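(* Let $T$ be a complete theory with elimination of imaginaries and monster model $\mathcal{U}$, and $C$ a small set. Let $p_0$ be a stably dominated type over $C$ with an extension $p$ over $C'=\mathrm{acl}(C)$, and let $f$ be a definable function whose domain contains the set of realisations of $p|\mathcal{U}$. Let $a\models p|\mathcal{U}$ and $C''=\mathrm{acl}(C)\cap\mathrm{dcl}(Ca)$. (i) The code for the germ of $f$ on $p$ is strong over $C''$. (ii) Suppose that $f(a)\in\mathrm{St}_{Ca}$. Then the code for the $p$-germ of $f$ lies in $\mathrm{St}_C$.
   Context: Stable domination: for a small set $D$, $\mathrm{St}_D$ is the many-sorted structure whose sorts are the $D$-definable subsets of $\mathcal{U}$ that are stable and stably embedded, with all $D$-definable relations (a stable structure); $\mathrm{St}_D(A)=\mathrm{St}_D\cap\mathrm{dcl}(DA)$. $A\,\perp\!\!\!\perp^{d}_D B$ means $\mathrm{St}_D(A),\mathrm{St}_D(B)$ are independent over $D$ in $\mathrm{St}_D$ and $\mathrm{tp}(B/D\,\mathrm{St}_D(A))\vdash\mathrm{tp}(B/DA)$; $\mathrm{tp}(A/D)$ is stably dominated if $A\,\perp\!\!\!\perp^d_D B$ whenever $\mathrm{St}_D(A)$ and $\mathrm{St}_D(B)$ are independent over $D$ in $\mathrm{St}_D$. A stably dominated type $p$ over $\mathrm{acl}(C)$ has a unique $\mathrm{Aut}(\mathcal{U}/\mathrm{acl}(C))$-invariant global extension, which is definable (over $\mathrm{acl}(C)$, indeed over $C''$ as in the claim); $p|\mathcal{U}$ denotes this global type, and ''the germ on $p$'' refers to germs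 with respect to it. Germs: let $q$ be a global type definable over a set $E$, and $f_b$ a function defined by a formula with parameter $b$ whose domain contains all realisations of $q|Eb$. The germ of $f_b$ on $q$ is the class of $b$ under the $E$-definable equivalence relation $b\sim b'$ iff the formula $f_b(x)=f_{b'}(x)$ lies in $q$. A code $e$ (an element of $\mathcal{U}$, by elimination of imaginaries) of this class is strong over $E$ if there is an $Ee$-definable function $g$ with $(f_b(x)=g(x))\in q$. *)

(* Defs.v *)
From mathcomp Require Import all_boot.
From mathcomp Require Import boolp classical_sets functions cardinality.

Set Implicit Arguments.
Unset Strict Implicit.
Unset Printing Implicit Defensive.

Local Open Scope classical_set_scope.
Local Open Scope card_scope.

Record language : Type := Language {
  lsort : Type;
  fsym : Type;
  farity : fsym -> nat;
  fdom : forall f : fsym, 'I_(farity f) -> lsort;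
  fcod : fsym -> lsort;
  rsym : Type;
  rarity : rsym -> nat;
  rdom : forall r : rsym, 'I_(rarity r) -> lsort }.

(** A variable context is a family [V : S -> Type], [V s] being the type of
    the variables of sort [s].  There is no named-variable bookkeeping: a
    quantifier over sort [s] binds the variable [New] of the context
    [ext V s]. *)

Inductive ext (S : Type) (V : S -> Type) (s : S) : S -> Type :=
| Old (t : S) (v : V t) : ext V s t
| New : ext V s s.
Arguments Old {S V s t} v.
Arguments New {S V s}.

Inductive vars (S I : Type) (so : I -> S) : S -> Type :=
| Var (i : I) : vars so (so i).
Arguments Var {S I so} i.

Definition vsum (S : Type) (V W : S -> Type) (s : S) : Type := (V s + W s)%type.

Definition novar (S : Type) (s : S) : Type := void.
Arguments novar {S} s.

Section Syntax.
Variable L : language.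

Inductive term (V : lsort L -> Type) : lsort L -> Type :=
| TVar (s : lsort L) (v : V s) : term V s
| TFun (f : fsym L) (ts : forall i, term V (fdom (f := f) i)) : term V (fcod f).

Inductive form (V : lsort L -> Type) : Type :=
| FBot : form V
| FEq (s : lsort L) (t u : term V s) : form V
| FRel (r : rsym L) (ts : forall i, term V (rdom (r := r) i)) : form V
| FImp (phi psi : form V) : form V
| FAll (s : lsort L) (phi : form (ext V s)) : form V.

Definition FNot (V : lsort L -> Type) (phi : form V) : form V :=
  FImp phi (FBot V).

Fixpoint trename (V W : lsort L -> Type) (r : forall s, V s -> W s)
    (s : lsort L) (t : term V s) : term W s :=
  match t in term _ s return term W s with
  | TVar s v => TVar (r s v)
  | TFun f ts => TFun (fun i => trename r (ts i))
  end.

Definition ext_map (V W : lsort L -> Type) (r : forall s, V s -> W s)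
    (s t : lsort L) (v : ext V s t) : ext W s t :=
  match v in ext _ _ t return ext W s t with
  | Old _ v => Old (r _ v)
  | New => New
  end.

Fixpoint rename (V W : lsort L -> Type) (r : forall s, V s -> W s)
    (phi : form V) : form W :=
  match phi with
  | FBot => FBot W
  | FEq s t u => FEq (trename r t) (trename r u)
  | FRel R ts => FRel (fun i => trename r (ts i))
  | FImp phi psi => FImp (rename r phi) (rename r psi)
  | FAll s phi => FAll (rename (@ext_map V W r s) phi)
  end.

Definition sentence : Type := form novar.

End Syntax.

Record structure (L : language) : Type := Structure {
  carrier :> lsort L -> Type;
  fint : forall f : fsym L,
    (forall i : 'I_(farity f), carrier (fdom i)) -> carrier (fcod f);
  rint : forall r : rsym L,
    (forall i : 'I_(rarity r), carrier (rdom i)) -> Prop }.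

Section Semantics.
Variables (L : language) (M : structure L).

Definition env (V : lsort L -> Type) : Type := forall s, V s -> M s.

Definition econs (V : lsort L -> Type) (e : env V) (s : lsort L) (m : M s) :
    env (ext V s) :=
  fun t v => match v in ext _ _ t return M t with
             | Old _ v => e _ v
             | New => m
             end.

Definition ejoin (V W : lsort L -> Type) (e : env V) (e' : env W) :
    env (vsum V W) :=
  fun s v => match v with inl x => e s x | inr y => e' s y end.

Definition tup (I : Type) (so : I -> lsort L) : Type := forall i, M (so i).

Definition tenv (I : Type) (so : I -> lsort L) (a : tup so) : env (vars so) :=
  fun s v => match v in vars _ s return M s with Var i => a i end.

Fixpoint teval (V : lsort L -> Type) (e : env V) (s : lsort L) (t : term V s) :
    M s :=
  match t in term _ s return M s with
  | TVar s v => e s v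
  | TFun f ts => fint (fun i => teval e (ts i))
  end.

Fixpoint sat (V : lsort L -> Type) (phi : form V) : env V -> Prop :=
  match phi with
  | FBot => fun _ => False
  | FEq s t u => fun e => teval e t = teval e u
  | FRel R ts => fun e => rint (fun i => teval e (ts i))
  | FImp phi psi => fun e => sat phi e -> sat psi e
  | FAll s phi => fun e => forall m : M s, sat phi (econs e m)
  end.

Definition sat1 (I : Type) (so : I -> lsort L) (phi : form (vars so))
    (x : tup so) : Prop := sat phi (tenv x).

Definition sat2 (I J : Type) (so : I -> lsort L) (to : J -> lsort L)
    (phi : form (vsum (vars so) (vars to))) (x : tup so) (y : tup to) : Prop :=
  sat phi (ejoin (tenv x) (tenv y)).

Definition sat3 (I J K : Type) (so : I -> lsort L) (to : J -> lsort L)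
    (zo : K -> lsort L)
    (phi : form (vsum (vars so) (vsum (vars to) (vars zo))))
    (x : tup so) (y : tup to) (z : tup zo) : Prop :=
  sat phi (ejoin (tenv x) (ejoin (tenv y) (tenv z))).

Definition models (T : set (sentence L)) : Prop :=
  forall phi, T phi -> sat phi (fun s v => match v with end).

Definition elt : Type := {s : lsort L & M s}.

Definition trange (I : Type) (so : I -> lsort L) (a : tup so) : set elt :=
  range (fun i => existT M (so i) (a i)).

(** L(M)-formulas: a parameter is a variable of the second summand, always
    interpreted by itself. *)
Definition lform (V : lsort L -> Type) : Type := form (vsum V M).

Definition lsat (I : Type) (so : I -> lsort L) (phi : lform (vars so))
    (x : tup so) : Prop :=
  sat phi (ejoin (tenv x) (fun s m => m)).

Definition par (A : set elt) (s : lsort L) : Type :=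
  {m : M s | A (existT M s m)}.

Definition forget_par (V : lsort L -> Type) (A : set elt) (s : lsort L)
    (v : vsum V (par A) s) : vsum V M s :=
  match v with inl x => inl x | inr m => inr (proj1_sig m) end.

(** The L(A)-formulas, as a subset of the L(M)-formulas. *)
Definition over (V : lsort L -> Type) (A : set elt) : set (lform V) :=
  range (fun phi : form (vsum V (par A)) => rename (@forget_par V A) phi).

Definition single (s : lsort L) : unit -> lsort L := fun _ => s.

Definition tup1 (s : lsort L) (m : M s) : tup (single s) := fun _ => m.

Definition dcl (A : set elt) : set elt :=
  [set u | exists2 phi : lform (vars (single (projT1 u))), over A phi &
     forall m, lsat phi (tup1 m) <-> m = projT2 u].

Definition acl (A : set elt) : set elt :=
  [set u | exists2 phi : lform (vars (single (projT1 u))), over A phi &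
     lsat phi (tup1 (projT2 u)) /\
     finite_set [set m : M (projT1 u) | lsat phi (tup1 m)]].

Definition realizes (I : Type) (so : I -> lsort L) (p : set (lform (vars so)))
    (a : tup so) : Prop := forall phi, p phi -> lsat phi a.

Definition finitely_satisfiable (I : Type) (so : I -> lsort L)
    (p : set (lform (vars so))) : Prop :=
  forall (n : nat) (phi : 'I_n -> lform (vars so)), (forall i, p (phi i)) ->
  exists a : tup so, forall i, lsat (phi i) a.

Definition complete_type (I : Type) (so : I -> lsort L) (A : set elt)
    (p : set (lform (vars so))) : Prop :=
  [/\ p `<=` over A, finitely_satisfiable p &
      forall phi, over A phi -> p phi \/ p (FNot phi)].

Definition tp (I : Type) (so : I -> lsort L) (a : tup so) (A : set elt) :
    set (lform (vars so)) := [set phi | over A phi /\ lsat phi a].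

Definition entails (I : Type) (so : I -> lsort L)
    (p q : set (lform (vars so))) : Prop :=
  forall a : tup so, realizes p a -> realizes q a.

Definition enumeration (B : set elt) :
    tup (fun u : {u : elt | B u} => projT1 (proj1_sig u)) :=
  fun u => projT2 (proj1_sig u).

(** The definable set [P] belongs to [q], i.e. some formula defining [P] does
    (for [q] complete over the whole of [M]: every such formula does). *)
Definition contains (I : Type) (so : I -> lsort L) (q : set (lform (vars so)))
    (P : set (tup so)) : Prop :=
  exists2 phi, q phi & forall x, lsat phi x <-> P x.

Record automorphism (g : forall s, M s -> M s) : Prop := {
  automorphism_bij : forall s, bijective (g s);
  automorphism_fun : forall (f : fsym L) (x : forall i, M (fdom (f := f) i)),
    g _ (fint x) = fint (fun i => g _ (x i));
  automorphism_rel : forall (r : rsym L) (x : forall i, M (rdom (r := r) i)),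
    rint (fun i => g _ (x i)) <-> rint x }.

Definition automorphism_over (A : set elt) (g : forall s, M s -> M s) : Prop :=
  automorphism g /\ forall s (m : M s), A (existT M s m) -> g s m = m.

Definition act_form (g : forall s, M s -> M s) (V : lsort L -> Type)
    (phi : lform V) : lform V :=
  rename (fun s v => match v with inl x => inl x | inr m => inr (g s m) end)
    phi.

Definition invariant_over (I : Type) (so : I -> lsort L) (A : set elt)
    (q : set (lform (vars so))) : Prop :=
  forall g, automorphism_over A g -> forall phi, q phi <-> q (act_form g phi).

(** No formula has the order property in the theory of [M]: a formula is
    unstable iff it orders arbitrarily long finite sequences. *)
Definition stable : Prop :=
  forall (n m : nat) (so : 'I_n -> lsort L) (to : 'I_m -> lsort L)
    (phi : form (vsum (vars so) (vars to))),
  ~ forall k : nat, exists (x : 'I_k -> tup so) (y : 'I_k -> tup to),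
      forall i j : 'I_k, sat2 phi (x i) (y j) <-> (i < j)%N.

(** Dividing and forking over [A] of the definable set [P]; in a saturated
    model they do not depend on the formula chosen to define [P]. *)
Definition divides (n : nat) (so : 'I_n -> lsort L) (A : set elt)
    (P : set (tup so)) : Prop :=
  exists (m : nat) (zo : 'I_m -> lsort L)
    (phi : form (vsum (vars so) (vars zo))) (d : tup zo),
    (forall x, P x <-> sat2 phi x d) /\
    exists (k : nat) (e : nat -> tup zo),
      (forall i, tp (e i) A = tp d A) /\
      forall t : 'I_k -> nat, injective t ->
        ~ exists x : tup so, forall l, sat2 phi x (e (t l)).

Definition forks (n : nat) (so : 'I_n -> lsort L) (A : set elt)
    (P : set (tup so)) : Prop :=
  exists (r : nat) (Q : 'I_r -> set (tup so)),
    (forall l, divides A (Q l)) /\ forall x, P x -> exists l, Q l x.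

Definition independent (A B D : set elt) : Prop :=
  forall (n : nat) (so : 'I_n -> lsort L) (a : tup so), trange a `<=` A ->
  forall phi : lform (vars so), over (B `|` D) phi -> lsat phi a ->
  ~ forks D [set x | lsat phi x].

End Semantics.

Definition consequence (L : language) (T : set (sentence L))
    (phi : sentence L) : Prop :=
  forall M : structure L, models M T ->
    sat (M := M) phi (fun s v => match v with end).

Definition complete_theory (L : language) (T : set (sentence L)) : Prop :=
  (exists M : structure L, models M T) /\
  forall phi, consequence T phi \/ consequence T (FNot phi).

Definition eliminates_imaginaries (L : language) (T : set (sentence L)) :
    Prop :=
  forall M : structure L, models M T ->
  forall (n : nat) (so : 'I_n -> lsort L)
    (E : form (vsum (vars so) (vars so))),
  (forall x : tup M so, sat2 E x x) ->
  (forall x y : tup M so, sat2 E x y -> sat2 E y x) ->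
  (forall x y z : tup M so, sat2 E x y -> sat2 E y z -> sat2 E x z) ->
  forall a : tup M so,
  exists (k : nat) (eo : 'I_k -> lsort L)
    (psi : form (vsum (vars so) (vars eo))),
  exists! e : tup M eo, forall x : tup M so, sat2 E x a <-> sat2 psi x e.

(** |A| < |K|; [K] stands for its cardinality. *)
Definition small (K T : Type) (A : set T) : Prop :=
  (A #<= [set: K]) /\ ~ ([set: K] #<= A).

Record monster (L : language) (K : Type) (M : structure L) : Prop := {
  monster_uncountable : small K [set: nat];
  monster_strong_limit : forall X : Type,
    small K [set: X] -> small K [set: set X];
  monster_sort : small K [set: lsort L];
  monster_fsym : small K [set: fsym L];
  monster_rsym : small K [set: rsym L];
  monster_saturated : forall (A : set (elt M)) (s : lsort L)
      (p : set (lform M (vars (single s)))),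
    small K A -> p `<=` over A -> finitely_satisfiable p ->
    exists a, realizes p a;
  monster_homogeneous : forall (I : Type) (so : I -> lsort L) (a b : tup M so),
    small K [set: I] -> (forall phi, sat1 phi a <-> sat1 phi b) ->
    exists2 g, automorphism g & forall i, g _ (a i) = b i }.

Section ElementaryExtension.
Variables (L : language) (M N : structure L) (j : forall s, M s -> N s).

Definition elementary : Prop :=
  forall (V : lsort L -> Type) (phi : form V) (e : env M V),
    sat phi e <-> sat phi (fun s v => j (e s v)).

Definition jelt (u : elt M) : elt N := existT N (projT1 u) (j (projT2 u)).

Definition jtup (I : Type) (so : I -> lsort L) (x : tup M so) : tup N so :=
  fun i => j (x i).

Definition realizes_in (I : Type) (so : I -> lsort L)
    (q : set (lform M (vars so))) (a : tup N so) : Prop :=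
  forall phi, q phi -> sat (M := N) phi (ejoin (tenv a) j).

End ElementaryExtension.

Section StablePart.
Variables (L : language) (M : structure L) (D : set (elt M)).

Record dset : Type := DSet {
  dsort : lsort L;
  dform : lform M (vars (single dsort));
  dform_over : over D dform }.

Definition dmem (X : dset) (m : M (dsort X)) : Prop :=
  lsat (dform X) (tup1 m).

(** The structure with sorts the [D]-definable sets [X j] and all
    [D]-definable relations between them. *)
Section Induced.
Variables (J : Type) (X : J -> dset).

Definition induced_language : language := {|
  lsort := J;
  fsym := void;
  farity := fun f => match f with end;
  fdom := fun f => match f with end;
  fcod := fun f => match f with end;
  rsym := {n : nat & {js : 'I_n -> J &
            {phi : lform M (vars (fun i => dsort (X (js i)))) | over D phi}}};
  rarity := fun r => projT1 r;
  rdom := fun r => projT1 (projT2 r) |}.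

Definition induced : structure induced_language :=
  @Structure induced_language
    (fun j => {m : M (dsort (X j)) | dmem m})
    (fun f => match f with end)
    (fun r x => lsat (proj1_sig (projT2 (projT2 r)))
                  (fun i => proj1_sig (x i))).

End Induced.

Definition stable_dset (X : dset) : Prop :=
  stable (induced (fun _ : unit => X)).

Definition dset_elts (X : dset) : set (elt M) :=
  [set u | exists2 m : M (dsort X), dmem m & u = existT M (dsort X) m].

Definition stably_embedded (X : dset) : Prop :=
  forall (n : nat) (phi : lform M (vars (fun _ : 'I_n => dsort X))),
  exists2 psi : lform M (vars (fun _ : 'I_n => dsort X)),
    over (D `|` dset_elts X) psi &
    forall x, (forall i, dmem (x i)) -> (lsat phi x <-> lsat psi x).

Definition St_sort : Type := {X : dset | stable_dset X /\ stably_embedded X}.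

Definition St_structure : structure (induced_language (@proj1_sig _ _)) :=
  induced (fun X : St_sort => proj1_sig X).

Definition St_val (u : elt St_structure) : elt M :=
  existT M (dsort (proj1_sig (projT1 u))) (proj1_sig (projT2 u)).

Definition St : set (elt M) := range St_val.

Definition St_of (A : set (elt M)) : set (elt M) := St `&` dcl (D `|` A).

(** Independence over [D] computed in the structure [St_D]; an element of
    [St_D] has one copy in each sort containing it, and every element of [D]
    has copies since singletons are stable and stably embedded. *)
Definition St_independent (A B : set (elt M)) : Prop :=
  independent (M := St_structure)
    (St_val @^-1` St_of A) (St_val @^-1` St_of B) (St_val @^-1` D).

Definition dom_independent (A B : set (elt M)) : Prop :=
  St_independent A B /\
  entails (tp (enumeration (B := B)) (D `|` St_of A))
          (tp (enumeration (B := B)) (D `|` A)).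

Definition stably_dominated (K : Type) (I : Type) (so : I -> lsort L)
    (p : set (lform M (vars so))) : Prop :=
  forall a : tup M so, realizes p a ->
  forall B : set (elt M), small K B ->
  St_independent (trange a) B -> dom_independent (trange a) B.

End StablePart.

Section Germs.
Variables (L : language) (M : structure L).
Variables (I J Z : Type).
Variables (so : I -> lsort L) (to : J -> lsort L) (zo : Z -> lsort L).
(** [F x y b] is the graph [y = f_b(x)]. *)
Variable F : form (vsum (vars so) (vsum (vars to) (vars zo))).

Definition functional (b : tup M zo) : Prop :=
  forall (x : tup M so) (y y' : tup M to),
    sat3 F x y b -> sat3 F x y' b -> y = y'.

(** [f_b(x) = f_b'(x)] is in [q]. *)
Definition same_germ (q : set (lform M (vars so))) (b b' : tup M zo) : Prop :=
  contains q [set x | exists2 y, sat3 F x y b & sat3 F x y b'].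

(** [e] is a code, over [E], of the germ of [f_b] on [q].  For [g] fixing [E]
    pointwise and [q] definable over [E], [g] maps the class of [b] onto the
    class of [g b], so [g] preserves the class iff [g b] and [b] have the same
    germ. *)
Definition germ_code (E : set (elt M)) (q : set (lform M (vars so)))
    (b : tup M zo) (k : nat) (eo : 'I_k -> lsort L) (e : tup M eo) : Prop :=
  forall g : forall s, M s -> M s, automorphism_over E g ->
    ((forall i, g _ (e i) = e i) <-> same_germ q (fun i => g _ (b i)) b).

Definition strong_over (E : set (elt M)) (q : set (lform M (vars so)))
    (b : tup M zo) (k : nat) (eo : 'I_k -> lsort L) (e : tup M eo) : Prop :=
  exists G : lform M (vsum (vars so) (vars to)),
    let graph x y := sat G (ejoin (ejoin (tenv x) (tenv y)) (fun s m => m)) in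
    [/\ over (E `|` trange e) G,
        forall (x : tup M so) (y y' : tup M to),
          graph x y -> graph x y' -> y = y' &
        contains q [set x | exists2 y, sat3 F x y b & graph x y]].

End Germs.

(* Main.v *)
(** Write [f_b] for the function.  The generic type [q] has a bound [N] such that a
    formula [phi(x, v)] in [q] holds for one of the terms of any Morley sequence of
    length [N]: for stable formulas this is the usual order argument, and stable
    domination with compactness gives it for all formulas.  Hence [q] is definable,
    it is the only invariant extension of [p0] with its restriction to [acl C], and
    its definition is over [C'']; elimination of imaginaries codes the germ by a
    tuple [e].

    If an automorphism over [C'' e a] moved [f_b(a)], then inserting [a] into a
    Morley sequence would give automorphisms over [C'' e] that fix the sequence and
    move the value of [f_b] at one chosen term; composing them yields [b'] with the
    germ of [b] but other values on the whole sequence, which the bound excludes.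
    So [f_b(a)] is definable over [C'' e a].

    For the second part, [e] is definable from the terms [c_i] of a Morley sequence
    and the values [f_b(c_i)], so it lies in a stable set over the [c_i].  Since [q]
    is definable the [c_i] can be removed one at a time, and a union of conjugates
    brings the parameters down to [C].  Such a set is stably embedded: in a larger
    model, an automorphism fixing its points in the small model preserves the trace
    of every formula on it, since types concentrated on the set and finitely
    satisfiable in those points are determined by their restriction to them. *)

Require Import Defs.
From Stdlib Require List.
From mathcomp Require Import all_boot zify.
From mathcomp Require Import boolp classical_sets cardinality filter.

Set Implicit Arguments.
Unset Strict Implicit.
Unset Printing Implicit Defensive.

Local Open Scope classical_set_scope.

(** Stable domination enters in a single form: a point with the type of a generic over [acl C] and
    with the right stable formulas over [e] is generic over [e]. Commutation, uniqueness and the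
    bound are therefore proved for stable formulas and then extended. When the bound is proved,
    membership of [phi(x, v)] in [q] is not known to be first-order in [v]; compactness is applied
    to two Morley sequences instead, one inside [phi] and one outside. An automorphism over [C'']
    may move points of [acl C], so invariance over [acl C] says nothing about it. It turns [q] into
    another invariant extension of [p0]; agreement over [acl C] holds because the trace of a formula
    at a generic, on the finitely many conjugates of its parameters, is coded in [C'']. For (ii),
    being stable and stably embedded is replaced by a condition on the ambient structure: no
    formula, with any parameters, has the order property on the set. It passes to finite products,
    definable images, finite unions and conjugates. The way back needs all points of the set as
    parameters. These need not be few enough for the saturation of [U], but they are for that of
    [N]. *)

Lemma existT_inj (S : Type) (P : S -> Type) (s : S) (x y : P s) :
  existT P s x = existT P s y -> x = y.
Proof.
move=> e.
have := congr1 (fun u : {s & P s} => projT1 u) e => /= e1.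
suff H : forall (u v : {s & P s}) (e : u = v) (e1 : projT1 u = projT1 v),
    eq_rect _ P (projT2 u) _ e1 = projT2 v.
  have := H _ _ e erefl; exact.
by move=> u v; case: v / => e2; rewrite (Prop_irrelevance e2 erefl).
Qed.

Lemma existT_elim (S : Type) (P : S -> Type) s s' (x : P s) (x' : P s')
    (Q : forall s, P s -> Prop) :
  existT P s x = existT P s' x' -> Q s x -> Q s' x'.
Proof.
move=> e; have es := congr1 (@projT1 _ _) e; rewrite /= in es; subst s'.
by rewrite (existT_inj e).
Qed.

Lemma funext2 (S : Type) (A B : S -> Type) (f g : forall s, A s -> B s) :
  (forall s v, f s v = g s v) -> f = g.
Proof.
by move=> h; apply: functional_extensionality_dep => s; apply: funext => v.
Qed.

(** * Formulas *)

Section Renaming.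
Variable L : language.
Notation ctx := (lsort L -> Type).
Implicit Types U V W : ctx.

Lemma teval_rename (M : structure L) V W (r : forall s, V s -> W s)
    (e : env M W) s (t : term V s) :
  teval e (trename r t) = teval (fun s v => e s (r s v)) t.
Proof.
elim: t => [//|f ts IH] /=; congr fint.
by apply: functional_extensionality_dep => i.
Qed.

Lemma sat_rename (M : structure L) V W (r : forall s, V s -> W s)
    (phi : form V) (e : env M W) :
  sat (rename r phi) e = sat phi (fun s v => e s (r s v)).
Proof.
elim: phi W r e => {V} [V|V s t u|V R ts|V phi IH1 psi IH2|V s phi IH] W r e //=.
- by rewrite !teval_rename.
- congr rint; apply: functional_extensionality_dep => i.
  by rewrite teval_rename.
- by rewrite IH1 IH2.
- apply: eq_forall => m; rewrite IH; congr sat.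
  by apply: funext2 => t [].
Qed.

Lemma trename_comp V W X (r : forall s, V s -> W s) (r' : forall s, W s -> X s)
    s (t : term V s) :
  trename r' (trename r t) = trename (fun s v => r' s (r s v)) t.
Proof.
elim: t => [//|f ts IH] /=; congr TFun.
by apply: functional_extensionality_dep => i.
Qed.

Lemma rename_comp V W X (r : forall s, V s -> W s) (r' : forall s, W s -> X s)
    (phi : form V) :
  rename r' (rename r phi) = rename (fun s v => r' s (r s v)) phi.
Proof.
elim: phi W X r r' => {V} [V|V s t u|V R ts|V phi IH1 psi IH2|V s phi IH]
    W X r r' //=.
- by rewrite !trename_comp.
- congr FRel; apply: functional_extensionality_dep => i.
  by rewrite trename_comp.
- by rewrite IH1 IH2.
- rewrite IH; congr FAll; congr (rename _ phi).
  by apply: funext2 => t [].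
Qed.

Lemma trename_id V s (t : term V s) : trename (fun s v => v) t = t.
Proof.
elim: t => [//|f ts IH] /=; congr TFun.
by apply: functional_extensionality_dep => i.
Qed.

Lemma rename_id V (phi : form V) : rename (fun s v => v) phi = phi.
Proof.
elim: phi => {V} [V|V s t u|V R ts|V phi IH1 psi IH2|V s phi IH] //=.
- by rewrite !trename_id.
- congr FRel; apply: functional_extensionality_dep => i.
  by rewrite trename_id.
- by rewrite IH1 IH2.
- rewrite -[in RHS]IH; congr FAll; congr (rename _ phi).
  by apply: funext2 => t [].
Qed.

Definition FTrue V : form V := FNot (FBot V).
Definition FAnd V (phi psi : form V) := FNot (FImp phi (FNot psi)).
Definition FOr V (phi psi : form V) := FImp (FNot phi) psi.
Definition FIff V (phi psi : form V) := FAnd (FImp phi psi) (FImp psi phi).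
Definition FEx1 V s (phi : form (ext V s)) := FNot (FAll (FNot phi)).
Definition FConj V (l : seq (form V)) := foldr (@FAnd V) (FTrue V) l.
Definition FDisj V (l : seq (form V)) := foldr (@FOr V) (FBot V) l.

Arguments FNot : simpl never.
Arguments FTrue : simpl never.
Arguments FAnd : simpl never.
Arguments FOr : simpl never.
Arguments FEx1 : simpl never.
Arguments FIff : simpl never.

Section Sat.
Variables (M : structure L) (V : ctx).
Implicit Types (e : env M V) (phi psi : form V).

Lemma sat_not phi e : sat (FNot phi) e = ~ sat phi e.
Proof. by []. Qed.

Lemma sat_and phi psi e : sat (FAnd phi psi) e = (sat phi e /\ sat psi e).
Proof.
apply/propext; rewrite /FAnd /=; split; last by move=> [a b] h; exact: (h a b).
by move=> h; split; apply: contrapT => h'; apply: h => a b; apply: h'.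
Qed.

Lemma sat_or phi psi e : sat (FOr phi psi) e = (sat phi e \/ sat psi e).
Proof.
apply/propext; rewrite /FOr /=; split; last by case=> // h h'; case: (h' h).
by move=> h; case: (pselect (sat phi e)) => [|/h]; [left|right].
Qed.

Lemma sat_iff phi psi e : sat (FIff phi psi) e = (sat phi e <-> sat psi e).
Proof. by rewrite sat_and. Qed.

Lemma sat_true e : sat (FTrue V) e = True.
Proof. by rewrite propeqE; split=> // _ []. Qed.

Lemma sat_ex1 s (phi : form (ext V s)) e :
  sat (FEx1 phi) e = exists m, sat phi (econs e m).
Proof.
apply/propext; split; last by move=> [m h] h'; exact: (h' m h).
by move=> h; apply: contrapT => h'; apply: h => m hm; apply: h'; exists m.
Qed.

Lemma sat_conj (l : seq (form V)) e :
  sat (FConj l) e = (forall phi, List.In phi l -> sat phi e).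
Proof.
apply/propext; elim: l => [|phi l IH]; first by rewrite sat_true.
rewrite (sat_and phi (FConj l)) IH; split; first by move=> [h1 h2] psi [<-|/h2].
by move=> h; split=> [|psi hp]; apply: h; [left|right].
Qed.

Lemma sat_disj (l : seq (form V)) e :
  sat (FDisj l) e = (exists2 phi, List.In phi l & sat phi e).
Proof.
apply/propext; elim: l => [|phi l IH]; first by split=> // -[].
rewrite (sat_or phi (FDisj l)) IH; split.
  by move=> [h|[psi h1 h2]]; [exists phi => //; left|exists psi => //; right].
move=> [psi [<-|h1] h2]; [by left|by right; exists psi].
Qed.

End Sat.

Definition fin V := exists l : seq {s & V s}, forall s (v : V s), List.In (existT V s v) l.

Lemma in_map_List (A B : Type) (f : A -> B) (l : seq A) x :
  List.In x l -> List.In (f x) (map f l).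
Proof. by elim: l => //= y l IH [->|/IH]; [left|right]. Qed.

Lemma map_in_List (A B : Type) (f : A -> B) (l : seq A) y :
  List.In y (map f l) -> exists2 x, List.In x l & f x = y.
Proof.
elim: l => //= a l IH [<-|/IH[x h e]]; first by exists a => //; left.
by exists x => //; right.
Qed.

Lemma in_cat_List (A : Type) (l l' : seq A) x :
  List.In x (l ++ l') <-> List.In x l \/ List.In x l'.
Proof.
elim: l => [|y l IH] /=; first by split=> [|[]//]; right.
by rewrite IH; tauto.
Qed.

Lemma List_in (T : eqType) (l : seq T) x : List.In x l <-> x \in l.
Proof.
elim: l => // y l IH /=; rewrite inE IH; split.
  by move=> [->|->]; rewrite ?eqxx ?orbT.
by move/orP => [/eqP->|]; [left|right].
Qed.

Lemma fin_vars n (so : 'I_n -> lsort L) : fin (vars so).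
Proof.
exists (map (fun i => existT (vars so) (so i) (Var i)) (enum 'I_n)) => s [i].
by apply: in_map_List; apply/List_in; rewrite mem_enum.
Qed.

Definition cprod (I : Type) W : ctx := fun s => (I * W s)%type.

Lemma fin_cprod n W : fin W -> fin (cprod 'I_n W).
Proof.
move=> [l hl].
exists (flatten (map (fun i => map (fun u => existT (cprod 'I_n W) (projT1 u)
   (i, projT2 u)) l) (enum 'I_n))) => s [i v].
have : i \in enum 'I_n by rewrite mem_enum.
elim: (enum 'I_n) => //= j l' IH; rewrite inE => /orP[/eqP<-|/IH h].
  by apply/in_cat_List; left; exact: (in_map_List _ (hl s v)).
by apply/in_cat_List; right.
Qed.

(** The list may repeat variables, so only a retraction onto [V] is available; this is enough to
    quantify over a block. *)
Lemma fin_section V : fin V ->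
  exists n (so : 'I_n -> lsort L) (f : forall s, vars so s -> V s)
    (g : forall s, V s -> vars so s), forall s v, f s (g s v) = v.
Proof.
move=> [l hl].
pose so (i : 'I_(size l)) := projT1 (tnth (in_tuple l) i).
pose f s (x : vars so s) : V s := match x in vars _ s return V s with
   Var i => projT2 (tnth (in_tuple l) i) end.
have hf (u : {s & V s}) : List.In u l -> exists x, f (projT1 u) x = projT2 u.
  move=> hu.
  suff [i hi] : exists i, tnth (in_tuple l) i = u.
    by case: u / hi hu => _; exists (Var i).
  clear - hu; elim: l hu => //= v l IH [<-|/IH[i hi]]; first by exists ord0.
  by exists (lift ord0 i); rewrite (tnth_nth v) /= -hi (tnth_nth v).
have hg s v : {x | f s x = v} by apply: cid; exact: (hf (existT V s v) (hl s v)).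
exists (size l), so, f, (fun s v => projT1 (hg s v)) => s v.
by case: (hg s v).
Qed.

Definition sum_map V V' W W' (f : forall s, V s -> V' s) (g : forall s, W s -> W' s) s
    (v : vsum V W s) : vsum V' W' s :=
  match v with inl x => inl (f s x) | inr y => inr (g s y) end.

Lemma ejoinE (M : structure L) V W (e : env M (vsum V W)) :
  ejoin (fun s v => e s (inl v)) (fun s v => e s (inr v)) = e.
Proof. by apply: funext2 => s []. Qed.

Lemma tenvE (M : structure L) (I : Type) (so : I -> lsort L) (e : env M (vars so)) :
  tenv (fun i => e _ (Var i)) = e.
Proof. by apply: funext2 => s []. Qed.

Lemma ex_block V n (so : 'I_n -> lsort L) (phi : form (vsum V (vars so))) :
  exists psi : form V, forall (M : structure L) (e : env M V),
    sat psi e <-> exists w : env M (vars so), sat phi (ejoin e w).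
Proof.
elim: n so V phi => [|n IH] so V phi.
  have no s : vars so s -> False by move=> [[]].
  exists (rename (fun s (v : vsum V (vars so) s) =>
     match v with inl x => x | inr y => match no s y with end end) phi) => M e.
  rewrite sat_rename; split.
    move=> h; exists (fun s v => match no s v with end); move: h.
    congr sat; apply: funext2 => s [//|y]; by case: (no s y).
  by move=> [w]; congr sat; apply: funext2 => s [//|y]; case: (no s y).
pose so' k := so (lift ord0 k).
(* Case analysis on an index changes the sort [so i]. So [R] chooses the image of each variable
   together with its equations, transported along an equality of indices; [Prop_irrelevance] then
   removes the transport. *)
have [r hr] : { r : forall s, vars so s -> vsum (ext V (so ord0)) (vars so') s |
   r _ (Var ord0) = inl New /\ forall k, r _ (Var (lift ord0 k)) = inr (Var k) }.
  have R i : { x : vsum (ext V (so ord0)) (vars so') (so i) |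
     (forall e : ord0 = i, x = match e in _ = i return vsum (ext V (so ord0)) (vars so') (so i) with erefl => inl New end)
     /\ (forall k (e : lift ord0 k = i), x = match e in _ = i return vsum (ext V (so ord0)) (vars so') (so i) with erefl => inr (Var k) end) }.
    case: (unliftP ord0 i) => [k|] ->.
      exists (inr (Var k)); split=> [e|k' e].
        by exfalso; have := neq_lift ord0 k; rewrite -e eqxx.
      have ek := lift_inj e; subst k'; by rewrite (Prop_irrelevance e erefl).
    exists (inl New); split=> [e|k e]; first by rewrite (Prop_irrelevance e erefl).
    by exfalso; have := neq_lift ord0 k; rewrite e eqxx.
  exists (fun s x => match x in vars _ s return vsum (ext V (so ord0)) (vars so') s with
     Var i => sval (R i) end); split => [|k] /=.
    by case: (R ord0) => x [h _] /=; rewrite (h erefl).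
  by case: (R _) => x [_ h] /=; rewrite (h k erefl).
pose rho s (v : vsum V (vars so) s) : vsum (ext V (so ord0)) (vars so') s :=
  match v with inl x => inl (Old x) | inr y => r s y end.
have [psi hpsi] := IH so' (ext V (so ord0)) (rename rho phi).
exists (FEx1 psi) => M e; rewrite sat_ex1; split.
  move=> [m /hpsi[w]]; rewrite sat_rename => h.
  exists (fun s y => ejoin (econs e m) w (r s y)).
  by move: h; congr sat; apply: funext2 => s [|].
move=> [w h]; exists (w _ (Var ord0)); apply/hpsi.
exists (fun s (x : vars so' s) => match x in vars _ s return M s with
   Var k => w _ (Var (lift ord0 k)) end).
rewrite sat_rename; move: h; congr sat; apply: funext2 => s [//|[i]] /=.
case: (unliftP ord0 i) => [k|] ->.
  by rewrite hr.2.
by rewrite hr.1.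
Qed.

Lemma ex_block_fin V W (phi : form (vsum V W)) : fin W ->
  exists psi : form V, forall (M : structure L) (e : env M V),
    sat psi e <-> exists w : env M W, sat phi (ejoin e w).
Proof.
move=> /fin_section[n [so [f [g fg]]]].
have [psi h] := ex_block (rename (sum_map (fun s v => v) g) phi).
exists psi => M e; rewrite h; split.
  move=> [w]; rewrite sat_rename => hw; exists (fun s v => w s (g s v)).
  by move: hw; congr sat; apply: funext2 => s [].
move=> [w hw]; exists (fun s x => w s (f s x)); rewrite sat_rename.
by move: hw; congr sat; apply: funext2 => s [//|y] /=; rewrite fg.
Qed.

Definition FEx V W (fW : fin W) (phi : form (vsum V W)) : form V :=
  projT1 (cid (ex_block_fin phi fW)).

Lemma sat_ex V W (fW : fin W) (phi : form (vsum V W)) (M : structure L) (e : env M V) :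
  sat (FEx fW phi) e = exists w, sat phi (ejoin e w).
Proof. by rewrite /FEx; case: cid => psi h /=; apply/propext. Qed.

Definition FAl V W (fW : fin W) (phi : form (vsum V W)) : form V :=
  FNot (FEx fW (FNot phi)).

Lemma sat_al V W (fW : fin W) (phi : form (vsum V W)) (M : structure L) (e : env M V) :
  sat (FAl fW phi) e = forall w, sat phi (ejoin e w).
Proof.
rewrite sat_not sat_ex propeqE; split.
  by move=> h w; apply: contrapT => h'; apply: h; exists w.
by move=> h [w h']; exact: (h' (h w)).
Qed.

Definition lctx V (l : seq {s & V s}) : ctx := fun s => {v : V s | List.In (existT V s v) l}.

Definition lsub V (l l' : seq {s & V s}) (h : forall u, List.In u l -> List.In u l')
   s (v : lctx l s) : lctx l' s := exist _ (sval v) (h _ (proj2_sig v)).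

Definition lval V (l : seq {s & V s}) s (v : lctx l s) : V s := sval v.

Lemma fsupp_term V s (t : term V s) :
  exists (l : seq {s & V s}) (t' : term (lctx l) s), t = trename (@lval V l) t'.
Proof.
elim: t => [{}s v|f ts IH].
  by exists [:: existT V s v], (TVar (exist _ v (or_introl erefl))).
have IHa i := cid (IH i).
pose ll i := projT1 (IHa i).
have IHb i : {t' : term (lctx (ll i)) (fdom i) | ts i = trename (@lval V _) t'}.
  by apply: cid; rewrite /ll; case: (IHa i) => l [t' e] /=; exists t'.
pose l := flatten (map ll (enum 'I_(farity f))).
have hl i u : List.In u (ll i) -> List.In u l.
  rewrite /l; have : i \in enum 'I_(farity f) by rewrite mem_enum.
  elim: (enum _) => //= j s' IH'; rewrite inE => /orP[/eqP<-|/IH' h] hu.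
    by apply/in_cat_List; left.
  by apply/in_cat_List; right; exact: h.
exists l, (TFun (fun i => trename (@lsub V _ _ (hl i)) (sval (IHb i)))).
rewrite /=; congr TFun; apply: functional_extensionality_dep => i.
by rewrite trename_comp; case: (IHb i).
Qed.

Lemma fsupp_list V (phi : form V) :
  exists (l : seq {s & V s}) (phi' : form (lctx l)), phi = rename (@lval V l) phi'.
Proof.
elim: phi => {V} [V|V s t u|V R ts|V phi IH1 psi IH2|V s phi IH].
- by exists [::], (FBot _).
- have [l1 [t' ->]] := fsupp_term t; have [l2 [u' ->]] := fsupp_term u.
  have h1 : forall w, List.In w l1 -> List.In w (l1 ++ l2).
    by move=> w hw; apply/in_cat_List; left.
  have h2 : forall w, List.In w l2 -> List.In w (l1 ++ l2).
    by move=> w hw; apply/in_cat_List; right.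
  exists (l1 ++ l2), (FEq (trename (@lsub V _ _ h1) t') (trename (@lsub V _ _ h2) u')).
  by rewrite /= !trename_comp.
- have IHa i := cid (fsupp_term (ts i)).
  pose ll i := projT1 (IHa i).
  have IHb i : {t' : term (lctx (ll i)) (rdom i) | ts i = trename (@lval V _) t'}.
    by apply: cid; rewrite /ll; case: (IHa i) => l [t' e] /=; exists t'.
  pose l := flatten (map ll (enum 'I_(rarity R))).
  have hl i u : List.In u (ll i) -> List.In u l.
    rewrite /l; have : i \in enum 'I_(rarity R) by rewrite mem_enum.
    elim: (enum _) => //= j s' IH'; rewrite inE => /orP[/eqP<-|/IH' h] hu.
      by apply/in_cat_List; left.
    by apply/in_cat_List; right; exact: h.
  exists l, (FRel (fun i => trename (@lsub V _ _ (hl i)) (sval (IHb i)))).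
  rewrite /=; congr FRel; apply: functional_extensionality_dep => i.
  by rewrite trename_comp; case: (IHb i).
- have [l1 [t' ->]] := IH1; have [l2 [u' ->]] := IH2.
  have h1 : forall w, List.In w l1 -> List.In w (l1 ++ l2).
    by move=> w hw; apply/in_cat_List; left.
  have h2 : forall w, List.In w l2 -> List.In w (l1 ++ l2).
    by move=> w hw; apply/in_cat_List; right.
  exists (l1 ++ l2), (FImp (rename (@lsub V _ _ h1) t') (rename (@lsub V _ _ h2) u')).
  by rewrite /= !rename_comp.
- have [l [phi' ->]] := IH.
  pose old (u : {t & ext V s t}) : option {t & V t} :=
    match u with existT t v => match v in ext _ _ t return option {t & V t} with
       Old t v => Some (existT V t v) | New => None end end.
  pose l' := pmap old l.
  have hl' t (v : V t) : List.In (existT (ext V s) t (Old v)) l -> List.In (existT V t v) l'.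
    rewrite /l'; elim: (l) => //= a l0 IH0 [->|/IH0 h] /=; first by left.
    by case: (old a) => [b|] //=; right.
  pose r t (x : lctx l t) : ext (lctx l') s t :=
    match x with exist v h =>
      match v in ext _ _ t return List.In (existT (ext V s) t v) l -> ext (lctx l') s t with
      | Old t v => fun h => Old (exist _ v (hl' t v h))
      | New => fun _ => New end h end.
  exists l', (FAll (rename r phi')) => /=; congr FAll.
  rewrite rename_comp; congr (rename _ phi').
  by apply: funext2 => t [[]].
Qed.

Lemma fin_lctx V (l : seq {s & V s}) : fin (lctx l).
Proof.
suff H : forall l' : seq {s & V s}, (forall u, List.In u l' -> List.In u l) ->
   exists m : seq {s & lctx l s}, forall s v (h : List.In (existT V s v) l),
     List.In (existT V s v) l' -> List.In (existT (lctx l) s (exist _ v h)) m.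
  have [m hm] := H l (fun u h => h).
  by exists m => s [v h]; exact: hm.
elim=> [|[s v] l' IH] hl; first by exists [::].
have [m hm] := IH (fun u h => hl u (or_intror h)).
exists (existT (lctx l) s (exist _ v (hl _ (or_introl erefl))) :: m).
move=> t w h /= [e|e]; last by right; exact: hm.
left; move: (hl _ _) => h'.
have F (u u' : {s & V s}) (_ : u = u') (k : List.In (existT V (projT1 u) (projT2 u)) l)
    (k' : List.In (existT V (projT1 u') (projT2 u')) l) :
    existT (lctx l) (projT1 u) (exist _ (projT2 u) k) =
    existT (lctx l) (projT1 u') (exist _ (projT2 u') k').
  by subst u'; rewrite (Prop_irrelevance k k').
exact: F e _ _.
Qed.

(** A context of parameters is usually infinite, while quantifier blocks and elimination of
    imaginaries need the finite tuple of parameters that really occurs. *)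
Lemma fsupp V W (phi : form (vsum V W)) :
  exists n (so : 'I_n -> lsort L) (phi' : form (vsum V (vars so)))
    (r : forall s, vars so s -> W s),
    phi = rename (sum_map (fun s v => v) r) phi'.
Proof.
have [l [phi' ->]] := fsupp_list phi.
have [n [so [f [g fg]]]] := fin_section (fin_lctx l).
pose pick (u : {s & vsum V W s}) : option {s & W s} :=
  match projT2 u with inl _ => None | inr w => Some (existT W _ w) end.
pose l2 := pmap pick l.
have hl2 s (w : W s) : List.In (existT (vsum V W) s (inr w)) l -> List.In (existT W s w) l2.
  rewrite /l2; elim: (l) => //= a l0 IH0 [->|/IH0 h] /=; first by left.
  by case: (pick a) => [b|] //=; right.
have [n2 [so2 [f2 [g2 fg2]]]] := fin_section (fin_lctx l2).
pose r s (x : lctx l s) : vsum V (vars so2) s :=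
  match x with exist v h =>
   match v return List.In (existT (vsum V W) s v) l -> vsum V (vars so2) s with
   | inl v => fun _ => inl v
   | inr w => fun h => inr (g2 s (exist _ w (hl2 s w h))) end h end.
exists n2, so2, (rename r phi'), (fun s x => lval (f2 s x)).
rewrite rename_comp; congr (rename _ phi'); apply: funext2 => s [[v|w] h] //=.
by rewrite fg2.
Qed.

Lemma fsupp0 V (phi : form V) :
  exists n (so : 'I_n -> lsort L) (phi' : form (vars so))
    (r : forall s, vars so s -> V s), phi = rename r phi'.
Proof.
have [l [phi' ->]] := fsupp_list phi.
have [n [so [f [g fg]]]] := fin_section (fin_lctx l).
exists n, so, (rename g phi'), (fun s x => lval (f s x)).
by rewrite rename_comp; congr (rename _ phi'); apply: funext2 => s v; rewrite fg.
Qed.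

End Renaming.

(** * Cardinals *)

Definition lec (X Y : Type) : Prop := exists f : X -> Y, injective f.

Lemma lec_trans X Y Z : lec X Y -> lec Y Z -> lec X Z.
Proof. by move=> [f fi] [g gi]; exists (g \o f); exact: inj_comp. Qed.

(** Zorn's lemma on graphs of partial injections: if a maximal one misses a point on each side, the
    pair of these points can be added. *)
Lemma lec_total X Y : lec X Y \/ lec Y X.
Proof.
pose P (R : set (X * Y)) := forall u v, R u -> R v -> (u.1 = v.1 <-> u.2 = v.2).
have [|R [PR Rmax]] := @Zorn_bigcup _ P.
  move=> F FP Ft u v [A FA Au] [B FB Bv].
  case: (Ft A B FA FB) => h; first exact: (FP _ FB _ _ (h _ Au) Bv).
  exact: (FP _ FA _ _ Au (h _ Bv)).
have [h|h] := pselect (forall x, exists y, R (x, y)).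
  left; exists (fun x => projT1 (cid (h x))) => x x'.
  by case: cid => y Ry /=; case: cid => y' Ry' /= e; apply/(PR _ _ Ry Ry').
have [h'|h'] := pselect (forall y, exists x, R (x, y)).
  right; exists (fun y => projT1 (cid (h' y))) => y y'.
  by case: cid => x Rx /=; case: cid => x' Rx' /= e; apply/(PR _ _ Rx Rx').
move: h h' => /existsNP[x nx] /existsNP[y ny].
case: (Rmax (R `|` [set (x, y)])).
  split; first by move=> u Ru; left.
  by move=> H; case: nx; exists y; apply: H; right.
move=> u v [Ru|->] [Rv|->]; first exact: PR.
- split=> /= e; first by case: nx; exists u.2; rewrite -e -surjective_pairing.
  by case: ny; exists u.1; rewrite -e -surjective_pairing.
- split=> /= e; first by case: nx; exists v.2; rewrite e -surjective_pairing.
  by case: ny; exists v.1; rewrite e -surjective_pairing.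
- by [].
Qed.

Lemma card_leE (T U : Type) (A : set T) (B : set U) :
  (A #<= B)%card <-> lec {x | A x} {y | B y}.
Proof.
have iA : injective (fun x : {x | A x} => SigSub (mem_set (proj2_sig x)) : A).
  by move=> [x hx] [y hy] /(congr1 val) /= e; subst y; rewrite (Prop_irrelevance hx hy).
have iB : injective (fun y : B => exist B (val y) (set_mem (valP y))).
  by move=> x y /(congr1 sval) /= /val_inj.
have iA' : injective (fun x : A => exist A (val x) (set_mem (valP x))).
  by move=> x y /(congr1 sval) /= /val_inj.
have iB' : injective (fun x : {x | B x} => SigSub (mem_set (proj2_sig x)) : B).
  by move=> [x hx] [y hy] /(congr1 val) /= e; subst y; rewrite (Prop_irrelevance hx hy).
split.
  move=> /card_leP/injfunPex[f _ fi].
  have {}fi : injective f by move=> x y; apply: fi; rewrite inE.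
  exact: (ex_intro _ _ (inj_comp iB (inj_comp fi iA))).
move=> [f fi]; apply/card_leP/injfunPex.
by eexists; last by move=> x y _ _; exact: (inj_comp iB' (inj_comp fi iA')).
Qed.

Lemma lec_setT X : lec {x | [set: X] x} X /\ lec X {x | [set: X] x}.
Proof.
split; first by exists sval => -[x hx] [y hy] /= e; subst y; rewrite (Prop_irrelevance hx hy).
by exists (fun x => exist _ x I) => x y /(congr1 sval).
Qed.

Definition sml (K X : Type) : Prop := lec X K /\ ~ lec K X.

Lemma smallE K T (A : set T) : small K A <-> sml K {x | A x}.
Proof.
have [h h'] := lec_setT K.
split=> -[h1 h2]; split.
- by move/card_leE : h1 => h1; exact: lec_trans h1 h.
- by move=> h3; apply: h2; apply/card_leE; exact: lec_trans h h3.
- by apply/card_leE; exact: lec_trans h1 h'.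
- by move=> /card_leE h3; apply: h2; exact: lec_trans h' h3.
Qed.

Lemma sml_le K X Y : lec X Y -> sml K Y -> sml K X.
Proof.
move=> XY [YK nKY]; split; first exact: lec_trans XY YK.
by move=> KX; apply: nKY; exact: lec_trans KX XY.
Qed.

Lemma smallT K X : small K [set: X] <-> sml K X.
Proof.
have [h h'] := lec_setT X.
by rewrite smallE; split; exact: sml_le.
Qed.

Section StrongLimit.
Variable K : Type.
Hypothesis K_nat : small K [set: nat].
Hypothesis K_pow : forall X : Type, small K [set: X] -> small K [set: set X].

Lemma sml_nat : sml K nat. Proof. exact/smallT. Qed.

Lemma sml_set X : sml K X -> sml K (set X).
Proof. by move=> /smallT/K_pow/smallT. Qed.

Lemma sml_count (X : countType) : sml K X.
Proof. by apply: (sml_le _ sml_nat); exists choice.pickle; exact: pcan_inj choice.pickleK. Qed.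

Lemma set1_inj X (x y : X) : [set x] = [set y] -> x = y.
Proof. by move=> e; have : [set y] x by rewrite -e. Qed.

(** Kuratowski pairs. The strong limit hypothesis absorbs the two power sets, so no cardinal
    arithmetic is developed. *)
Lemma lec_prod X : lec (X * X) (set (set X)).
Proof.
exists (fun u => [set [set u.1]; [set u.1; u.2]]) => -[x y] [x' y'] /= e.
have ex : x = x'.
  have : [set [set x]; [set x; y]] [set x'] by rewrite e; left.
  case=> e1; first by rewrite (set1_inj e1).
  by have : [set x'] x by rewrite e1; left.
subst x'; congr pair.
have : [set [set x]; [set x; y]] [set x; y'] by rewrite e; right.
have : [set [set x]; [set x; y']] [set x; y] by rewrite -e; right.
move=> [e1|e1] [e2|e2].
- have : [set x] y by rewrite -e1; right.
  have : [set x] y' by rewrite -e2; right.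
  by move=> -> ->.
- have : [set x; y] y' by rewrite -e2; right.
  rewrite e1 => ->.
  by have : [set x] y by rewrite -e1; right.
- have : [set x; y'] y by rewrite -e1; right.
  rewrite e2 => ->.
  by have : [set x] y' by rewrite -e2; right.
- have : [set x; y'] y by rewrite -e1; right.
  move=> [yx|//].
  have : [set x; y] y' by rewrite -e2; right.
  by move=> [|]; rewrite yx.
Qed.

Lemma lec_pair X X' Y Y' : lec X X' -> lec Y Y' -> lec (X * Y) (X' * Y').
Proof.
move=> [f fi] [g gi]; exists (fun u => (f u.1, g u.2)) => -[x y] [x' y'] /=.
by move=> [/fi-> /gi->].
Qed.

Lemma lec_refl X : lec X X. Proof. by exists id. Qed.

Lemma sml_prod X Y : sml K X -> sml K Y -> sml K (X * Y).
Proof.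
move=> sX sY; case: (lec_total X Y) => h.
  apply: (sml_le (lec_trans (lec_pair h (lec_refl Y)) (lec_prod Y))).
  exact/sml_set/sml_set.
apply: (sml_le (lec_trans (lec_pair (lec_refl X) h) (lec_prod X))).
exact/sml_set/sml_set.
Qed.

Lemma sml_sum X Y : sml K X -> sml K Y -> sml K (X + Y).
Proof.
move=> sX sY.
suff H : lec (X + Y) (nat * (set X * set Y)).
  apply: (sml_le H); apply: sml_prod; first exact: sml_nat.
  by apply: sml_prod; exact: sml_set.
(* [set0] fills the missing component, since [X] or [Y] may be empty. *)
exists (fun u => match u with inl x => (0%N, ([set x], set0)) | inr y => (1%N, (set0, [set y])) end).
by move=> [x|y] [x'|y'] // [] e; rewrite (set1_inj e).
Qed.

End StrongLimit.

(** * Counting formulas *)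

Section FormulaCount.
Variables (L : language) (A : Type).
Notation ctx := (lsort L -> Type).

(** A syntax tree is coded by the set of its (position, label) pairs; the
    variable bound at depth [d] is labelled [inr d]. *)
Definition label : Type :=
  ((A + nat) + Defs.fsym L + (rsym L + (lsort L + nat)))%type.
Definition code : Type := set (seq nat * label).

Definition node (l : label) (kids : nat -> code) : code :=
  [set u | match u.1 with [::] => u.2 = l | i :: p => kids i (p, u.2) end].

Lemma node_inj l l' k k' : node l k = node l' k' -> l = l' /\ k = k'.
Proof.
move=> e; split.
  by have : node l' k' ([::], l) by rewrite -e.
apply: funext => i; apply/seteqP; split=> -[p x] h.
  by have : node l' k' (i :: p, x) by rewrite -e.
by have : node l k (i :: p, x) by rewrite e.
Qed.

Fixpoint tenc (V : ctx) (lv : forall s, V s -> A + nat) s (t : term V s) : code :=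
  match t with
  | TVar s v => node (inl (inl (lv s v))) (fun _ => set0)
  | TFun f ts => node (inl (inr f))
      (fun i => if insub i is Some j then tenc lv (ts j) else set0)
  end.

Definition lvinj (V : ctx) (lv : forall s, V s -> A + nat) :=
  forall s s' (v : V s) (v' : V s'), lv s v = lv s' v' -> existT V s v = existT V s' v'.

Lemma tenc_inj (V : ctx) (lv : forall s, V s -> A + nat) : lvinj lv ->
  forall s s' (t : term V s) (t' : term V s'), tenc lv t = tenc lv t' ->
  existT (term V) s t = existT (term V) s' t'.
Proof.
move=> li s s' t; elim: t s' => [{}s v|f ts IH] s' [{}s' v'|f' ts'] /= /node_inj[] // [] e1.
  by move=> _; exact: (existT_elim (Q := fun s'' w => existT (term V) s (TVar v) = existT (term V) s'' (TVar w)) (li _ _ _ _ e1)).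
subst f' => e2; congr existT; congr TFun.
apply: functional_extensionality_dep => i.
have := congr1 (fun k => k (val i)) e2; rewrite valK => /IH; exact: existT_inj.
Qed.

Definition lvext (V : ctx) (lv : forall s, V s -> A + nat) (d : nat) (s t : lsort L)
    (v : ext V s t) : A + nat :=
  match v with Old t v => lv t v | New => inr d end.

Definition two (a b : code) (i : nat) : code := if i is 0%N then a else b.

Fixpoint fenc (V : ctx) (d : nat) (lv : forall s, V s -> A + nat) (phi : form V) : code :=
  match phi with
  | FBot => fun _ => node (inr (inr (inr 0%N))) (fun _ => set0)
  | FEq s t u => fun lv => node (inr (inr (inr 1%N))) (two (tenc lv t) (tenc lv u))
  | FRel r ts => fun lv => node (inr (inl r))
      (fun i => if insub i is Some j then tenc lv (ts j) else set0)
  | FImp phi psi => fun lv => node (inr (inr (inr 2%N))) (two (fenc d lv phi) (fenc d lv psi))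
  | FAll s phi => fun lv => node (inr (inr (inl s))) (fun _ => fenc d.+1 (lvext lv d (s := s)) phi)
  end lv.

(** The labels of variables bound further out stay below the depth [d], so the label [inr d] of the
    next bound variable is fresh and [lvext] is again injective. *)
Lemma fenc_inj (V : ctx) (phi phi' : form V) d (lv : forall s, V s -> A + nat) : lvinj lv ->
  (forall s v k, lv s v = inr k -> (k < d)%N) ->
  fenc d lv phi = fenc d lv phi' -> phi = phi'.
Proof.
elim: phi phi' d lv => {V} [V|V s t u|V R ts|V phi IH1 psi IH2|V s phi IH]
  [|s' t' u'|R' ts'|phi' psi'|s' phi'] d lv li ld //= /node_inj[] //=.
- move=> _ e; have /(tenc_inj li) e1 := congr1 (fun k => k 0%N) e.
  have /(tenc_inj li) e2 := congr1 (fun k => k 1%N) e.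
  have es := congr1 (@projT1 _ _) e1; rewrite /= in es; subst s'.
  by rewrite (existT_inj e1) (existT_inj e2).
- move=> [] e; subst R' => e2; congr FRel.
  apply: functional_extensionality_dep => i.
  have := congr1 (fun k => k (val i)) e2; rewrite valK => /(tenc_inj li); exact: existT_inj.
- move=> _ e; have e1 := IH1 _ _ _ li ld (congr1 (fun k => k 0%N) e).
  by have e2 := IH2 _ _ _ li ld (congr1 (fun k => k 1%N) e); rewrite e1 e2.
- move=> [] e; subst s' => /(congr1 (fun k => k 0%N)) e; congr FAll.
  apply: (IH _ d.+1 _ _ _ e).
    move=> t t' [{}t v|] [{}t' v'|] //=.
    + by move=> /li e2; exact: (existT_elim (Q := fun s'' w => existT (ext V s) t (Old v) = existT (ext V s) s'' (Old w)) e2).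
    + by move=> /ld; rewrite ltnn.
    + by move=> /esym/ld; rewrite ltnn.
  by move=> t [{}t v|] k //=; [move=> /ld/ltnW|move=> [->]].
Qed.

End FormulaCount.

(** * Small contexts in a monster model *)

Section Monster.
Variables (K : Type) (L : language) (M : structure L).
Hypothesis Mm : monster K M.
Notation ctx := (lsort L -> Type).

Definition smV (V : ctx) := sml K {s & V s}.

Let Kn := monster_uncountable Mm.
Let Kp := monster_strong_limit Mm.

Lemma smV_vsum (V W : ctx) : smV V -> smV W -> smV (vsum V W).
Proof.
move=> sV sW; apply: sml_le (sml_sum Kn Kp sV sW).
exists (fun u => match projT2 u with inl v => inl (existT V _ v) | inr w => inr (existT W _ w) end).
move=> [s [v|w]] [s' [v'|w']] //= e.
  have ee := congr1 (fun u => if u is inl x then x else existT V s v) e; rewrite /= in ee.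
  exact: (existT_elim (Q := fun s'' x => existT (vsum V W) s (inl v) = existT (vsum V W) s'' (inl x)) ee).
have ee := congr1 (fun u => if u is inr x then x else existT W s w) e; rewrite /= in ee.
exact: (existT_elim (Q := fun s'' x => existT (vsum V W) s (inr w) = existT (vsum V W) s'' (inr x)) ee).
Qed.

Lemma smV_cprod I (V : ctx) : sml K I -> smV V -> smV (cprod I V).
Proof.
move=> sI sV; apply: sml_le (sml_prod Kp sI sV).
exists (fun u => ((projT2 u).1, existT V _ (projT2 u).2)).
move=> [s [i v]] [s' [i' v']] /= e.
have e1 := congr1 fst e; have e2 := congr1 snd e; rewrite /= in e1 e2.
by subst i'; exact: (existT_elim (Q := fun s'' x => existT (cprod I V) s (i, v) = existT (cprod I V) s'' (i, x)) e2).
Qed.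

Lemma smV_vars I (so : I -> lsort L) : sml K I -> smV (vars so).
Proof.
apply: sml_le; exists (fun u => match projT2 u with Var i => i end).
by move=> [s [i]] [s' [i']] /= ->.
Qed.

Lemma smV_fin n (so : 'I_n -> lsort L) : smV (vars so).
Proof. exact/smV_vars/(sml_count Kn). Qed.

Lemma smV_par (A : set (elt M)) : small K A -> smV (par A).
Proof.
move=> /smallE; apply: sml_le.
exists (fun u => exist A (existT _ (projT1 u) (sval (projT2 u))) (proj2_sig (projT2 u))).
move=> [s [m h]] [s' [m' h']] /= /(congr1 sval) /= e.
have es := congr1 (@projT1 _ _) e; rewrite /= in es; subst s'.
have em := existT_inj e; subst m'; by rewrite (Prop_irrelevance h h').
Qed.

Definition erange (V : ctx) (e : env M V) : set (elt M) :=
  [set u | exists v : V (projT1 u), e _ v = projT2 u].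

Lemma small_erange (V : ctx) (e : env M V) : smV V -> small K (erange e).
Proof.
move=> sV; apply/smallE; apply: sml_le sV.
exists (fun u : {u | erange e u} => existT V (projT1 (sval u)) (projT1 (cid (proj2_sig u)))).
move=> [[s m] h] [[s' m'] h'] /=; case: cid => v /= ev; case: cid => v' /= ev' ee.
have es := congr1 (@projT1 _ _) ee; rewrite /= in es; subst s'.
have ev2 := existT_inj ee; subst v'; subst m; subst m'.
by rewrite (Prop_irrelevance h h').
Qed.

End Monster.

(** * Automorphisms and saturation *)

Section Automorphisms.
Variables (L : language) (M : structure L).
Notation ctx := (lsort L -> Type).

Definition app (V : ctx) (g : forall s, M s -> M s) (e : env M V) : env M V :=
  fun s v => g s (e s v).

Definition eqtp (V : ctx) (e e' : env M V) := forall phi : form V, sat phi e <-> sat phi e'.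

Lemma teval_aut g (V : ctx) (e : env M V) s (t : term V s) : automorphism g ->
  teval (app g e) t = g s (teval e t).
Proof.
move=> ga; elim: t => [//|f ts IH] /=; rewrite (automorphism_fun ga); congr fint.
by apply: functional_extensionality_dep => i.
Qed.

Lemma sat_aut g (V : ctx) (phi : form V) (e : env M V) : automorphism g ->
  sat phi (app g e) = sat phi e.
Proof.
move=> ga; elim: phi e => {V} [V|V s t u|V R ts|V phi IH1 psi IH2|V s phi IH] e //=.
- rewrite !teval_aut// propeqE; split=> [e12|->//].
  exact: (bij_inj (automorphism_bij ga s) e12).
- rewrite -[RHS](propext (automorphism_rel ga _)); congr rint.
  by apply: functional_extensionality_dep => i; rewrite (teval_aut _ _ ga).
- by rewrite IH1 IH2.
- have H m : sat phi (econs (app g e) (g s m)) = sat phi (econs e m).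
    by rewrite -[RHS]IH; congr sat; apply: funext2 => t [].
  have [h gh hg] := automorphism_bij ga s.
  rewrite propeqE; split=> hm m; first by rewrite -H.
  by rewrite -(hg m) H.
Qed.

Lemma eqtp_refl (V : ctx) (e : env M V) : eqtp e e. Proof. by []. Qed.

Lemma eqtp_sym (V : ctx) (e e' : env M V) : eqtp e e' -> eqtp e' e.
Proof. by move=> h phi; rewrite h. Qed.

Lemma eqtp_sub (V W : ctx) (r : forall s, V s -> W s) (e e' : env M W) :
  eqtp e e' -> eqtp (fun s v => e s (r s v)) (fun s v => e' s (r s v)).
Proof. by move=> h phi; have := h (rename r phi); rewrite !sat_rename. Qed.

Lemma eqtp_imp (V : ctx) (e e' : env M V) :
  (forall phi, sat phi e -> sat phi e') -> eqtp e e'.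
Proof.
move=> h phi; split; first exact: h.
by move=> h'; apply: contrapT => n; exact: (h (FNot phi) n h').
Qed.

Lemma app_ejoin (V W : ctx) g (e : env M V) (e' : env M W) :
  app g (ejoin e e') = ejoin (app g e) (app g e').
Proof. by apply: funext2 => s []. Qed.

Lemma ejoin_inj (V W : ctx) (e e1 : env M V) (e' e1' : env M W) :
  ejoin e e' = ejoin e1 e1' -> e = e1 /\ e' = e1'.
Proof.
move=> h; split; apply: funext2 => s v.
  exact: (congr1 (fun e : env M (vsum V W) => e s (inl v)) h).
exact: (congr1 (fun e : env M (vsum V W) => e s (inr v)) h).
Qed.

Lemma aut_comp (g h : forall s, M s -> M s) : automorphism g -> automorphism h ->
  automorphism (fun s m => g s (h s m)).
Proof.
move=> ga ha; split=> [s|f x|r x].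
- exact: (bij_comp (automorphism_bij ga s) (automorphism_bij ha s)).
- by rewrite (automorphism_fun ha) (automorphism_fun ga).
- exact: (iff_trans (automorphism_rel ga _) (automorphism_rel ha _)).
Qed.

Lemma aut_inv (g : forall s, M s -> M s) : automorphism g ->
  exists h : forall s, M s -> M s,
   [/\ automorphism h, forall s m, h s (g s m) = m & forall s m, g s (h s m) = m].
Proof.
move=> ga.
have H s : {h : M s -> M s | cancel (g s) h /\ cancel h (g s)}.
  by apply: cid; have [h] := automorphism_bij ga s; exists h.
have H1 s m : sval (H s) (g s m) = m by case: (H s) => h [].
have H2 s m : g s (sval (H s) m) = m by case: (H s) => h [].
exists (fun s => sval (H s)); split=> //; split=> [s|f x|r x].
- by exists (g s).
- apply: (bij_inj (automorphism_bij ga _)); rewrite H2 (automorphism_fun ga).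
  by congr fint; apply: functional_extensionality_dep => i; rewrite H2.
- apply: (iff_trans (iff_sym (automorphism_rel ga _))).
  suff -> : (fun i => g (rdom i) (sval (H (rdom i)) (x i))) = x by [].
  by apply: functional_extensionality_dep => i.
Qed.

End Automorphisms.

Definition mkpar (L : language) (M : structure L) (A : set (elt M)) s (m : M s)
  (h : A (existT M s m)) : par A s := exist _ m h.

(** * Homogeneity and saturation for small contexts *)

Section Saturation.
Variables (K : Type) (L : language) (M : structure L).
Hypothesis Mm : monster K M.
Notation ctx := (lsort L -> Type).
Notation smV := (smV K).

Lemma hom (V : ctx) (e e' : env M V) : smV V -> eqtp e e' ->
  exists g, automorphism g /\ app g e = e'.
Proof.
move=> /smallT sV ee.
pose so := @projT1 (lsort L) V.
have [|g ga gh] := monster_homogeneous Mm (so := so)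
  (a := fun u => e _ (projT2 u)) (b := fun u => e' _ (projT2 u)) sV.
  move=> phi; rewrite /sat1.
  pose r s (x : vars so s) : V s := match x with Var u => projT2 u end.
  have := ee (rename r phi); rewrite !sat_rename.
  have H e0 : (fun s v => e0 s (r s v)) = tenv (M := M) (so := so) (fun u => e0 _ (projT2 u)).
    by apply: funext2 => s [].
  by rewrite !H.
exists g; split=> //; apply: funext2 => s v.
exact: (gh (existT V s v)).
Qed.

Definition upd (W : ctx) (w : env M W) s0 (v0 : W s0) (m : M s0) : env M W :=
  fun s v => match pselect (existT W s0 v0 = existT W s v) with
   | left h => eq_rect s0 M m s (congr1 (@projT1 _ _) h)
   | right _ => w s v end.

Lemma upd_same (W : ctx) (w : env M W) s0 (v0 : W s0) (m : M s0) :
  upd w v0 m v0 = m.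
Proof.
rewrite /upd; case: pselect => // h.
by rewrite (Prop_irrelevance (congr1 _ h) erefl).
Qed.

Lemma upd_other (W : ctx) (w : env M W) s0 (v0 : W s0) (m : M s0) s (v : W s) :
  existT W s0 v0 <> existT W s v -> upd w v0 m v = w s v.
Proof. by rewrite /upd; case: pselect. Qed.

Section Realise.
Variables (V W : ctx) (e : env M V) (Sig : set (form (vsum W V))).
Hypotheses (sV : smV V) (sW : smV W).

Definition agree (S : set {s & W s}) (w w' : env M W) :=
  forall s v, S (existT W s v) -> w' s v = w s v.

(** The states of the Zorn argument in [realise]: the values on [t.1] are settled, those outside are
    provisional. *)
Definition okst (t : set {s & W s} * env M W) :=
  forall l : seq (form (vsum W V)), (forall phi, List.In phi l -> Sig phi) ->
  exists w', agree t.1 t.2 w' /\ forall phi, List.In phi l -> sat phi (ejoin w' e).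

Definition stpar (S : set {s & W s}) (w : env M W) : set (elt M) :=
  erange e `|` [set u | exists v : W (projT1 u), S (existT W _ v) /\ w _ v = projT2 u].

Lemma small_stpar S w : small K (stpar S w).
Proof.
apply/smallE.
have /smallE s1 := small_erange e sV; have /smallE s2 := small_erange w sW.
apply: sml_le (sml_sum (monster_uncountable Mm) (monster_strong_limit Mm) s1 s2).
have H (u : {u | stpar S w u}) : {x : {u | erange e u} + {u | erange w u} |
    match x with inl y => sval y = sval u | inr y => sval y = sval u end}.
  case: u => u /= hu; case: (pselect (erange e u)) => h; first by exists (inl (exist _ u h)).
  have h2 : erange w u by case: hu => // -[v [_ hv]]; exists v.
  by exists (inr (exist _ u h2)).
exists (fun u => sval (H u)) => u u' /=; case: (H u) => -[x|x] /= hx; case: (H u') => -[y|y] //= hy [exy].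
  by subst y; move: u u' hx hy => [u hu] [u' hu'] /= -> e2; subst u'; rewrite (Prop_irrelevance hu hu').
by subst y; move: u u' hx hy => [u hu] [u' hu'] /= -> e2; subst u'; rewrite (Prop_irrelevance hu hu').
Qed.

(** Finitely many variables occur in [l]. The settled ones and the values of [e] become parameters,
    [v0] becomes the free variable, and the others are quantified away in a finite block; this makes
    saturation in one variable applicable. *)
Lemma step_form S w s0 (v0 : W s0) (l : seq (form (vsum W V))) :
  ~ S (existT W s0 v0) ->
  exists2 chi : lform M (vars (single s0)), Defs.over (stpar S w) chi &
    forall m, lsat chi (tup1 m) <-> exists w', [/\ agree S w w', w' s0 v0 = m &
      forall phi, List.In phi l -> sat phi (ejoin w' e)].
Proof.
move=> nS; have [n [so [phi0 [r er]]]] := fsupp0 (FConj l).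
(* Rebuilds an assignment on [W] from values [x'] of the finite block; a variable that does not
   occur keeps its provisional value. *)
pose W' (m : M s0) (x' : env M (vars so)) : env M W := fun s u =>
  match pselect (S (existT W s u) \/ existT W s0 v0 = existT W s u) with
  | left _ => upd w v0 m u
  | right _ => match pselect (exists x, r s x = inl u) with
     | left h => x' s (sval (cid h))
     | right _ => w s u end end.
have wS m s u : S (existT W s u) -> upd w v0 m u = w s u.
  by move=> hS; apply: upd_other => h; apply: nS; rewrite h.
have Wag m x' : agree S w (W' m x').
  by move=> s u hS; rewrite /W'; case: pselect => [_|[]]; [exact: wS|left].
have W0 m x' : W' m x' s0 v0 = m.
  by rewrite /W'; case: pselect => [_|[]]; [exact: upd_same|right].
pose A := stpar S w.
have [kap hkap] : {kap : forall s, vars so s -> vsum (vsum (vars (single s0)) (par A)) (vars so) s |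
   forall s x m x', ejoin (ejoin (tenv (tup1 m)) (fun s (c : par A s) => sval c)) x' (kap s x) =
     ejoin (W' m x') e (r s x)}.
  suff H s (x : vars so s) : {y : vsum (vsum (vars (single s0)) (par A)) (vars so) s |
    forall m x', ejoin (ejoin (tenv (tup1 m)) (fun s (c : par A s) => sval c)) x' y =
     ejoin (W' m x') e (r s x)}.
    by exists (fun s x => sval (H s x)) => s x; case: (H s x).
  case E: (r s x) => [u|v] /=; last first.
    have h : A (existT _ s (@e s v)) by left; exists v.
    by exists (inl (inr (mkpar h))).
  case: (pselect (S (existT W s u))) => hS.
    have h : A (existT _ s (w s u)) by right; exists u.
    by exists (inl (inr (mkpar h))) => m x' /=; rewrite Wag.
  case: (pselect (existT W s0 v0 = existT W s u)) => h0.
    have es := congr1 (@projT1 _ _) h0; rewrite /= in es; subst s.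
    have eu := existT_inj h0; subst u.
    by exists (inl (inl (Var tt))) => m x' /=; rewrite W0.
  have h : exists x, r s x = inl u by exists x.
  exists (inr (sval (cid h))) => m x'; rewrite /= /W'.
  case: pselect => [[]//|_]; case: pselect => [h'|//].
  by rewrite (Prop_irrelevance h h').
pose chi0 := FEx (fin_vars so) (rename kap phi0).
exists (rename (@forget_par _ _ _ A) chi0); first by exists chi0.
have sE w' : sat (FConj l) (ejoin w' e) = sat phi0 (fun s x => ejoin w' e (r s x)).
  by rewrite er sat_rename.
move=> m; rewrite /lsat sat_rename.
have -> : (fun s v => ejoin (tenv (tup1 m)) (fun s m => m) (forget_par (A := A) v)) =
   ejoin (tenv (tup1 m)) (fun s (c : par A s) => sval c) by apply: funext2 => s [].
rewrite sat_ex; split.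
  move=> [x']; rewrite sat_rename => h; exists (W' m x'); split=> //.
  suff : sat (FConj l) (ejoin (W' m x') e) by rewrite sat_conj.
  by rewrite sE; move: h; congr sat; apply: funext2 => s x; exact: hkap.
move=> [w' [ag em hl]]; exists (fun s x => ejoin w' e (r s x)).
have : sat (FConj l) (ejoin w' e) by rewrite sat_conj.
rewrite sE sat_rename; congr sat; apply: funext2 => s x; rewrite hkap.
case E: (r s x) => [u|v] //=; rewrite /W'; case: pselect => [[hS|h0]|_].
- by rewrite wS // ag.
- have es := congr1 (@projT1 _ _) h0; rewrite /= in es; subst s.
  by have eu := existT_inj h0; subst u; rewrite upd_same.
- case: pselect => [h|[]]; last by exists x.
  by case: cid => y /= ->.
Qed.

Lemma step_ok S w s0 (v0 : W s0) : okst (S, w) -> ~ S (existT W s0 v0) ->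
  exists m, okst (S `|` [set existT W s0 v0], upd w v0 m).
Proof.
move=> ok nS.
pose p : set (lform M (vars (single s0))) := [set chi | Defs.over (stpar S w) chi /\
   exists2 l, (forall phi, List.In phi l -> Sig phi) & forall m, lsat chi (tup1 m) <->
     exists w', [/\ agree S w w', w' s0 v0 = m &
      forall phi, List.In phi l -> sat phi (ejoin w' e)]].
have [|| a ha] := monster_saturated Mm (p := p) (small_stpar S w).
- by move=> chi [].
- move=> n phi hp.
  have H i : {l | (forall phi, List.In phi l -> Sig phi) /\ forall m, lsat (phi i) (tup1 m) <->
     exists w', [/\ agree S w w', w' s0 v0 = m &
      forall phi, List.In phi l -> sat phi (ejoin w' e)]}.
    by apply: cid; have [_ [l h1 h2]] := hp i; exists l.
  pose l := flatten (map (fun i => sval (H i)) (enum 'I_n)).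
  have inl_ i psi : List.In psi (sval (H i)) -> List.In psi l.
    rewrite /l; have : i \in enum 'I_n by rewrite mem_enum.
    elim: (enum _) => //= j s IH; rewrite inE => /orP[/eqP<-|/IH h] hin.
      by apply/in_cat_List; left.
    by apply/in_cat_List; right; exact: h.
  have [|w' [ag hw]] := ok l.
    rewrite /l; elim: (enum _) => //= j s IH psi /in_cat_List[]; last exact: IH.
    by case: (H j) => l' [h _] /=; exact: h.
  exists (tup1 (w' s0 v0)) => i; have [_ h2] := proj2_sig (H i); apply/h2.
  by exists w'; split=> // psi /inl_; exact: hw.
exists (a tt) => l hl.
have [chi ch hc] := step_form w l nS.
have /hc[w' [ag em hw]] : lsat chi (tup1 (a tt)).
  have -> : tup1 (a tt) = a by apply: functional_extensionality_dep => -[].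
  by apply: ha; split=> //; exists l.
exists w'; split=> //= s v; case=> [hS|h0].
  by rewrite upd_other ?ag // => h; apply: nS; rewrite h.
have es := congr1 (@projT1 _ _) h0; rewrite /= in es; subst s.
by have eu := existT_inj h0; subst v; rewrite upd_same.
Qed.

(** Saturation treats one variable at a time. Zorn's lemma settles the variables of [W]
    successively, and [step_ok] shows that a maximal state has settled all of them. *)
Lemma realise :
  (forall l : seq (form (vsum W V)), (forall phi, List.In phi l -> Sig phi) ->
    exists w, forall phi, List.In phi l -> sat phi (ejoin w e)) ->
  exists w, forall phi, Sig phi -> sat phi (ejoin w e).
Proof.
move=> fs; have [wd _] := fs [::] (fun phi h => False_ind _ h).
have ok0 : okst (set0, wd).
  by move=> l hl; have [w hw] := fs l hl; exists w; split=> // s v [].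
pose T := {t | okst t}.
pose R (t t' : T) := `[< (sval t).1 `<=` (sval t').1 /\ agree (sval t).1 (sval t).2 (sval t').2 >].
have [||A At|[[S w] ok] mx] := @ZL_preorder T (exist _ _ ok0) R.
- by move=> t; apply/asboolP; split.
- move=> r s t /asboolP[h1 h2] /asboolP[h3 h4]; apply/asboolP; split.
    by move=> x /h1/h3.
  by move=> x v hv; rewrite h4 ?h2 //; exact: h1.
- pose S : set {s & W s} := [set v | exists2 t, A t & (sval t).1 v].
  pose w : env M W := fun s v => match pselect (S (existT W s v)) with
    left h => (sval (projT1 (cid2 h))).2 s v | right _ => wd s v end.
  have wE t s v : A t -> (sval t).1 (existT W s v) -> w s v = (sval t).2 s v.
    move=> At' hv; rewrite /w; case: pselect => [h|[]]; last by exists t.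
    case: cid2 => t' /= At1 ht1.
    case: (At _ _ At' At1) => /asboolP[_ h']; first by rewrite h'.
    by rewrite h'.
  have okS : okst (S, w).
    case: (pselect (exists t, A t)) => [[t0 At0]|nA]; last first.
      move=> l hl; have [w' hw'] := fs l hl; exists w'; split=> // s v [t At' _].
      by case: nA; exists t.
    move=> l hl.
    (* A finite part of [Sig] mentions finitely many variables, so a single member of the chain has
       already settled all those among them that the union settles. *)
    have [ll [phi' er]] := fsupp_list (FConj l).
    have [t At1 ht] : exists2 t, A t & forall s v, List.In (existT (vsum W V) s (inl v)) ll ->
       S (existT W s v) -> (sval t).1 (existT W s v).
      elim: (ll) => [|[s0 u0] l0 [t At1 IH]]; first by exists t0.
      case: (pselect (exists2 v, u0 = inl v & S (existT W s0 v))) => [[v ev [t' At' hv]]|nv].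
        case: (At _ _ At1 At') => /asboolP[h' _].
          exists t' => // s v' /= [h0|h0] hS; last exact/h'/IH.
          have es := congr1 (@projT1 _ _) h0; rewrite /= in es; subst s.
          by have := existT_inj h0; rewrite ev => -[<-].
        exists t => // s v' /= [h0|h0] hS; last exact: IH.
        have es := congr1 (@projT1 _ _) h0; rewrite /= in es; subst s.
        by have := existT_inj h0; rewrite ev => -[<-]; exact: h'.
      exists t => // s v' /= [h0|h0] hS; last exact: IH.
      have es := congr1 (@projT1 _ _) h0; rewrite /= in es; subst s.
      by case: nv; exists v' => //; exact: existT_inj h0.
    have [w' [ag hw']] := proj2_sig t l hl.
    pose w'' : env M W := fun s v => if pselect (S (existT W s v)) then w s v else w' s v.
    exists w''; split; first by move=> s v hS; rewrite /w''; case: pselect.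
    suff : sat (FConj l) (ejoin w'' e) by rewrite sat_conj.
    have : sat (FConj l) (ejoin w' e) by rewrite sat_conj.
    rewrite er !sat_rename; congr sat; apply: funext2 => s [[v|v] hv] //=.
    rewrite /w''; case: pselect => // hS.
    have h := ht _ _ hv hS; by rewrite (wE t) // ag.
  exists (exist _ _ okS) => t At'; apply/asboolP; split=> /=.
    by move=> v hv; exists t.
  by move=> s v hv; exact: wE.
have full s v : S (existT W s v).
  apply: contrapT => nS; have [m ok'] := step_ok ok nS.
  have /mx/asboolP[h _] : R (exist _ _ ok) (exist _ _ ok').
    apply/asboolP; split=> /=; first by move=> x; left.
    by move=> s' v' hv; apply: upd_other => h'; apply: nS; rewrite h'.
  by apply/nS/h; right.
exists w => phi hphi; have [|w' [ag hw]] := ok [:: phi].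
  by move=> psi [<-|[]].
have -> : w = w' by apply: funext2 => s v; rewrite (ag s v (full s v)).
by apply: hw; left.
Qed.

End Realise.
End Saturation.

(** * Global invariant types *)

Section Definability.
Variables (K : Type) (L : language) (M : structure L).
Hypothesis Mm : monster K M.
Notation ctx := (lsort L -> Type).
Notation smV := (smV K).

(** Compactness twice. A point of the set whose type over [b] had a realisation outside would be
    moved out of the set by an automorphism, so each point lies in a subset definable over [b]; then
    finitely many such subsets cover the set. *)
Lemma invdef (B W D : ctx) (b : env M B) (d : env M D) (th : form (vsum W D)) :
  smV B -> smV W -> smV D ->
  (forall g, automorphism g -> app g b = b -> forall x : env M W,
     sat th (ejoin x d) -> sat th (ejoin (app g x) d)) ->
  exists chi : form (vsum W B), forall x, sat chi (ejoin x b) <-> sat th (ejoin x d).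
Proof.
move=> sB sW sD hinv.
pose impl (chi : form (vsum W B)) := forall x, sat chi (ejoin x b) -> sat th (ejoin x d).
pose lB s (v : vsum W B s) : vsum W (vsum B D) s :=
  match v with inl x => inl x | inr c => inr (inl c) end.
pose lD s (v : vsum W D s) : vsum W (vsum B D) s :=
  match v with inl x => inl x | inr c => inr (inr c) end.
have elB x chi : sat (rename lB chi) (ejoin x (ejoin b d)) = sat chi (ejoin x b).
  by rewrite sat_rename; congr sat; apply: funext2 => s [].
have elD x chi : sat (rename lD chi) (ejoin x (ejoin b d)) = sat chi (ejoin x d).
  by rewrite sat_rename; congr sat; apply: funext2 => s [].
have sBD : smV (vsum B D) by exact: (smV_vsum Mm).
have stepA x : sat th (ejoin x d) -> exists2 chi, impl chi & sat chi (ejoin x b).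
  move=> hx; apply: contrapT => nh.
  pose Sig : set (form (vsum W (vsum B D))) := [set phi | phi = FNot (rename lD th) \/
     exists2 chi, phi = rename lB chi & sat chi (ejoin x b)].
  have [l hl|x' hx'] := @realise _ _ _ Mm _ _ (ejoin b d) Sig sBD sW.
    have [chi h1 h2] : exists2 chi, sat chi (ejoin x b) & forall x', sat chi (ejoin x' b) ->
       ~ sat th (ejoin x' d) -> forall phi, List.In phi l -> sat phi (ejoin x' (ejoin b d)).
      elim: l hl => [|phi l IH] hl; first by exists (FTrue _) => //; rewrite sat_true.
      have [|chi h1 h2] := IH; first by move=> psi h; apply: hl; right.
      case: (hl phi (or_introl erefl)) => [e|[chi' e hc]].
        exists chi => // x' hx' nx' psi [<-|h]; last exact: h2.
        by rewrite e sat_not elD.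
      exists (FAnd chi chi'); first by rewrite sat_and.
      move=> x'; rewrite sat_and => -[k1 k2] nx' psi [<-|h]; last exact: h2.
      by rewrite e elB.
    apply: contrapT => nex; apply: nh; exists chi => // x' hx'.
    by apply: contrapT => nx'; apply: nex; exists x'; exact: h2.
  have ee : eqtp (ejoin x b) (ejoin x' b).
    apply: eqtp_imp => phi hphi; rewrite -elB; apply: hx'; right; by exists phi.
  have [g [ga]] := hom Mm (smV_vsum Mm sW sB) ee.
  rewrite app_ejoin => /ejoin_inj[gx gb].
  have /(_ (or_introl erefl)) := hx' (FNot (rename lD th)).
  by rewrite sat_not elD -gx; apply; exact: hinv.
pose Sig : set (form (vsum W (vsum B D))) := [set phi | phi = rename lD th \/
   exists2 chi, phi = FNot (rename lB chi) & impl chi].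
apply: contrapT => nex.
have [l hl|x hx] := @realise _ _ _ Mm _ _ (ejoin b d) Sig sBD sW.
  have [chi h1 h2] : exists2 chi, impl chi & forall x, sat th (ejoin x d) ->
      ~ sat chi (ejoin x b) -> forall phi, List.In phi l -> sat phi (ejoin x (ejoin b d)).
    elim: l hl => [|phi l IH] hl; first by exists (FBot _).
    have [|chi h1 h2] := IH; first by move=> psi h; apply: hl; right.
    case: (hl phi (or_introl erefl)) => [e|[chi' e hc]].
      exists chi => // x' hx' nx' psi [<-|h]; last exact: h2.
      by rewrite e elD.
    exists (FOr chi chi'); first by move=> x'; rewrite sat_or => -[/h1|/hc].
    move=> x' k1; rewrite sat_or => nx' psi [<-|h]; last by apply: h2 => // ?; apply: nx'; left.
    by rewrite e sat_not elB => ?; apply: nx'; right.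
  apply: contrapT => nx; apply: nex; exists chi => x; split; first exact: h1.
  by move=> hx; apply: contrapT => nc; apply: nx; exists x; exact: h2.
have /stepA[chi h1 h2] : sat th (ejoin x d) by rewrite -elD; apply: hx; left.
have := hx (FNot (rename lB chi)); rewrite sat_not elB; apply => //.
by right; exists chi.
Qed.

(** Elimination of imaginaries is applied to the relation that two parameter tuples define the same
    set. Uniqueness of the code turns preservation of the set into fixing the code. *)
Lemma canonical_parameter (T : set (sentence L)) (TEI : eliminates_imaginaries T)
    (MT : models M T) (W D : ctx) (th : form (vsum W D)) (d : env M D) : fin W ->
  exists k (eo : 'I_k -> lsort L) (e : tup M eo), forall g, automorphism g ->
   ((forall i, g _ (e i) = e i) <->
    (forall u, sat th (ejoin u (app g d)) <-> sat th (ejoin u d))).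
Proof.
move=> fW; have [n [so [th0 [r ->]]]] := fsupp th.
pose dd : tup M so := fun i => d _ (r _ (Var i)).
have ed g : (fun s v => app g d (r s v)) = tenv (fun i => g _ (dd i)).
  by apply: funext2 => s [].
have ed0 : (fun s v => d s (r s v)) = tenv dd by apply: funext2 => s [].
pose l1 s (v : vsum W (vars so) s) : vsum (vsum (vars so) (vars so)) W s :=
  match v with inl x => inr x | inr c => inl (inl c) end.
pose l2 s (v : vsum W (vars so) s) : vsum (vsum (vars so) (vars so)) W s :=
  match v with inl x => inr x | inr c => inl (inr c) end.
pose E := FAl fW (FIff (rename l1 th0) (rename l2 th0)).
have EE (x y : tup M so) : sat2 E x y <-> (forall u, sat th0 (ejoin u (tenv x)) <-> sat th0 (ejoin u (tenv y))).
  have e1 (z1 z2 : tup M so) (u : env M W) :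
      (fun s v => ejoin (ejoin (tenv z1) (tenv z2)) u (l1 s v)) = ejoin u (tenv z1).
    by apply: funext2 => s [].
  have e2 (z1 z2 : tup M so) (u : env M W) :
      (fun s v => ejoin (ejoin (tenv z1) (tenv z2)) u (l2 s v)) = ejoin u (tenv z2).
    by apply: funext2 => s [].
  rewrite /sat2 sat_al; split=> h u; have := h u; by rewrite sat_iff !sat_rename e1 e2.
have [|||k [eo [psi [e [he eu]]]]] := TEI M MT n so E _ _ _ dd.
- by move=> x; apply/EE.
- by move=> x y /EE h; apply/EE => u; split=> /h.
- by move=> x y z /EE h /EE h'; apply/EE => u; split=> [/h/h'|/h'/h].
exists k, eo, e => g ga.
pose gd : tup M so := fun i => g _ (dd i).
have sE u g' : sat (rename (sum_map (fun s v => v) r) th0) (ejoin u (app g' d)) =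
    sat th0 (ejoin u (tenv (fun i => g' _ (dd i)))).
  by rewrite sat_rename; congr sat; apply: funext2 => s [|[]].
have sE0 u : sat (rename (sum_map (fun s v => v) r) th0) (ejoin u d) =
    sat th0 (ejoin u (tenv dd)).
  by rewrite sat_rename; congr sat; apply: funext2 => s [|[]].
have gpsi x : sat2 E (fun i => g _ (x i)) gd <-> sat2 psi (fun i => g _ (x i)) (fun i => g _ (e i)).
  have H1 (k1 k2 : nat) (o1 : 'I_k1 -> lsort L) (o2 : 'I_k2 -> lsort L) (z1 : tup M o1) (z2 : tup M o2)
     (chi : form (vsum (vars o1) (vars o2))) :
     sat2 chi (fun i => g _ (z1 i)) (fun i => g _ (z2 i)) <-> sat2 chi z1 z2.
    rewrite /sat2 -[sat chi (ejoin (tenv z1) _)](sat_aut chi _ ga).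
    suff -> : app g (ejoin (tenv z1) (tenv z2)) = ejoin (tenv (fun i => g _ (z1 i)))  (tenv (fun i => g _ (z2 i))) by [].
    by apply: funext2 => s [[]|[]].
  by rewrite !H1.
have gpsi' x : sat2 E x gd <-> sat2 psi x (fun i => g _ (e i)).
  have [h [ha hg gh]] := aut_inv ga.
  have := gpsi (fun i => h _ (x i)).
  by have -> : (fun i => g _ (h _ (x i))) = x by apply: functional_extensionality_dep => i.
split=> [ge u|h].
  have : sat2 E gd gd by apply/EE.
  move/gpsi'; have -> : (fun i => g _ (e i)) = e by apply: functional_extensionality_dep.
  by move=> /he/EE/(_ u); rewrite sE sE0.
have {}h : sat2 E gd dd.
  by apply/EE => u; have := h u; rewrite sE sE0.
have ee : e = (fun i => g _ (e i)).
  apply: eu => x; rewrite -gpsi'; split=> /EE h1; apply/EE => u.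
    by rewrite h1; move/EE: h => h; rewrite h.
  by rewrite h1; move/EE: h => h; rewrite h.
by move=> i; exact: (esym (congr1 (fun z : tup M eo => z i) ee)).
Qed.

End Definability.

(** * Global types, their generic points and Morley sequences *)

Definition pre (L : language) (M : structure L) (W : lsort L -> Type)
    (a : nat -> env M W) (n : nat) : env M (cprod 'I_n W) :=
  fun s p => a p.1 s p.2.
Arguments pre {L M W} a n s p.

Section GlobalTypes.
Variables (K : Type) (L : language) (M : structure L).
Hypothesis Mm : monster K M.
Notation ctx := (lsort L -> Type).
Notation smV := (smV K).

Definition pid : env M M := fun s m => m.

Section OneType.
Variables (W : ctx) (q : set (lform M W)).

Definition gtp := (forall phi, q phi \/ q (FNot phi)) /\
  forall l : seq (lform M W), (forall phi, List.In phi l -> q phi) ->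
  exists x : env M W, forall phi, List.In phi l -> sat phi (ejoin x pid).

Definition Q (V : ctx) (phi : form (vsum W V)) (e : env M V) : Prop :=
  q (rename (sum_map (fun s v => v) e) phi).

Lemma sat_Q (V : ctx) (phi : form (vsum W V)) (e : env M V) x :
  sat (rename (sum_map (fun s v => v) e) phi) (ejoin x pid) = sat phi (ejoin x e).
Proof. by rewrite sat_rename; congr sat; apply: funext2 => s []. Qed.

Lemma Q_rename (V V' : ctx) (r : forall s, V s -> V' s) (phi : form (vsum W V)) (e : env M V') :
  Q (rename (sum_map (fun s v => v) r) phi) e = Q phi (fun s v => e s (r s v)).
Proof. by rewrite /Q rename_comp; congr (q (rename _ phi)); apply: funext2 => s []. Qed.

Hypothesis gq : gtp.

Lemma Q_cons (V : ctx) (phi : form (vsum W V)) e : Q phi e -> exists x, sat phi (ejoin x e).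
Proof.
move=> h; have [|x hx] := gq.2 [:: rename (sum_map (fun s v => v) e) phi].
  by move=> psi [<-|[]].
by exists x; rewrite -sat_Q; apply: hx; left.
Qed.

Lemma Q_not (V : ctx) (phi : form (vsum W V)) e : Q (FNot phi) e <-> ~ Q phi e.
Proof.
split=> [h h'|]; last by case: (gq.1 (rename (sum_map (fun s v => v) e) phi)).
have [|x hx] := gq.2 [:: rename (sum_map (fun s v => v) e) phi; rename (sum_map (fun s v => v) e) (FNot phi)].
  by move=> psi [<-|[<-|[]]].
by have := hx _ (or_introl erefl); exact: (hx _ (or_intror (or_introl erefl))).
Qed.

Lemma Q_mono (V V' : ctx) (phi : form (vsum W V)) e (phi' : form (vsum W V')) e' :
  (forall x, sat phi (ejoin x e) -> sat phi' (ejoin x e')) -> Q phi e -> Q phi' e'.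
Proof.
move=> h hq; apply: contrapT => nq; have hq' := (Q_not phi' e').2 nq.
have [|x hx] := gq.2 [:: rename (sum_map (fun s v => v) e) phi; rename (sum_map (fun s v => v) e') (FNot phi')].
  by move=> psi [<-|[<-|[]]].
have h1 := hx _ (or_introl erefl); have h2 := hx _ (or_intror (or_introl erefl)).
by rewrite sat_Q in h1; rewrite sat_Q in h2; apply: h2; exact: h.
Qed.

Lemma Q_and (V : ctx) (phi psi : form (vsum W V)) e : Q phi e -> Q psi e -> Q (FAnd phi psi) e.
Proof.
move=> h1 h2; apply: contrapT => h3'; have h3 := (Q_not (FAnd phi psi) e).2 h3'.
pose R (chi : form (vsum W V)) : lform M W := rename (sum_map (fun s v => v) e) chi.
have [|x hx] := gq.2 [:: R phi; R psi; R (FNot (FAnd phi psi))].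
  by move=> chi [<-|[<-|[<-|[]]]]; rewrite /R.
have k1 := hx _ (or_introl erefl); have k2 := hx _ (or_intror (or_introl erefl)).
have k3 := hx _ (or_intror (or_intror (or_introl erefl))).
rewrite /R sat_Q in k1; rewrite /R sat_Q in k2; rewrite /R sat_Q sat_not sat_and in k3.
exact: k3.
Qed.

Lemma Q_conj (V : ctx) (l : seq (form (vsum W V))) e :
  (forall phi, List.In phi l -> Q phi e) -> Q (FConj l) e.
Proof.
elim: l => [|phi l IH] h.
  apply: contrapT => nh; have [x] := Q_cons ((Q_not (FConj [::]) e).2 nh).
  by rewrite sat_not sat_conj; apply => phi [].
apply: Q_and; first by apply: h; left.
by apply: IH => psi hp; apply: h; right.
Qed.

End OneType.

Section Base.
Variables (B W : ctx) (b : env M B).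
Hypotheses (sB : smV B) (sW : smV W).

Definition inv (q : set (lform M W)) := forall g, automorphism g -> app g b = b ->
  forall phi, q phi <-> q (act_form g phi).

Lemma Q_aut (q : set (lform M W)) g (V : ctx) (phi : form (vsum W V)) (e : env M V) :
  inv q -> automorphism g -> app g b = b -> Q q phi (app g e) <-> Q q phi e.
Proof.
move=> iq ga gb; rewrite /Q (iq g ga gb (rename (sum_map _ e) _)).
suff -> : act_form g (rename (sum_map (fun s v => v) e) phi) =
  rename (sum_map (fun s v => v) (app g e)) phi by [].
by rewrite /act_form rename_comp; congr (rename _ phi); apply: funext2 => s [].
Qed.

(** [a |= q | b e] *)
Definition real (q : set (lform M W)) (a : env M W) (V : ctx) (e : env M V) :=
  forall phi : form (vsum W (vsum B V)), Q q phi (ejoin b e) -> sat phi (ejoin a (ejoin b e)).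

Lemma real_ex q (V : ctx) (e : env M V) : gtp q -> smV V -> exists a, real q a e.
Proof.
move=> gq sV.
have [l hl|a ha] := @realise _ _ _ Mm _ _ (ejoin b e) (fun phi => Q q phi (ejoin b e))
  (smV_vsum Mm sB sV) sW.
  have /(Q_cons gq)[x] := Q_conj gq hl.
  by rewrite sat_conj; exists x.
by exists a.
Qed.

Lemma real_iff q a (V : ctx) (e : env M V) (phi : form (vsum W (vsum B V))) : gtp q ->
  real q a e -> (Q q phi (ejoin b e) <-> sat phi (ejoin a (ejoin b e))).
Proof.
move=> gq ra; split; first exact: ra.
by move=> h; apply: contrapT => nq; exact: (ra _ ((Q_not gq phi _).2 nq) h).
Qed.

(** Membership in [q] is read off a generic point for any parameters found among [b] and [e]; [rho]
    says where they are found. *)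
Lemma real_at q a (V X : ctx) (e : env M V) (x : env M X) (rho : forall s, X s -> vsum B V s)
    (phi : form (vsum W X)) : gtp q -> real q a e ->
  (forall s v, x s v = ejoin b e (rho s v)) ->
  (Q q phi x <-> sat phi (ejoin a x)).
Proof.
move=> gq ra hx.
have -> : x = (fun s v => ejoin b e (rho s v)) by apply: funext2.
rewrite -Q_rename (real_iff _ gq ra) sat_rename.
suff -> : (fun s v => ejoin a (ejoin b e) (sum_map (fun s v => v) rho v)) = ejoin a (fun s v => ejoin b e (rho s v)) by [].
by apply: funext2 => s [].
Qed.

Lemma real_atr q a (X : ctx) (x : env M X) (phi : form (vsum W X)) : gtp q -> real q a x ->
  (Q q phi x <-> sat phi (ejoin a x)).
Proof. by move=> gq ra; apply: (real_at (rho := fun s v => inr v) phi gq ra). Qed.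

Lemma real_sub q a (V V' : ctx) (e : env M V) (e' : env M V') (rho : forall s, V' s -> vsum B V s) :
  gtp q -> real q a e -> (forall s v, e' s v = ejoin b e (rho s v)) -> real q a e'.
Proof.
move=> gq ra he phi.
pose r s (v : vsum B V' s) : vsum B V s := match v with inl c => inl c | inr v => rho s v end.
have H s (v : vsum B V' s) : ejoin b e' v = ejoin b e (r s v) by case: v => [//|w]; exact: he.
exact: (real_at phi gq ra H).1.
Qed.

Lemma real_eqtp q a a' (V : ctx) (e e' : env M V) : gtp q -> inv q -> smV V ->
  real q a e -> real q a' e' -> eqtp (ejoin b e) (ejoin b e') ->
  eqtp (ejoin a (ejoin b e)) (ejoin a' (ejoin b e')).
Proof.
move=> gq iq sV ra ra' ee phi.
have [g [ga]] := hom Mm (smV_vsum Mm sB sV) ee.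
rewrite app_ejoin => gbe; have [gb _] := ejoin_inj gbe.
rewrite -(real_iff _ gq ra) -(real_iff _ gq ra') -gbe -app_ejoin.
exact: iff_sym (Q_aut _ _ iq ga gb).
Qed.

Lemma real_app q a (V : ctx) (e : env M V) g : inv q -> automorphism g -> app g b = b ->
  real q a e -> real q (app g a) (app g e).
Proof.
move=> iq ga gb ra phi; rewrite -{1}gb -app_ejoin Q_aut // => /ra.
by rewrite -(sat_aut _ _ ga) !app_ejoin gb.
Qed.

Lemma real_eqtp_r q a a' (V : ctx) (e e' : env M V) : gtp q -> inv q -> smV V ->
  real q a e -> eqtp (ejoin a (ejoin b e)) (ejoin a' (ejoin b e')) -> real q a' e'.
Proof.
move=> gq iq sV ra ee phi.
have [g [ga]] := hom Mm (smV_vsum Mm sW (smV_vsum Mm sB sV)) ee.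
rewrite app_ejoin => /ejoin_inj[gae]; rewrite app_ejoin => /ejoin_inj[gb ge].
have := real_app iq ga gb ra; rewrite gae ge; exact.
Qed.

Lemma sm_pre n : smV (cprod 'I_n W).
Proof. by apply: (smV_cprod Mm) => //; apply: sml_count; exact: monster_uncountable Mm. Qed.

(** The type may depend on the index: an alternation of two types tests whether they commute, and a
    switch from one to the other tests whether they are equal. *)
Definition morley (qs : nat -> set (lform M W)) (a : nat -> env M W) (n : nat) :=
  forall i, (i < n)%N -> real (qs i) (a i) (pre a i).

Lemma mor_uniq qs a a' n : (forall i, gtp (qs i)) -> (forall i, inv (qs i)) ->
  morley qs a n -> morley qs a' n -> eqtp (ejoin b (pre a n)) (ejoin b (pre a' n)).
Proof.
move=> gq iq; elim: n => [|n IH] ma ma'.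
  have -> // : pre a 0 = pre a' 0 by apply: funext2 => s [[]].
have {}IH := IH (fun i h => ma i (ltnW h)) (fun i h => ma' i (ltnW h)).
have := real_eqtp (gq n) (iq n) (sm_pre n) (ma n (ltnSn n)) (ma' n (ltnSn n)) IH.
pose r s (v : vsum B (cprod 'I_n.+1 W) s) : vsum W (vsum B (cprod 'I_n W)) s :=
  match v with inl c => inr (inl c)
  | inr (i, w) => match ltnP i n with
     LtnNotGeq h => inr (inr (Ordinal h, w)) | GeqNotLtn _ => inl w end end.
move=> /(eqtp_sub r).
have H c : (fun s v => ejoin (c n) (ejoin b (pre c n)) (r s v)) = ejoin b (pre c n.+1).
  apply: funext2 => s [//|[i w]] /=; case: ltnP => // h.
  have en : val i = n by apply/eqP; rewrite eqn_leq h -ltnS ltn_ord.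
  by rewrite /pre /= en.
by rewrite !H.
Qed.

Lemma mor_sub q a n m (iota : nat -> nat) : gtp q -> morley (fun _ => q) a n ->
  (forall i, (i < m)%N -> (iota i < n)%N) ->
  (forall i j, (i < j)%N -> (j < m)%N -> (iota i < iota j)%N) ->
  morley (fun _ => q) (fun i => a (iota i)) m.
Proof.
move=> gq ma hn hi i im.
have h (k : 'I_i) : (iota k < iota i)%N by exact: hi.
apply: (real_sub (rho := fun s (v : cprod 'I_i W s) => inr (Ordinal (h v.1), v.2)) gq (ma _ (hn _ im))).
by move=> s [].
Qed.

Lemma pre_ext (a a' : nat -> env M W) n : (forall i, (i < n)%N -> a i = a' i) -> pre a n = pre a' n.
Proof. by move=> h; apply: funext2 => s [i w]; rewrite /pre /= h. Qed.

Lemma mor_ext qs a a' n : (forall i, (i < n)%N -> a i = a' i) -> morley qs a n -> morley qs a' n.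
Proof.
move=> h ma i hi; rewrite -h // -(@pre_ext a) => [|k hk]; first exact: ma.
by apply: h; exact: ltn_trans hk hi.
Qed.

(** Genericity of the new terms over [x] allows a given sequence to be confronted with a parameter
    that it was not chosen for. *)
Lemma mor_extend qs a n m (X : ctx) (x : env M X) : (forall i, gtp (qs i)) -> smV X ->
  morley qs a n -> exists a', [/\ forall i, (i < n)%N -> a' i = a i, morley qs a' (n + m) &
    forall i, (n <= i < n + m)%N -> real (qs i) (a' i) (ejoin (pre a' i) x)].
Proof.
move=> gq sX ma; elim: m => [|m [a' [h1 h2 h3]]].
  exists a; rewrite addn0; split=> // i /andP[h h']; exfalso.
  by move: h'; rewrite ltnNge h.
have [c hc] := real_ex (ejoin (pre a' (n + m)) x) (gq (n + m)) (smV_vsum Mm (sm_pre _) sX).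
pose a'' i := if (i < n + m)%N then a' i else c.
have e'' i : (i <= n + m)%N -> pre a'' i = pre a' i.
  move=> hi; apply: pre_ext => k hk; rewrite /a''.
  by rewrite (leq_trans hk hi).
exists a''; split.
- by move=> i hi; rewrite /a'' ltn_addr // h1.
- move=> i; rewrite addnS ltnS (leq_eqVlt i) => /orP[/eqP->|hi].
    rewrite e'' // /a'' ltnn.
    by apply: (real_sub (rho := fun s v => inr (inl v)) (gq _) hc).
  by rewrite e'' ?(ltnW hi) // /a'' hi; exact: h2.
- move=> i; rewrite addnS ltnS (leq_eqVlt i) => /andP[hn /orP[/eqP->|hi]].
    by rewrite e'' // /a'' ltnn.
  by rewrite e'' ?(ltnW hi) // /a'' hi; apply: h3; rewrite hn.
Qed.

Lemma mor_ex qs : (forall i, gtp (qs i)) -> exists a, forall n, morley qs a n.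
Proof.
move=> gq.
have s0 : smV (@novar (lsort L)).
  by apply: sml_le (sml_nat (monster_uncountable Mm)); exists (fun=> 0%N) => -[s []].
have [a0 _] := real_ex (fun s (v : novar s) => match v with end) (gq 0%N) s0.
have m0 : morley qs (fun=> a0) 0 by [].
have st n (t : {a | morley qs a n}) : {a' | morley qs a' n.+1 /\ forall i, (i < n)%N -> a' i = sval t i}.
  apply: cid; have [a' [h1 h2 _]] := mor_extend 1 (fun s (v : novar s) => match v with end : M s)  gq s0 (proj2_sig t).
  by exists a'; rewrite -addn1.
(* Each stage keeps the earlier terms, so the diagonal of the stages is a sequence that is Morley at
   every length. *)
pose S := fix S n : {a | morley qs a n} := match n with 0%N => exist (fun a => morley qs a 0) _ m0
   | n.+1 => exist (fun a => morley qs a n.+1) (sval (st n (S n))) (proj1 (proj2_sig (st n (S n)))) end.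
have SS n m : (n <= m)%N -> forall i, (i < n)%N -> sval (S m) i = sval (S n) i.
  move=> nm i hi; elim: m nm => [|m IH]; first by rewrite leqn0 => /eqP->.
  rewrite leq_eqVlt => /orP[/eqP->//|]; rewrite ltnS => nm.
  rewrite -IH // /=; case: (st m (S m)) => a' [_ h] /=; apply: h.
  exact: leq_trans hi nm.
exists (fun n => sval (S n.+1) n) => n.
apply: (mor_ext _ (proj2_sig (S n))) => i hi.
exact: SS.
Qed.

End Base.

End GlobalTypes.

(** * Stable formulas *)

(** Sequences indexed by [nat] with explicit bounds make reindexing and passing to subsequences
    plain arithmetic. *)
Definition ordR (X Y : Type) (R : X -> Y -> Prop) (A : set X) (k : nat) :=
  exists (x : nat -> X) (y : nat -> Y), (forall i, (i < k)%N -> A (x i)) /\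
    forall i j, (i < k)%N -> (j < k)%N -> (R (x i) (y j) <-> (i < j)%N).

(** The reversal [j |-> k - j] takes the values [1, ..., k]; this is why one more [y] than [x] is
    asked for. *)
Lemma ord_rev (X Y : Type) (R : X -> Y -> Prop) (A : set X) k (x : nat -> X) (y : nat -> Y) :
  (forall i, (i < k)%N -> A (x i)) ->
  (forall i j, (i < k)%N -> (j < k.+1)%N -> (R (x i) (y j) <-> (j <= i)%N)) ->
  ordR R A k.
Proof.
move=> hX ho; exists (fun i => x (k - i.+1)), (fun j => y (k - j)); split.
  by move=> i hi; apply: hX; lia.
move=> i j hi hj; rewrite ho; [|lia|lia].
by split=> h; lia.
Qed.

Section OrderProperty.
Variables (L : language) (M : structure L).
Notation ctx := (lsort L -> Type).

Definition ord (W V : ctx) (phi : form (vsum W V)) :=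
  ordR (fun (x : env M W) (y : env M V) => sat phi (ejoin x y)).

Definition stable_for (W B V : ctx) (b : env M B) (phi : form (vsum W (vsum B V))) :=
  exists k, ~ ordR (fun (x : env M W) (y : env M V) => sat phi (ejoin x (ejoin b y))) setT k.

End OrderProperty.

Section Morley.
Variables (K : Type) (L : language) (M : structure L).
Hypothesis Mm : monster K M.
Notation ctx := (lsort L -> Type).
Notation smV := (smV K).
Variable W : ctx.
Hypothesis sW : smV W.

Lemma real_any (B B' : ctx) (b : env M B) (b' : env M B') (q : set (lform M W)) a
    (V V' : ctx) (e : env M V) (e' : env M V') (rho : forall s, vsum B' V' s -> vsum B V s) :
  gtp q -> real b q a e -> (forall s v, ejoin b' e' v = ejoin b e (rho s v)) -> real b' q a e'.
Proof. move=> gq ra he phi; exact: (real_at phi gq ra he).1. Qed.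

Lemma real_base (B : ctx) (b : env M B) (q : set (lform M W)) a (V X : ctx) (e : env M V)
    (x : env M X) : gtp q -> real (ejoin b e) q a x <-> real b q a (ejoin e x).
Proof.
move=> gq; split=> ra.
  apply: (real_any (rho := fun s v => match v with inl c => inl (inl c)
     | inr (inl v) => inl (inr v) | inr (inr x) => inr x end) gq ra).
  by move=> s [|[]].
apply: (real_any (rho := fun s v => match v with inl (inl c) => inl c
   | inl (inr v) => inr (inl v) | inr x => inr (inr x) end) gq ra).
by move=> s [[]|].
Qed.

Lemma inv_base (B V : ctx) (b : env M B) (e : env M V) (q : set (lform M W)) :
  inv b q -> inv (ejoin b e) q.
Proof. by move=> iq g ga; rewrite app_ejoin => /ejoin_inj[gb _]; exact: iq. Qed.

Lemma real_eqtp0 (B : ctx) (b : env M B) (q : set (lform M W)) a a' (V V' : ctx) (e : env M V)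
    (e' : env M V') : gtp q -> real b q a e -> real b q a' e' ->
  eqtp (ejoin a b) (ejoin a' b).
Proof.
move=> gq ra ra' phi.
rewrite -(real_at (x := b) (rho := fun s v => inl v) phi gq ra) //.
by rewrite -(real_at (x := b) (rho := fun s v => inl v) phi gq ra').
Qed.

(** * The bound for stable formulas *)

Section L5.
Variables (B : ctx) (b : env M B) (q : set (lform M W)).
Hypotheses (sB : smV B) (gq : gtp q) (iq : inv b q).

(** If [phi(a_i, v)] failed for all [i < k] with [phi(x, v)] in [q], it would hold at [k] further
    terms generic over [v]. The windows of length [k] starting at [k - j] then show every cut; moved
    to one common sequence, they order [phi]. *)
Lemma stf_mor_bound (V : ctx) (phi : form (vsum W (vsum B V))) : smV V -> stable_for b phi ->
  exists N, forall a, morley b (fun=> q) a N -> forall v : env M V,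
    (forall i, (i < N)%N -> ~ sat phi (ejoin (a i) (ejoin b v))) -> ~ Q q phi (ejoin b v).
Proof.
move=> sV [k nk]; exists k => a ma v hv qv; apply: nk.
have [a' [h1 h2 h3]] := mor_extend Mm sB sW k v (fun=> gq) sV ma.
have tr i : (i < k + k)%N -> sat phi (ejoin (a' i) (ejoin b v)) <-> (k <= i)%N.
  move=> hi; split=> hk.
    by rewrite leqNgt; apply/negP => h; apply: (hv i h); rewrite -h1.
  have hr := h3 i; rewrite hk hi in hr.
  apply/(real_at (x := ejoin b v) (rho := fun s v => match v with inl c => inl c | inr v => inr (inr v) end) phi gq (hr isT)) => //.
  by move=> s [].
have ma' : morley b (fun=> q) a' k by move=> i hi; apply: h2; lia.
have H j : {y : env M V | (j <= k)%N -> forall i, (i < k)%N ->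
     sat phi (ejoin (a' i) (ejoin b y)) <-> (j <= i)%N}.
  apply: cid; case: (leqP j k) => hj; last by exists v.
  have mw : morley b (fun=> q) (fun i => a' (k - j + i)) k.
    by apply: (mor_sub gq h2) => [i hi|i i' hi hi']; lia.
  have [g [ga]] := hom Mm (smV_vsum Mm sB (sm_pre Mm sW k))
    (mor_uniq Mm sB sW (fun=> gq) (fun=> iq) mw ma').
  rewrite app_ejoin => /ejoin_inj[gb gp].
  exists (app g v) => _ i hi.
  have <- : app g (a' (k - j + i)) = a' i.
    apply: funext2 => s w.
    exact: (congr1 (fun f : env M (cprod 'I_k W) => f s (Ordinal hi, w)) gp).
  rewrite -[ejoin b (app g v)](_ : app g (ejoin b v) = _); last by rewrite app_ejoin gb.
  by rewrite -app_ejoin sat_aut // tr; [split=> h; lia|lia].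
apply: (@ord_rev _ _ _ _ _ a' (fun j => sval (H j))) => // i j hi hj.
by case: (H j) => y /= /(_ _ i hi); apply; lia.
Qed.

End L5.

(** * Commuting types and uniqueness of invariant extensions *)

Section Commuting.
Variables (B : ctx) (b : env M B).
Hypothesis sB : smV B.

(** In a Morley sequence alternating between [q] and [q'], the truth of [phi] at a term of each kind
    depends only on which comes first. The two sides of the equivalence are the two answers; if they
    differed, [phi] would be ordered. *)
Lemma commute (q q' : set (lform M W)) (V : ctx) (e : env M V) a0 a1 a0'
    (phi : form (vsum W (vsum B (vsum V W)))) :
  gtp q -> gtp q' -> inv b q -> inv b q' -> smV V -> stable_for b phi ->
  real b q a0 e -> real b q' a1 (ejoin e a0) -> real b q a0' (ejoin e a1) ->
  sat phi (ejoin a0 (ejoin b (ejoin e a1))) <-> sat phi (ejoin a0' (ejoin b (ejoin e a1))).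
Proof.
move=> gq gq' iq iq' sV [k nk] r0 r1 r0'.
pose b2 := ejoin b e; pose qs i := if odd i then q' else q.
have sb2 : smV (vsum B V) by exact: (smV_vsum Mm).
have gqs i : gtp (qs i) by rewrite /qs; case: (odd i).
have [a ma] := mor_ex Mm b2 sb2 sW gqs.
have iq2 : inv b2 q by exact: inv_base.
have iq2' : inv b2 q' by exact: inv_base.
have re s : real b2 q (a (s.*2)) (pre a (s.*2)).
  by have := ma s.*2.+1 s.*2 (ltnSn _); rewrite /qs odd_double.
have ro s : real b2 q' (a (s.*2.+1)) (pre a (s.*2.+1)).
  by have := ma s.*2.+2 s.*2.+1 (ltnSn _); rewrite /qs /= odd_double.
have E1 s : eqtp (ejoin (a s.*2) b2) (ejoin a0 b2).
  move=> chi; rewrite -(real_at (x := b2) (rho := fun s v => inl v) chi gq (re s)) //.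
  by rewrite -(real_at (x := b2) (rho := fun s v => v) chi gq r0).
have E2 t : eqtp (ejoin (a t.*2.+1) b2) (ejoin a1 b2).
  move=> chi; rewrite -(real_at (x := b2) (rho := fun s v => inl v) chi gq' (ro t)) //.
  rewrite -(real_at (x := b2) (rho := fun s v => match v with inl c => inl c | inr v => inr (inl v) end) chi gq' r1) //.
  by move=> s [].
pose y t : env M (vsum V W) := ejoin e (a t.*2.+1).
have sw (c c' : env M W) : eqtp (ejoin c b2) (ejoin c' b2) -> eqtp (ejoin b2 c) (ejoin b2 c').
  move=> h; have := eqtp_sub (fun s v => match v with inl c => inr c | inr w => inl w end) h.
  have H c0 : (fun s v => ejoin c0 b2 (match v with inl c => inr c | inr w => inl w end)) = ejoin b2 c0.
    by apply: funext2 => s [].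
  by rewrite !H.
have T1 s t : (s <= t)%N -> sat phi (ejoin (a s.*2) (ejoin b (y t))) <->
    sat phi (ejoin a0 (ejoin b (ejoin e a1))).
  move=> st; have hst : (s.*2 < t.*2.+1)%N by rewrite ltnS leq_double.
  have r1' : real b2 q' (a t.*2.+1) (a s.*2).
    by apply: (real_sub (rho := fun s v => inr (Ordinal hst, v)) gq' (ro t)).
  have := real_eqtp Mm sb2 gq' iq2' sW r1' ((real_base _ _ _ _ gq').2 r1) (sw _ _ (E1 s)).
  pose r z (v : vsum W (vsum B (vsum V W)) z) :=
    match v return vsum W (vsum (vsum B V) W) z with
    | inl w => inr (inr w) | inr (inl c) => inr (inl (inl c))
    | inr (inr (inl v)) => inr (inl (inr v)) | inr (inr (inr w)) => inl w end.
  have H (c c' : env M W) : (fun s v => ejoin c' (ejoin b2 c) (r s v)) =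
      ejoin c (ejoin b (ejoin e c')) by apply: funext2 => z [|[|[]]].
  by move=> /(eqtp_sub r)/(_ phi); rewrite !H.
have T2 s t : (t < s)%N -> sat phi (ejoin (a s.*2) (ejoin b (y t))) <->
    sat phi (ejoin a0' (ejoin b (ejoin e a1))).
  move=> ts; have hst : (t.*2.+1 < s.*2)%N by lia.
  have r1' : real b2 q (a s.*2) (a t.*2.+1).
    by apply: (real_sub (rho := fun s v => inr (Ordinal hst, v)) gq (re s)).
  have := real_eqtp Mm sb2 gq iq2 sW r1' ((real_base _ _ _ _ gq).2 r0') (sw _ _ (E2 t)).
  pose r z (v : vsum W (vsum B (vsum V W)) z) :=
    match v return vsum W (vsum (vsum B V) W) z with
    | inl w => inl w | inr (inl c) => inr (inl (inl c))
    | inr (inr (inl v)) => inr (inl (inr v)) | inr (inr (inr w)) => inr (inr w) end.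
  have H (c c' : env M W) : (fun s v => ejoin c (ejoin b2 c') (r s v)) =
      ejoin c (ejoin b (ejoin e c')) by apply: funext2 => z [|[|[]]].
  by move=> /(eqtp_sub r)/(_ phi); rewrite !H.
case: (pselect (sat phi (ejoin a0 (ejoin b (ejoin e a1))))) => h0;
  case: (pselect (sat phi (ejoin a0' (ejoin b (ejoin e a1))))) => h1 //; case: nk.
  (* The shift to [s.+1] turns the condition [s <= t] of [T1] into the strict order. *)
  exists (fun s => a s.+1.*2), y; split=> // i j _ _.
  by case: (ltnP i j) => hij; [rewrite T1|rewrite T2].
apply: (@ord_rev _ _ _ _ _ (fun s => a s.+1.*2) y) => // i j _ _.
by case: (leqP j i) => hij; [rewrite T2|rewrite T1].
Qed.

Definition comm (q q' : set (lform M W)) := forall (V : ctx) (e : env M V) a a', smV V ->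
  real b q a e -> real b q' a' (ejoin e a) -> real b q a (ejoin e a').

Section Uniqueness.
Variables q1 q2 : set (lform M W).
Hypotheses (g1 : gtp q1) (g2 : gtp q2) (i1 : inv b q1).
Hypotheses (c21 : comm q2 q1) (c22 : comm q2 q2).

Definition agr (V : ctx) (e : env M V) := forall phi : form (vsum W (vsum B V)),
  Q q1 phi (ejoin b e) <-> Q q2 phi (ejoin b e).

Lemma agr_real (V : ctx) (e : env M V) a : agr e -> real b q1 a e <-> real b q2 a e.
Proof. by move=> h; split=> ra phi /h; exact: ra. Qed.

(** Let [v] be generic for [q1] over [e, a]. By agreement [a] is generic for [q2] over [e], hence
    over [e, v] by [c21]; also [v] is generic for [q2] over [e], hence over [e, a] by [c22]. So [v]
    realises both types over [e, a]. *)
Lemma agr_step (V : ctx) (e : env M V) a : smV V -> agr e -> real b q1 a e -> agr (ejoin e a).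
Proof.
move=> sV ae ra.
have [v rv] := real_ex Mm b sB sW (ejoin e a) g1 (smV_vsum Mm sV sW).
have ra2 := (agr_real a ae).1 ra.
have rva := c21 sV ra2 rv.
have rv1 : real b q1 v e by apply: (real_sub (rho := fun s v => inr (inl v)) g1 rv).
have rv2 := c22 sV ((agr_real v ae).1 rv1) rva.
by move=> phi; rewrite (real_iff _ g1 rv) (real_iff _ g2 rv2).
Qed.

Hypothesis a0 : forall phi : form (vsum W B), Q q1 phi b <-> Q q2 phi b.

Lemma agr_pre a n : morley b (fun=> q1) a n -> agr (pre a n).
Proof.
elim: n => [|n IH] ma.
  move=> phi.
  pose r s (v : vsum W (vsum B (cprod 'I_0 W)) s) : vsum W B s :=
    match v with inl w => inl w | inr (inl c) => inr c
    | inr (inr (i, _)) => match i with Ordinal _ h => False_rect _ (Bool.diff_false_true h) end end.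
  have H q' : gtp q' -> Q q' phi (ejoin b (pre a 0)) <-> Q q' (rename r phi) b.
    move=> gq'; suff E x : sat (rename r phi) (ejoin x b) = sat phi (ejoin x (ejoin b (pre a 0))).
      by split; apply: Q_mono => // x; rewrite E.
    rewrite sat_rename; congr sat; apply: funext2 => s [//|[//|[i w]]].
    by case: i.
  by rewrite !H.
have {}IH := IH (fun i h => ma i (ltnW h)).
have := agr_step (sm_pre Mm sW n) IH (ma n (ltnSn n)) => h phi.
pose r s (v : vsum B (cprod 'I_n.+1 W) s) : vsum B (vsum (cprod 'I_n W) W) s :=
  match v with inl c => inl c
  | inr (i, w) => match ltnP i n with
     LtnNotGeq h => inr (inl (Ordinal h, w)) | GeqNotLtn _ => inr (inr w) end end.
have -> : ejoin b (pre a n.+1) = (fun s v => ejoin b (ejoin (pre a n) (a n)) (r s v)).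
  apply: funext2 => s [//|[i w]] /=; case: ltnP => // hn.
  have en : val i = n by apply/eqP; rewrite eqn_leq hn -ltnS ltn_ord.
  by rewrite /pre /= en.
by rewrite -!Q_rename.
Qed.

(** A sequence generic over [v] that follows [q1] before [j] and [q2] from [j] on is Morley for
    [q1], by agreement. If [phi(x, v)] separated the types, these sequences, moved to one fixed
    sequence for all [j], would order [phi]. *)
Lemma inv_unique (V : ctx) (phi : form (vsum W (vsum B V))) (v : env M V) : smV V -> stable_for b phi ->
  Q q1 phi (ejoin b v) -> Q q2 phi (ejoin b v).
Proof.
move=> sV [k nk] h1; apply: contrapT => h2; apply: nk.
have [c mc] := mor_ex Mm b sB sW (qs := fun=> q1) (fun=> g1).
have H j : {y : env M V | forall i, (i < k)%N -> sat phi (ejoin (c i) (ejoin b y)) <-> (i < j)%N}.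
  apply: cid; pose qs i := if (i < j)%N then q1 else q2.
  have gqs i : gtp (qs i) by rewrite /qs; case: ifP.
  have m0 : morley b qs c 0 by [].
  have [a' [_ ma hv]] := mor_extend Mm sB sW k v gqs sV m0.
  have {}ma : morley b (fun=> q1) a' k.
    move: ma; rewrite add0n => ma.
    have : forall n, (n <= k)%N -> morley b (fun=> q1) a' n.
      elim=> [//|n IH] hn; have {}IH := IH (ltnW hn).
      move=> i; rewrite ltnS leq_eqVlt => /orP[/eqP->|]; last exact: IH.
      have := ma n hn; rewrite /qs; case: ifP => // _.
      by move/(agr_real _ (agr_pre IH)).
    exact.
  have [g [ga]] := hom Mm (smV_vsum Mm sB (sm_pre Mm sW k))
    (mor_uniq Mm sB sW (fun=> g1) (fun=> i1) ma (mc k)).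
  rewrite app_ejoin => /ejoin_inj[gb gp].
  exists (app g v) => i hi.
  have <- : app g (a' i) = c i.
    apply: funext2 => s w.
    exact: (congr1 (fun f : env M (cprod 'I_k W) => f s (Ordinal hi, w)) gp).
  rewrite -[ejoin b (app g v)](_ : app g (ejoin b v) = _); last by rewrite app_ejoin gb.
  rewrite -app_ejoin sat_aut //.
  have hr := hv i; rewrite add0n hi in hr; have {}hr := hr isT.
  rewrite -(real_at (x := ejoin b v) (rho := fun s v => match v with inl c => inl c | inr v => inr (inr v) end) phi (gqs i) hr).
    by rewrite /qs; case: (i < j)%N.
  by move=> s [].
exists c, (fun j => sval (H j)); split=> // i j hi hj.
by case: (H j) => y hy; exact: hy.
Qed.

End Uniqueness.
End Commuting.
End Morley.

(** * Limits of types along an ultrafilter *)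

Section Limit.
Variables (L : language) (M : structure L).
Notation ctx := (lsort L -> Type).
Variables (W : ctx) (T : Type) (c : T -> env M W) (D : set_system T).
Hypothesis UD : UltraFilter D.

(** The average type of the points [c i]; it is finitely satisfiable in them, hence invariant over
    them. *)
Definition tlim : set (lform M W) := [set phi | D [set i | sat phi (ejoin (c i) (@pid _ M))]].

Lemma tlim_gtp : gtp tlim.
Proof.
have PD := @ultra_proper _ _ UD.
split=> [phi|l hl].
  by case: (in_ultra_setVsetC [set i | sat phi (ejoin (c i) (@pid _ M))] UD); [left|right].
suff h : D [set i | forall phi, List.In phi l -> sat phi (ejoin (c i) (@pid _ M))].
  by have [i hi] := filter_ex h; exists (c i).
elim: l hl => [|phi l IH] hl; first by apply: filterS filterT => i _ psi [].
have h1 : D [set i | sat phi (ejoin (c i) (@pid _ M))] by apply: hl; left.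
have h2 := IH (fun psi h => hl psi (or_intror h)).
apply: filterS (filterI h1 h2) => i [h3 h4] psi [<-//|]; exact: h4.
Qed.

Lemma Q_tlim (V : ctx) (phi : form (vsum W V)) (e : env M V) :
  Q tlim phi e <-> D [set i | sat phi (ejoin (c i) e)].
Proof.
rewrite /Q /tlim /=; suff -> : [set i | sat (rename (sum_map (fun s v => v) e) phi) (ejoin (c i) (@pid _ M))] =
  [set i | sat phi (ejoin (c i) e)] by [].
by apply/seteqP; split=> i /=; rewrite sat_Q.
Qed.

Lemma tlim_inv (B : ctx) (b : env M B) :
  (forall g, app g b = b -> forall i, app g (c i) = c i) -> inv b tlim.
Proof.
move=> h g ga gb phi; rewrite /tlim /=.
suff -> : [set i | sat (act_form g phi) (ejoin (c i) (@pid _ M))] =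
  [set i | sat phi (ejoin (c i) (@pid _ M))] by [].
apply/seteqP; split=> i /=; rewrite /act_form sat_rename -(sat_aut phi _ ga) app_ejoin (h g gb i).
  by move=> H; move: H; congr sat; apply: funext2 => s [].
by move=> H; move: H; congr sat; apply: funext2 => s [].
Qed.

End Limit.

Lemma ultra_nat : exists D : set_system nat, UltraFilter D /\
  forall N, D [set n | (N <= n)%N].
Proof.
have [D [UD hD]] := ultraFilterLemma (F := eventually) _.
exists D; split=> // N; apply: hD; exists N => // n.
Qed.

(** * The order property along a Morley sequence *)

Section Stability.
Variables (K : Type) (L : language) (M : structure L).
Hypothesis Mm : monster K M.
Notation ctx := (lsort L -> Type).
Notation smV := (smV K).

(** The type is the limit of an infinite order along an ultrafilter. *)
Lemma order_morley (W V B : ctx) (phi : form (vsum W V)) (th : form (vsum W B)) (b : env M B) :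
  smV W -> smV V -> smV B ->
  (forall k, ord phi [set x | sat th (ejoin x b)] k) ->
  exists (B' : ctx) (b' : env M B') (rho : forall s, B s -> B' s) (r : set (lform M (vsum W V)))
    (w : nat -> env M W) (y : nat -> env M V),
    [/\ smV B' /\ (forall s v, b s v = b' s (rho s v)), gtp r, inv b' r,
      forall n, morley b' (fun=> r) (fun i => ejoin (w i) (y i)) n &
      (forall i, sat th (ejoin (w i) b)) /\
      forall i j, sat phi (ejoin (w i) (y j)) <-> (j < i)%N].
Proof.
move=> sW sV sB ho.
pose C : ctx := cprod nat (vsum W V).
have sn : sml K nat by exact/sml_nat/(monster_uncountable Mm).
have sC : smV C by apply: (smV_cprod Mm) => //; exact: (smV_vsum Mm).
pose Rth i s (v : vsum W B s) : vsum C B s := match v with inl w => inl (i, inl w) | inr c => inr c end.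
pose Rphi i j s (v : vsum W V s) : vsum C B s := match v with inl w => inl (i, inl w) | inr c => inl (j, inr c) end.
pose F i j := FAnd (rename (Rth i) th) (FIff (rename (Rphi i j) phi)
   (if (i < j)%N then FTrue _ else FNot (FTrue _))).
pose tow (c : env M C) i : env M W := fun s v => c s (i, inl v).
pose toy (c : env M C) i : env M V := fun s v => c s (i, inr v).
have FE (c : env M C) i j : sat (F i j) (ejoin c b) <->
    sat th (ejoin (tow c i) b) /\ (sat phi (ejoin (tow c i) (toy c j)) <-> (i < j)%N).
  rewrite /F sat_and sat_iff !sat_rename.
  have -> : (fun s v => ejoin c b (Rth i s v)) = ejoin (tow c i) b by apply: funext2 => s [].
  have -> : (fun s v => ejoin c b (Rphi i j s v)) = ejoin (tow c i) (toy c j) by apply: funext2 => s [].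
  case E : (i < j)%N; first by rewrite sat_true; split=> -[h1 h2]; split=> //; split=> // _; apply/h2.
  rewrite (sat_not (FTrue _)) sat_true; split=> -[h1 h2]; split=> //.
    by split=> // /h2.
  by split=> // /h2.
have [l hl|c hc] := @realise _ _ _ Mm _ _ b [set psi | exists i j, psi = F i j] sB sC.
  have [k hk] : exists k, forall psi, List.In psi l -> exists i j, [/\ (i < k)%N, (j < k)%N & psi = F i j].
    elim: l hl => [|psi l IH] hl; first by exists 0%N.
    have [|k hk] := IH; first by move=> psi' h; apply: hl; right.
    have [i [j e]] := hl psi (or_introl erefl).
    exists (maxn k (maxn i.+1 j.+1)) => psi' [<-|/hk[i' [j' [h1 h2 h3]]]].
      by exists i, j; split=> //; lia.
    by exists i', j'; split=> //; lia.
  have [x [y [hx hxy]]] := ho k.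
  pose c : env M C := fun s v => ejoin (x v.1) (y v.1) v.2.
  exists c => psi /hk[i [j [hi hj ->]]]; apply/FE; split; first exact: hx.
  exact: hxy.
have hcF i j := (FE c i j).1 (hc _ (ex_intro _ i (ex_intro _ j erefl))).
have [D [UD hD]] := ultra_nat.
have PD := @ultra_proper _ _ UD.
pose cc i := ejoin (tow c i) (toy c i).
pose r := tlim cc D.
pose b' := ejoin b c.
have gr : gtp r by exact: tlim_gtp.
have ir : inv b' r.
  apply: tlim_inv => g; rewrite app_ejoin => /ejoin_inj[_ gc] i; rewrite /cc app_ejoin.
  congr ejoin; apply: funext2 => s v.
    exact: (congr1 (fun f : env M C => f s (i, inl v)) gc).
  exact: (congr1 (fun f : env M C => f s (i, inr v)) gc).
have sB' : smV (vsum B C) by exact: (smV_vsum Mm).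
have sWV : smV (vsum W V) by exact: (smV_vsum Mm).
have [a ma] := mor_ex Mm b' sB' sWV (qs := fun=> r) (fun=> gr).
pose w i : env M W := fun s v => a i s (inl v).
pose y i : env M V := fun s v => a i s (inr v).
have ea i : ejoin (w i) (y i) = a i by exact: ejoinE.
have ea' : (fun i => ejoin (w i) (y i)) = a by apply: funext.
exists (vsum B C), b', (fun s v => inl v), r, w, y; split=> //; first by rewrite ea'.
have ra i := ma i.+1 i (ltnSn i).
split=> [i|].
  pose rr s (v : vsum W B s) : vsum (vsum W V) B s := match v with inl w => inl (inl w) | inr c => inr c end.
  suff : sat (rename rr th) (ejoin (a i) b).
    by rewrite sat_rename -ea; congr sat; apply: funext2 => s [].
  rewrite -(real_at (x := b) (rho := fun s v => inl (inl v)) _ gr (ra i)) // Q_tlim.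
  apply: filterS filterT => k _ /=; rewrite sat_rename.
  by have [h _] := hcF k 0%N; move: h; congr sat; apply: funext2 => s [].
pose r1 s (v : vsum W V s) : vsum (vsum W V) V s := match v with inl w => inl (inl w) | inr c => inr c end.
pose r2 s (v : vsum W V s) : vsum (vsum W V) W s := match v with inl w => inr w | inr c => inl (inr c) end.
have e1 (w0 : env M W) (y0 y1 : env M V) : sat (rename r1 phi) (ejoin (ejoin w0 y0) y1) = sat phi (ejoin w0 y1).
  by rewrite sat_rename; congr sat; apply: funext2 => s [].
have e2 (w0 w1 : env M W) (y0 : env M V) : sat (rename r2 phi) (ejoin (ejoin w0 y0) w1) = sat phi (ejoin w1 y0).
  by rewrite sat_rename; congr sat; apply: funext2 => s [].
(* The ultrafilter contains every final segment, so [phi] fails between a realisation of the limit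
   and a given [toy c j] and holds between a given [tow c i] and a realisation. This reverses the
   order on the Morley sequence. *)
have X1 i j : sat phi (ejoin (w i) (toy c j)) <-> D [set k | (k < j)%N].
  rewrite -(e1 (w i) (y i)) ea -(real_at (x := toy c j) (rho := fun s v => inl (inr (j, inr v))) _ gr (ra i)) //.
  rewrite Q_tlim; suff -> : [set k | sat (rename r1 phi) (ejoin (cc k) (toy c j))] = [set k | (k < j)%N] by [].
  by apply/seteqP; split=> k /=; rewrite /cc e1; have [_ ->] := hcF k j.
have X2 i j : sat phi (ejoin (tow c i) (y j)) <-> D [set k | (i < k)%N].
  rewrite -(e2 (w j)) ea -(real_at (x := tow c i) (rho := fun s v => inl (inr (i, inl v))) _ gr (ra j)) //.
  rewrite Q_tlim; suff -> : [set k | sat (rename r2 phi) (ejoin (cc k) (tow c i))] = [set k | (i < k)%N] by [].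
  by apply/seteqP; split=> k /=; rewrite /cc e2; have [_ ->] := hcF i k.
have n1 j : ~ D [set k | (k < j)%N].
  move=> h; have [k [/= h1 h2]] := filter_ex (filterI h (hD j)).
  by move: h1; rewrite ltnNge h2.
move=> i j; case: (ltngtP j i) => hij.
- split=> // _.
  rewrite -(e1 (w i) (y i)) ea.
  rewrite -(real_at (x := y j) (rho := fun s v => inr (Ordinal hij, inr v)) _ gr (ra i)) // Q_tlim.
  apply: filterS filterT => k _ /=; rewrite /cc e1 X2; exact: (hD k.+1).
- split=> //; rewrite -(e2 (w j)) ea.
  rewrite -(real_at (x := w i) (rho := fun s v => inr (Ordinal hij, inl v)) _ gr (ra j)) // Q_tlim.
  suff -> : [set k | sat (rename r2 phi) (ejoin (cc k) (w i))] = set0.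
    by move=> h; case: (filter_ex h).
  by apply/seteqP; split=> k //=; rewrite /cc e2 X1 => /n1.
- subst j; split=> //; rewrite ea.
  pose r3 s (v : vsum W V s) : vsum (vsum W V) (vsum B C) s := inl v.
  have e3 (c0 : env M (vsum W V)) : sat (rename r3 phi) (ejoin c0 b') = sat phi c0 by rewrite sat_rename.
  rewrite -e3 -(real_at (x := b') (rho := fun s v => inl v) _ gr (ra i)) // Q_tlim.
  suff -> : [set k | sat (rename r3 phi) (ejoin (cc k) b')] = set0.
    by move=> h; case: (filter_ex h).
  by apply/seteqP; split=> k //=; rewrite e3; have [_ ->] := hcF k k; rewrite ltnn.
Qed.

End Stability.

(** * Sets on which no formula has the order property *)

Definition penv (L : language) (M : structure L) (A : set (elt M)) : env M (par A) :=
  fun s m => sval m.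

Lemma sat_over (L : language) (M : structure L) (V : lsort L -> Type) (A : set (elt M))
    (phi : form (vsum V (par A))) (e : env M V) :
  sat (rename (@forget_par _ _ V A) phi) (ejoin e (fun s m => m)) = sat phi (ejoin e (penv (A := A))).
Proof. by rewrite sat_rename; congr sat; apply: funext2 => s []. Qed.

Section Stability.
Variables (K : Type) (L : language) (M : structure L).
Hypothesis Mm : monster K M.
Notation ctx := (lsort L -> Type).
Notation smV := (smV K).

(** The form in which stable, stably embedded sets are used: no formula of the
    ambient structure, whatever its parameters, has the order property there. *)
Definition Good (W D : ctx) (th : form (vsum W D)) (d : env M D) :=
  forall (V : ctx) (phi : form (vsum W V)), smV V ->
  exists k, ~ ord phi [set x | sat th (ejoin x d)] k.

(** Stable embeddedness defines the trace of [phi(x, y_0)] on the set by some [chi] with parameters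
    in [A] and in the set. Automorphisms over [A] that take [y_0] to [y_j] show that [chi], with
    moved parameters, serves every [y_j]. So an order for [phi] becomes one for a single relation of
    the induced structure. *)
Lemma stable_Good (A : set (elt M)) (X : dset A) (th : form (vsum (vars (single (dsort X))) (par A))) :
  small K A -> stable_dset X -> stably_embedded X ->
  dform X = rename (@forget_par _ _ _ A) th -> Good th (penv (A := A)).
Proof.
move=> sA Xst Xse eX V phi sV; apply: contrapT => nk.
have ho k : ord phi [set x | sat th (ejoin x (penv (A := A)))] k.
  by apply: contrapT => h; apply: nk; exists k.
have sn := monster_uncountable Mm.
have s1 : smV (vars (single (dsort X))).
  apply: (smV_vars (K := K)); apply: (sml_count sn).
have [B' [b' [rho [r [w [y [[sB' hrho] gr ir ma [hth hphi]]]]]]]] :=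
  order_morley Mm s1 sV (smV_par sA) ho.
set s0 := dsort X in th eX phi s1 r w y ma hth hphi ho gr ir nk *.
have dE (x : env M (vars (single s0))) : dmem (x _ (Var tt)) <-> sat th (ejoin x (penv (A := A))).
  rewrite /dmem /lsat eX sat_over.
  suff -> : tenv (tup1 (x (single s0 tt) (Var tt))) = x by [].
  by apply: funext2 => s [[]].
have dE1 (m : M s0) : dmem (X := X) m <-> sat th (ejoin (tenv (tup1 m)) (penv (A := A))).
  by rewrite -dE.
have G j : {g | [/\ automorphism g, app g b' = b' & app g (y 0%N) = y j]}.
  apply: cid.
  have ee : eqtp (ejoin (ejoin (w 0%N) (y 0%N)) b') (ejoin (ejoin (w j) (y j)) b').
    exact: (real_eqtp0 gr (ma 1%N 0%N (ltnSn 0)) (ma j.+1 j (ltnSn j))).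
  have [g [ga]] := hom Mm (smV_vsum Mm (smV_vsum Mm s1 sV) sB') ee.
  by rewrite !app_ejoin => /ejoin_inj[/ejoin_inj[_ gy] gb]; exists g.
have gp g : app g b' = b' -> app g (penv (A := A)) = penv (A := A).
  move=> gb; apply: funext2 => s v; rewrite /app hrho.
  exact: (congr1 (fun f : env M B' => f s (rho s v)) gb).
have gd g m : automorphism g -> app g b' = b' -> dmem (X := X) m -> dmem (X := X) (g _ m).
  move=> ga /gp gb; rewrite !dE1 -(sat_aut _ _ ga) app_ejoin gb.
  suff -> : app g (tenv (tup1 m)) = tenv (tup1 (g _ m)) by [].
  by apply: funext2 => s [[]].
pose r1 s (v : vsum (vars (single s0)) V s) : vsum (vars (fun _ : 'I_1 => s0)) M s :=
  match v with inl x => inl (match x in vars _ s return vars (fun _ : 'I_1 => s0) s with Var _ => Var ord0 end)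
  | inr c => inr (y 0%N s c) end.
have [psi [psi' _ <-] hpsi] := Xse 1%N (rename r1 phi).
have [n [so [psi0 [rr epsi]]]] := fsupp psi'.
set A' := A `|` _ in psi' rr psi0 epsi hpsi.
(* A parameter in [A] stays a constant, one in the set becomes a variable. In the first case the
   value [z] is a filler, for which [w 0] serves because it lies in the set. *)
have kap (i : 'I_n) : {u : vsum (vars (fun _ : 'I_n.+1 => s0)) (par A) (so i) & {z : M s0 |
   dmem (X := X) z /\ forall z' : tup M (fun _ : 'I_n.+1 => s0), z' (lift ord0 i) = z ->
     ejoin (tenv z') (penv (A := A)) u = sval (rr _ (Var i))}}.
  have W0 := (dE _).2 (hth 0%N).
  move: (rr _ (Var i)); move: (so i) => t [m hm].
  case: (pselect (A (existT _ t m))) => h.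
    by exists (inr (mkpar h)), (w 0%N _ (Var tt)); split.
  have hm1 : dset_elts X (existT _ t m) by case: (hm).
  have [m' [hm' em]] : {m' | dmem (X := X) m' /\ existT _ t m = existT _ s0 m'}.
    by apply: cid; case: hm1 => m' h1 h2; exists m'.
  have es := congr1 (@projT1 _ _) em; rewrite /= in es; subst t.
  have em' := existT_inj em; subst m'.
  by exists (inl (Var (lift ord0 i))), m; split => // z' /= ->.
pose RR s (v : vsum (vars (fun _ : 'I_1 => s0)) (vars so) s) : vsum (vars (fun _ : 'I_n.+1 => s0)) (par A) s :=
  match v with inl x => inl (match x in vars _ s return vars (fun _ : 'I_n.+1 => s0) s with Var _ => Var ord0 end)
  | inr x => match x in vars _ s return vsum (vars (fun _ : 'I_n.+1 => s0)) (par A) s with Var i => projT1 (kap i) end end.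
pose chi := rename RR psi0.
pose zz i : M s0 := sval (projT2 (kap i)).
have zzX i : dmem (X := X) (zz i) by rewrite /zz; case: (projT2 (kap i)) => z [].
pose tz (x : M s0) (g : forall s, M s -> M s) : tup M (fun _ : 'I_n.+1 => s0) :=
  fun i => if unlift ord0 i is Some k then g _ (zz k) else x.
have C0 (x : env M (vars (single s0))) : dmem (X := X) (x _ (Var tt)) ->
    sat chi (ejoin (tenv (tz (x _ (Var tt)) (fun s m => m))) (penv (A := A))) <-> sat phi (ejoin x (y 0%N)).
  move=> hx; have := hpsi (fun _ => x _ (Var tt)) (fun _ => hx).
  rewrite /lsat sat_over epsi !sat_rename.
  have -> : (fun s v => ejoin (tenv (fun=> x s0 (Var tt))) (fun s m => m) (r1 s v)) = ejoin x (y 0%N).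
    by apply: funext2 => s [[[]]|].
  move=> ->.
  suff -> : (fun s v => ejoin (tenv (tz (x s0 (Var tt)) (fun s m => m))) (penv (A := A)) (RR s v)) =
    (fun s v => ejoin (tenv (fun=> x s0 (Var tt))) (penv (A := A')) (sum_map (fun s v => v) rr v)) by [].
  apply: funext2 => s [[i]|[i]]; first by rewrite /= /tz unlift_none.
  have [_ h] := proj2_sig (projT2 (kap i)).
  by apply: h; rewrite /tz liftK.
have C1 (x : env M (vars (single s0))) j : dmem (X := X) (x _ (Var tt)) ->
    sat chi (ejoin (tenv (tz (x _ (Var tt)) (sval (G j)))) (penv (A := A))) <-> sat phi (ejoin x (y j)).
  move=> hx; case: (G j) => g [ga gb gy] /=.
  have [h [ha hg gh]] := aut_inv ga.
  have hb : app h b' = b' by rewrite -{1}gb; apply: funext2 => s v; exact: hg.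
  have hx' := gd h _ ha hb hx.
  have := C0 (app h x) hx'; rewrite -(sat_aut chi _ ga) -(sat_aut phi _ ga) !app_ejoin gy gp //.
  have -> : app g (app h x) = x by apply: funext2 => s v; exact: gh.
  suff -> : app g (tenv (tz (app h x (Var tt)) (fun s m => m))) = tenv (tz (x s0 (Var tt)) g) by [].
  by apply: funext2 => s [i]; rewrite /app /= /tz; case: unlift => //; rewrite /app gh.
have ov : Defs.over A (rename (@forget_par _ _ (vars (fun _ : 'I_n.+1 => s0)) A) chi) by exists chi.
pose R : rsym (induced_language (fun _ : unit => X)) :=
  existT _ n.+1 (existT _ (fun _ => tt) (exist _ _ ov)).
pose ts (i : 'I_n.+1) : term (L := induced_language (fun _ : unit => X))
    (vsum (vars (fun _ : 'I_1 => tt)) (vars (fun _ : 'I_n => tt))) tt :=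
  if unlift ord0 i is Some k then TVar (inr (Var k)) else TVar (inl (Var ord0)).
apply: (Xst 1%N n (fun=> tt) (fun=> tt) (FRel (r := R) ts)) => k.
have wX i : dmem (X := X) (w i _ (Var tt)) by apply/dE/hth.
have zX j l : dmem (X := X) (sval (G j) _ (zz l)) by have [ga gb _] := proj2_sig (G j); exact: gd.
(* The indices run backwards because [hphi] gives [j < i] where the order property wants [i < j]. *)
exists (fun i _ => exist _ (w (k - i.+1)%N _ (Var tt)) (wX _)).
exists (fun j l => exist _ (sval (G (k - j.+1)%N) _ (zz l)) (zX _ l)).
move=> i j; rewrite /sat2 /= /lsat sat_over.
set tt1 := (X in tenv X).
have -> : tt1 = tz (w (k - i.+1)%N _ (Var tt)) (sval (G (k - j.+1)%N)).
  apply: functional_extensionality_dep => l; rewrite /tt1 /tz /ts.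
  by case: unlift.
rewrite C1 // hphi; have := ltn_ord i; have := ltn_ord j.
by split=> h; lia.
Qed.

End Stability.

Lemma vars_split (S : Type) n (so : 'I_n.+1 -> S) :
  exists r : forall s, vars so s ->
      (vars (fun _ : unit => so ord0) s + vars (fun k => so (lift ord0 k)) s)%type,
   r _ (Var ord0) = inl (Var tt) /\ forall k, r _ (Var (lift ord0 k)) = inr (Var k).
Proof.
set T := fun s => (vars (fun _ : unit => so ord0) s + vars (fun k => so (lift ord0 k)) s)%type.
have R i : { x : T (so i) |
   (forall e : ord0 = i, x = match e in _ = i return T (so i) with erefl => inl (Var tt) end)
   /\ (forall k (e : lift ord0 k = i), x = match e in _ = i return T (so i) with erefl => inr (Var k) end) }.
  case: (unliftP ord0 i) => [k|] ->.
    exists (inr (Var k)); split=> [e|k' e].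
      by exfalso; have := neq_lift ord0 k; rewrite -e eqxx.
    have ek := lift_inj e; subst k'; by rewrite (Prop_irrelevance e erefl).
  exists (inl (Var tt)); split=> [e|k e]; first by rewrite (Prop_irrelevance e erefl).
  by exfalso; have := neq_lift ord0 k; rewrite e eqxx.
exists (fun s x => match x in vars _ s return T s with Var i => sval (R i) end).
split => [|k] /=.
  by case: (R ord0) => x [h _] /=; rewrite (h erefl).
by case: (R _) => x [_ h] /=; rewrite (h k erefl).
Qed.

(** * Products of good sets and functions into them *)

Section Products.
Variables (K : Type) (L : language) (M : structure L).
Hypothesis Mm : monster K M.
Notation ctx := (lsort L -> Type).
Notation smV := (smV K).

Definition thprod (W1 W2 D : ctx) (th1 : form (vsum W1 D)) (th2 : form (vsum W2 D)) :
    form (vsum (vsum W1 W2) D) :=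
  FAnd (rename (sum_map (fun s v => inl v) (fun s v => v)) th1)
       (rename (sum_map (fun s v => inr v) (fun s v => v)) th2).

Lemma sat_thprod (W1 W2 D : ctx) (th1 : form (vsum W1 D)) (th2 : form (vsum W2 D))
    (w1 : env M W1) (w2 : env M W2) (d : env M D) :
  sat (thprod th1 th2) (ejoin (ejoin w1 w2) d) = (sat th1 (ejoin w1 d) /\ sat th2 (ejoin w2 d)).
Proof.
rewrite sat_and !sat_rename; congr (_ /\ _).
  by congr sat; apply: funext2 => s [].
by congr sat; apply: funext2 => s [].
Qed.

(** Let [w_i = (u_i, v_i)] be Morley with [phi(w_i, y_j)] iff [j < i].  By
    stability in the first coordinate, [u_0] can be slid past the [y]'s without
    changing which patterns [phi(u_0, v; y_1), ..., phi(u_0, v; y_m)] are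
    realised by some [v]; so [phi(u_0, v; y)] is unstable in [v]. *)
Lemma Good_prod (W1 W2 D : ctx) (th1 : form (vsum W1 D)) (th2 : form (vsum W2 D)) (d : env M D) :
  smV W1 -> smV W2 -> fin W2 -> smV D -> Good K th1 d -> Good K th2 d -> Good K (thprod th1 th2) d.
Proof.
move=> s1 s2 f2 sD G1 G2 V phi sV; apply: contrapT => nk.
have ho k : ord phi [set x | sat (thprod th1 th2) (ejoin x d)] k.
  by apply: contrapT => h; apply: nk; exists k.
have sW : smV (vsum W1 W2) by exact: (smV_vsum Mm).
have [B' [b' [rho [r [w [y [[sB' hrho] gr ir ma [hth hphi]]]]]]]] :=
  order_morley Mm sW sV sD ho.
pose u1 i : env M W1 := fun s v => w i s (inl v).
pose u2 i : env M W2 := fun s v => w i s (inr v).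
have ew i : w i = ejoin (u1 i) (u2 i) by rewrite ejoinE.
have h1 i : sat th1 (ejoin (u1 i) d) by have := hth i; rewrite ew sat_thprod => -[].
have h2 i : sat th2 (ejoin (u2 i) d) by have := hth i; rewrite ew sat_thprod => -[].
pose rphi s (v : vsum (vsum W1 W2) V s) : vsum W2 (vsum W1 V) s :=
  match v with inl (inl x) => inr (inl x) | inl (inr x) => inl x | inr c => inr (inr c) end.
pose phi2 := rename rphi phi.
have ephi2 (a : env M W1) (a' : env M W2) (c : env M V) :
    sat phi2 (ejoin a' (ejoin a c)) = sat phi (ejoin (ejoin a a') c).
  by rewrite sat_rename; congr sat; apply: funext2 => s [[|]|].
have [m nm] := G2 _ phi2 (smV_vsum Mm s1 sV).
pose E : ctx := vsum (vsum W1 (vsum (cprod 'I_m V) D)) W2.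
pose rl (l : 'I_m) s (v : vsum (vsum W1 W2) V s) : E s :=
  match v with inl (inl x) => inl (inl x) | inl (inr x) => inr x | inr c => inl (inr (inl (l, c))) end.
pose rth s (v : vsum W2 D s) : E s := match v with inl x => inr x | inr c => inl (inr (inr c)) end.
pose lit t (l : 'I_m) := if (l < t)%N then rename (rl l) phi else FNot (rename (rl l) phi).
(* [chi t] says that some point of the second set completes the first coordinate so that [phi] holds
   at exactly the first [t] of the [m] given parameters. *)
pose chi t := FEx f2 (FAnd (rename rth th2) (FConj (map (lit t) (enum 'I_m)))).
have chiE t a (ys : env M (cprod 'I_m V)) : sat (chi t) (ejoin a (ejoin ys d)) <->
   exists a', sat th2 (ejoin a' d) /\ forall l : 'I_m,
     sat phi (ejoin (ejoin a a') (fun s v => ys s (l, v))) <-> (l < t)%N.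
  have el a' l : sat (rename (rl l) phi) (ejoin (ejoin a (ejoin ys d)) a') =
      sat phi (ejoin (ejoin a a') (fun s v => ys s (l, v))).
    by rewrite sat_rename; congr sat; apply: funext2 => s [[|]|].
  have elit a' l : sat (lit t l) (ejoin (ejoin a (ejoin ys d)) a') <->
      (sat phi (ejoin (ejoin a a') (fun s v => ys s (l, v))) <-> (l < t)%N).
    rewrite /lit -el; case: (l < t)%N.
      by split=> [h|[_ h]]; [split|exact: h].
    by rewrite sat_not; split=> [h|[h _] /h//]; split=> // /h.
  rewrite sat_ex; split=> -[a' ha']; exists a'; move: ha'; rewrite sat_and sat_conj sat_rename.
    have -> : (fun s v => ejoin (ejoin a (ejoin ys d)) a' (rth s v)) = ejoin a' d.
      by apply: funext2 => s [].
    move=> [ha hl]; split=> // l; apply/elit; apply: hl.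
    by apply: (in_map_List (lit t)); apply/List_in; rewrite mem_enum.
  have -> : (fun s v => ejoin (ejoin a (ejoin ys d)) a' (rth s v)) = ejoin a' d.
    by apply: funext2 => s [].
  move=> [ha hl]; split=> // psi hp; have [l _ <-] := map_in_List hp; exact/elit.
pose Y (f : nat -> nat) : env M (cprod 'I_m V) := fun s p => y (f p.1) s p.2.
(* The parameters are the [y] with indices [0, ..., m] except [s], so exactly [s] of them precede
   [u_s]. Lowering [s] slides the first coordinate to the left. *)
pose T t s := sat (chi t) (ejoin (u1 s) (ejoin (Y (fun l => l + (s <= l)))%N d)).
have pick t s (iota f : nat -> nat) : (s <= m)%N ->
    (forall i j, (i < j)%N -> (j < m.+1)%N -> (iota i < iota j)%N) ->
    (forall l, (l < m)%N -> f l = iota (l + (s <= l))%N) ->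
    sat (chi t) (ejoin (u1 (iota s)) (ejoin (Y f) d)) <-> T t s.
  move=> sm hi hf; pose cc i := ejoin (w i) (y i).
  have mc : morley b' (fun=> r) (fun i => cc (iota i)) m.+1.
    have hb i : (i < m.+1)%N -> (iota i < (iota m).+1)%N.
      rewrite !ltnS leq_eqVlt => /orP[/eqP->//|h]; apply/ltnW/hi => //.
    exact: (mor_sub gr (ma _) hb hi).
  have := mor_uniq Mm sB' (smV_vsum Mm sW sV) (fun=> gr) (fun=> ir) mc (ma m.+1).
  pose rr z (v : vsum W1 (vsum (cprod 'I_m V) D) z) : vsum B' (cprod 'I_m.+1 (vsum (vsum W1 W2) V)) z :=
    match v with inl x => inr (inord s, inl (inl x))
    | inr (inl (l, c)) => inr (inord (l + (s <= l)), inr c)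
    | inr (inr c) => inl (rho z c) end.
  move=> /(eqtp_sub rr)/(_ (chi t)).
  have hl (l : 'I_m) : (l + (s <= l) < m.+1)%N.
    by have := ltn_ord l; case: (s <= l)%N; rewrite ?addn1 ?addn0 // => h; apply: ltnW.
  have -> : (fun z v => ejoin b' (pre (fun i => cc (iota i)) m.+1) (rr z v)) =
      ejoin (u1 (iota s)) (ejoin (Y f) d).
    apply: funext2 => z [x|[[l c]|c]] /=.
    - by rewrite /pre /= inordK.
    - by rewrite /pre /= inordK // /Y /= hf.
    - by rewrite hrho.
  have -> // : (fun z v => ejoin b' (pre cc m.+1) (rr z v)) =
      ejoin (u1 s) (ejoin (Y (fun l => l + (s <= l)))%N d).
  apply: funext2 => z [x|[[l c]|c]] /=.
  - by rewrite /pre /= inordK.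
  - by rewrite /pre /= inordK.
  - by rewrite hrho.
have Tt t : T t t.
  apply/chiE; exists (u2 t); split=> // l; rewrite -ew.
  rewrite (hphi t (l + (t <= l))%N); case: (leqP t l) => h; last by rewrite addn0 h.
  by split=> h'; lia.
have Tstep t s : (s < m)%N -> T t s <-> T t s.+1.
  move=> sm; have [k nk1] := G1 _ (chi t) (smV_vsum Mm (smV_cprod Mm (sml_count (monster_uncountable Mm) _) sV) sD).
  (* Parameter number [s] sits at the even offset [2 be] from [s], the first coordinate at the odd
     offset [2 al + 1], and the later parameters beyond all of these. Which of the two comes first
     is decided by [be <= al], so a difference between [T t s] and [T t s.+1] orders [chi t]. *)
  pose J be l := (if l < s then l else if l == s then s + be.*2 else s + k.+2.*2 + l.+1)%N.
  pose a al := (s + al.*2.+1)%N.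
  have A1 al be : (al < k.+2)%N -> (be <= al)%N -> sat (chi t) (ejoin (u1 (a al)) (ejoin (Y (J be)) d)) <-> T t s.+1.
    move=> hal hbe.
    pose io l := (if l < s then l else if l == s then s + be.*2 else if l == s.+1 then a al
       else s + k.+2.*2 + l)%N.
    have <- : io s.+1 = a al by rewrite /io; do !case: ifP; lia.
    apply: (@pick t s.+1 io (J be) sm).
      by move=> i j; rewrite /io /a; do !case: ifP; lia.
    move=> l hl; rewrite /J /io /a; do !case: ifP; lia.
  have A2 al be : (al < be)%N -> (be < k.+2)%N -> sat (chi t) (ejoin (u1 (a al)) (ejoin (Y (J be)) d)) <-> T t s.
    move=> hal hbe.
    pose io l := (if l < s then l else if l == s then a al else if l == s.+1 then s + be.*2
       else s + k.+2.*2 + l)%N.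
    have <- : io s = a al by rewrite /io; do !case: ifP; lia.
    apply: (@pick t s io (J be) (ltnW sm)).
      by move=> i j; rewrite /io /a; do !case: ifP; lia.
    move=> l hl; rewrite /J /io /a; do !case: ifP; lia.
  split=> hT; apply: contrapT => hT'; apply: nk1.
    exists (fun i => u1 (a i)), (fun j => ejoin (Y (J j)) d); split=> [i _|i j hi hj]; first exact: h1.
    by case: (ltnP i j) => hij; [rewrite A2|rewrite A1] => //; lia.
  apply: (@ord_rev _ _ _ _ _ (fun i => u1 (a i)) (fun j => ejoin (Y (J j)) d)) => [i _|i j hi hj]; first exact: h1.
  by case: (leqP j i) => hij; [rewrite A1|rewrite A2] => //; lia.
have T0 t : (t <= m)%N -> T t 0%N.
  move=> tm; suff H s : (s <= t)%N -> T t (t - s)%N by have := H t (leqnn t); rewrite subnn.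
  elim: s => [|s IH] hs; first by rewrite subn0.
  by rewrite Tstep; [rewrite -subSn // subSS; apply: IH; exact: ltnW|lia].
have H t : {a' : env M W2 | (t <= m)%N -> sat th2 (ejoin a' d) /\ forall l, (l < m)%N ->
     sat phi (ejoin (ejoin (u1 0%N) a') (y l.+1)) <-> (l < t)%N}.
  apply: cid; case: (leqP t m) => tm; last by exists (u2 0%N).
  have /chiE[a' [k1 k2]] := T0 t tm; exists a' => _; split=> // l hl.
  by have := k2 (Ordinal hl); rewrite /Y /= addn1.
apply: nm; exists (fun i => sval (H (m - i.+1)%N)), (fun j => ejoin (u1 0%N) (y (m - j.+1).+1)).
split=> [i hi|i j hi hj].
  by have [|h _] := proj2_sig (H (m - i.+1)%N); [lia|exact: h].
rewrite ephi2; have [|_ h] := proj2_sig (H (m - i.+1)%N); first by lia.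
by rewrite h; [split=> hh; lia|lia].
Qed.

Definition thtup (D : ctx) n (so : 'I_n -> lsort L)
    (th : forall i, form (vsum (vars (single (so i))) D)) : form (vsum (vars so) D) :=
  FConj (map (fun i => rename (sum_map (fun s (x : vars (single (so i)) s) =>
     match x in vars _ s return vars so s with Var _ => Var i end) (fun s v => v)) (th i))
   (enum 'I_n)).

Lemma sat_thtup (D : ctx) n (so : 'I_n -> lsort L)
    (th : forall i, form (vsum (vars (single (so i))) D)) (w : env M (vars so)) (d : env M D) :
  sat (thtup th) (ejoin w d) = (forall i, sat (th i) (ejoin (tenv (tup1 (w _ (Var i)))) d)).
Proof.
have E i : (fun s v => ejoin w d (sum_map (fun s (x : vars (single (so i)) s) =>
     match x in vars _ s return vars so s with Var _ => Var i end) (fun s v => v) v)) =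
   ejoin (tenv (tup1 (w _ (Var i)))) d by apply: funext2 => s [[]|].
rewrite sat_conj propeqE; split=> [h i|h phi hp]; last have [i _ <-] := map_in_List hp.
  rewrite -E -sat_rename; apply: h.
  by apply: (in_map_List (fun i => _)); apply/List_in; rewrite mem_enum.
by rewrite sat_rename E.
Qed.

Lemma Good_tup (D : ctx) (d : env M D) n (so : 'I_n -> lsort L)
    (th : forall i, form (vsum (vars (single (so i))) D)) : smV D ->
  (forall i, Good K (th i) d) -> Good K (thtup th) d.
Proof.
move=> sD; elim: n so th => [|n IH] so th hG V phi sV.
  (* All points of the empty context coincide, so not even two of them can be ordered. *)
  exists 2 => -[x [y [_ h]]].
  have e : x 0%N = x 1%N by apply: funext2 => s [[]].
  by have := (h 0%N 1%N isT isT).2 isT; rewrite e => /(h 1%N 1%N isT isT).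
pose so' k := so (lift ord0 k); pose th' k := th (lift ord0 k).
have G' : Good K (thprod (th ord0) (thtup th')) d.
  have sn := monster_uncountable Mm.
  apply: Good_prod => //.
  - by apply: (smV_vars (K := K)); exact: (sml_count sn).
  - exact: (smV_fin Mm).
  - exact: fin_vars.
  - by apply: (IH so' th') => i; exact: hG.
have [r [r0 r1]] := vars_split so.
pose rr s (v : vsum (vars so) V s) : vsum (vsum (vars (single (so ord0))) (vars so')) V s :=
  match v with inl x => inl (r s x) | inr c => inr c end.
have [k nk] := G' V (rename rr phi) sV.
exists k => -[x [y [hx hxy]]]; apply: nk.
pose hd (w : env M (vars so)) : env M (vars (single (so ord0))) := tenv (tup1 (w _ (Var ord0))).
pose tl (w : env M (vars so)) : env M (vars so') := tenv (fun i => w _ (Var (lift ord0 i))).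
have E (w : env M (vars so)) s v : ejoin (hd w) (tl w) (r s v) = w s v.
  case: v => i; case: (unliftP ord0 i) => [l|] ->; first by rewrite r1.
  by rewrite r0.
exists (fun i => ejoin (hd (x i)) (tl (x i))), y; split=> [i hi|i j hi hj].
  suff : sat (thprod (th ord0) (thtup th')) (ejoin (ejoin (hd (x i)) (tl (x i))) d) by [].
  have : sat (thtup th) (ejoin (x i) d) := hx i hi; rewrite sat_thprod sat_thtup => h.
  split; first exact: h.
  by rewrite sat_thtup => l; exact: (h (lift ord0 l)).
rewrite sat_rename -hxy //.
have -> // : (fun s v => ejoin (ejoin (hd (x i)) (tl (x i))) (y j) (rr s v)) = ejoin (x i) (y j).
by apply: funext2 => s [v|v] //=; rewrite E.
Qed.

(** An order on arguments of a definable function with values in a good set is an order on the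
    values. This is the source of the stable formulas to which domination is applied. *)
Lemma stf_graph (W1 W2 B D V : ctx) (b : env M B) (d : env M D) (th : form (vsum W2 D))
    (Gam : form (vsum W2 (vsum W1 B))) (psi : form (vsum W2 (vsum B V)))
    (chi : form (vsum W1 (vsum B V))) :
  smV B -> smV V -> Good K th d ->
  (forall x w, sat Gam (ejoin w (ejoin x b)) -> sat th (ejoin w d)) ->
  (forall x w w', sat Gam (ejoin w (ejoin x b)) -> sat Gam (ejoin w' (ejoin x b)) -> w = w') ->
  (forall x v, sat chi (ejoin x (ejoin b v)) <->
     exists2 w, sat Gam (ejoin w (ejoin x b)) & sat psi (ejoin w (ejoin b v))) ->
  stable_for b chi.
Proof.
move=> sB sV G hth fG hchi; have [k nk] := G _ psi (smV_vsum Mm sB sV).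
(* The term [y k] provides a true instance, hence a value of the function, at every index below [k];
   the instance at [0] and [1] gives a default value even for [k = 0]. *)
exists k.+2 => -[x [y [_ ho]]]; apply: nk.
have [w0 _] : exists w0 : env M W2, True.
  by have /hchi[w _ _] := (ho 0%N 1%N isT isT).2 isT; exists w.
have H i : {w | (i < k)%N -> sat Gam (ejoin w (ejoin (x i) b))}.
  apply: cid; case: (ltnP i k) => hi; last by exists w0.
  have [h1 h2] : (i < k.+2)%N /\ (k < k.+2)%N by split; lia.
  by have /hchi[w hw _] := (ho i k h1 h2).2 hi; exists w.
exists (fun i => sval (H i)), (fun j => ejoin b (y j)); split=> [i hi|i j hi hj].
  by case: (H i) => w /= /(_ hi); exact: hth.
have [hi' hj'] : (i < k.+2)%N /\ (j < k.+2)%N by split; lia.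
apply: (iff_trans _ (ho i j hi' hj')); rewrite hchi; have hw := proj2_sig (H i) hi.
split=> [h|[w hw' h]]; first by exists (sval (H i)).
by rewrite (fG _ _ _ hw hw').
Qed.

End Products.

(** * Closures, definable graphs and extraction of subsequences *)

Section Closure.
Variables (K : Type) (L : language) (M : structure L).
Hypothesis Mm : monster K M.
Notation ctx := (lsort L -> Type).
Notation smV := (smV K).

Lemma lsat_tup1 (A : set (elt M)) s (phi' : form (vsum (vars (single s)) (par A))) m :
  lsat (rename (@forget_par _ _ _ A) phi') (tup1 m) =
  sat phi' (ejoin (tenv (tup1 m)) (penv (A := A))).
Proof. by rewrite /lsat sat_over. Qed.

Lemma app_tup1 g s (m : M s) : app g (tenv (tup1 m)) = tenv (tup1 (g s m)).
Proof. by apply: funext2 => t [[]]. Qed.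

Lemma app_penv (A : set (elt M)) g : (forall s m, A (existT _ s m) -> g s m = m) <->
  app g (penv (A := A)) = penv (A := A).
Proof.
split=> [h|h s m hA]; first by apply: funext2 => s [m hm]; exact: h.
exact: (congr1 (fun f : env M (par A) => f s (mkpar hA)) h).
Qed.

Lemma dcl_fix (A : set (elt M)) g u : automorphism g -> app g (penv (A := A)) = penv (A := A) ->
  dcl A u -> g _ (projT2 u) = projT2 u.
Proof.
move=> ga gA; case: u => s m [phi [phi' _ <-] h]; apply/h => /=.
have : lsat (rename (@forget_par _ _ _ A) phi') (tup1 m) by apply/h.
by rewrite !lsat_tup1 -(sat_aut _ _ ga) app_ejoin gA app_tup1.
Qed.

Lemma sub_acl (A : set (elt M)) : A `<=` acl A.
Proof.
move=> [s m] hA.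
pose phi' : form (vsum (vars (single s)) (par A)) :=
  FEq (TVar (inl (Var tt))) (TVar (inr (mkpar hA))).
exists (rename (@forget_par _ _ _ A) phi'); first by exists phi'.
have E m' : lsat (rename (@forget_par _ _ _ A) phi') (tup1 m') <-> m' = m by rewrite lsat_tup1.
split; first exact/E.
rewrite (_ : [set m' | _] = [set m]); first exact: finite_set1.
by apply/seteqP; split=> m' /= /E.
Qed.

Lemma dcl_sub_acl (A : set (elt M)) : dcl A `<=` acl A.
Proof.
move=> [s m] [phi ov h] /=; exists phi => //=; split; first exact/h.
rewrite (_ : [set m' | _] = [set m]); first exact: finite_set1.
by apply/seteqP; split=> m' /= /h.
Qed.

Lemma acl_aut (A : set (elt M)) g s m : automorphism g -> app g (penv (A := A)) = penv (A := A) ->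
  acl A (existT _ s m) -> acl A (existT _ s (g s m)).
Proof.
move=> ga gA [phi [phi' _ <-] [h1 h2]] /=; exists (rename (@forget_par _ _ _ A) phi'); first by exists phi'.
split=> //=; move: h1; rewrite /= !lsat_tup1 -(sat_aut _ _ ga) app_ejoin gA.
by rewrite app_tup1.
Qed.

(** An algebraic element is determined by its sort, a formula with finitely many solutions and its
    number among them; [fenc] bounds the formulas. *)
Lemma acl_small (A : set (elt M)) : small K A -> small K (acl A).
Proof.
move=> sA; apply/smallE.
have Kn := monster_uncountable Mm; have Kp := monster_strong_limit Mm.
pose V s : ctx := vsum (vars (single s)) (par A).
pose A1 : Type := {s & vsum (fun _ : lsort L => unit) (par A) s}.
have lS s : lec (form (V s)) (code L A1).
  pose lv t (v : V s t) : A1 + nat := inl (existT _ t (match v with inl _ => inl tt | inr c => inr c end)).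
  exists (fenc 0 lv) => phi psi; apply: fenc_inj => // t t' v v' e0.
  have ea : existT (vsum (fun _ : lsort L => unit) (par A)) t (match v with inl _ => inl tt | inr c => inr c end) =
      existT _ t' (match v' with inl _ => inl tt | inr c => inr c end).
    exact: (congr1 (fun u : A1 + nat => if u is inl a then a else existT _ t (inl tt)) e0).
  case: v v' {e0} ea => [x|c] [x'|c'] ea.
  - by move: x x' {ea} => [[]] [[]].
  - by case: (existT_elim (Q := fun s v => match v with inl _ => True | inr _ => False end) ea I).
  - by case: (existT_elim (Q := fun s v => match v with inl _ => False | inr _ => True end) ea I).
  - exact: (existT_elim (Q := fun t'' v => match v with inl _ => True
      | inr c' => existT (V s) t (inr c) = existT (V s) t'' (inr c') end) ea erefl).
pose f s := projT1 (cid (lS s)); have fi s : injective (f s) := projT2 (cid (lS s)).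
have ix s (phi : form (V s)) : {h : M s -> nat | finite_set [set m | lsat (rename (@forget_par _ _ _ A) phi) (tup1 m)] ->
   forall m m', lsat (rename (@forget_par _ _ _ A) phi) (tup1 m) ->
    lsat (rename (@forget_par _ _ _ A) phi) (tup1 m') -> h m = h m' -> m = m'}.
  apply: cid; set S := [set m | _].
  case: (pselect (finite_set S)) => [fS|nf]; last by exists (fun=> 0%N).
  have [n] := fS; rewrite card_eq_le => /andP[/card_leE[h hi] _].
  exists (fun m => match pselect (S m) with left hm => sval (h (exist _ m hm)) | right _ => 0%N end).
  move=> _ m m' hm hm'; case: pselect => // k; case: pselect => // k' e.
  have : h (exist _ m k) = h (exist _ m' k').
    by case: (h _) e => x hx /= e; move: hx; rewrite e => hx; case: (h _) hx => y hy hy' /=; rewrite (Prop_irrelevance hy hy').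
  by move/hi => [].
have W (u : {u | acl A u}) : {phi : form (V (projT1 (sval u))) |
   lsat (rename (@forget_par _ _ _ A) phi) (tup1 (projT2 (sval u))) /\
   finite_set [set m | lsat (rename (@forget_par _ _ _ A) phi) (tup1 m)]}.
  by apply: cid; have [phi [phi' _ <-] h] := proj2_sig u; exists phi'.
suff h : lec {u | acl A u} (lsort L * (code L A1 * nat)).
  apply: sml_le h _; have ss : sml K (lsort L) by exact/smallT/(monster_sort Mm).
  have sn := sml_nat Kn.
  have sf : sml K (Defs.fsym L) by exact/smallT/(monster_fsym Mm).
  have sr : sml K (rsym L) by exact/smallT/(monster_rsym Mm).
  have sA1 : sml K A1.
    apply: (smV_vsum Mm); last exact: (smV_par sA).
    by apply: sml_le ss; exists (fun u => projT1 u) => -[s []] [s' []] /= ->.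
  apply: (sml_prod Kp) => //; apply: (sml_prod Kp) => //; apply: (sml_set Kp).
  apply: (sml_prod Kp); first exact: (sml_count Kn).
  by do !apply: (sml_sum Kn Kp).
exists (fun u => (projT1 (sval u), (f _ (sval (W u)), sval (ix _ (sval (W u))) (projT2 (sval u))))).
move=> u u'; case: (W u) => phi /= [p1 p2]; case: (W u') => phi' /= [p1' p2'].
move: u u' phi p1 p2 phi' p1' p2' => [[s m] hu] [[s' m'] hu'] /= phi p1 p2 phi' p1' p2' e.
have es := congr1 fst e; rewrite /= in es; subst s'.
have ef := fi _ _ _ (congr1 (fun z => z.2.1) e); subst phi'.
have em := proj2_sig (ix _ phi) p2 _ _ p1 p1' (congr1 (fun z => z.2.2) e); subst m'.
by rewrite (Prop_irrelevance hu hu').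
Qed.

Lemma eqform (W : ctx) : fin W -> exists th : form (vsum W W),
  forall (x d : env M W), sat th (ejoin x d) <-> x = d.
Proof.
move=> [l hl]; exists (FConj (map (fun u => FEq (TVar (inl (projT2 u))) (TVar (inr (projT2 u)))) l)).
move=> x d; rewrite sat_conj; split=> [h|-> phi hp].
  by apply: funext2 => s v; exact: (h _ (in_map_List _ (hl s v))).
by have [u _ <-] := map_in_List hp.
Qed.

(** Uniqueness of the value is made part of the formula, so that it is functional at every argument
    and not only at [a] and [b]. *)
Lemma def_graph (W W1 B : ctx) (a : env M W1) (b : env M B) (w0 : env M W) :
  fin W -> smV W -> smV W1 -> smV B ->
  (forall g, automorphism g -> app g a = a -> app g b = b -> app g w0 = w0) ->
  exists Gam : form (vsum W (vsum W1 B)),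
   (forall (x : env M W1) (b' : env M B) (w w' : env M W), sat Gam (ejoin w (ejoin x b')) -> sat Gam (ejoin w' (ejoin x b')) -> w = w') /\
   forall w, sat Gam (ejoin w (ejoin a b)) <-> w = w0.
Proof.
move=> fW sW s1 sB hfix; have [th hth] := eqform fW.
have [|chi hchi] := @invdef _ _ _ Mm _ _ _ (ejoin a b) w0 th (smV_vsum Mm s1 sB) sW sW.
  move=> g ga; rewrite app_ejoin => /ejoin_inj[g1 g2] x /hth ->; apply/hth.
  exact: hfix.
pose E : ctx := vsum (vsum W (vsum W1 B)) W.
pose r1 s (v : vsum W (vsum W1 B) s) : E s := match v with inl w => inr w | inr c => inl (inr c) end.
pose r2 s (v : vsum W W s) : E s := match v with inl w => inr w | inr c => inl (inl c) end.
exists (FAnd chi (FAl fW (FImp (rename r1 chi) (rename r2 th)))).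
have E1 (x : env M W1) (b' : env M B) (w w' : env M W) : sat (rename r1 chi) (ejoin (ejoin w (ejoin x b')) w') = sat chi (ejoin w' (ejoin x b') : env M _).
  by rewrite sat_rename; congr sat; apply: funext2 => s [].
have E2 (x : env M W1) (b' : env M B) (w w' : env M W) : sat (rename r2 th) (ejoin (ejoin w (ejoin x b')) w') <-> w' = w :> env M W.
  rewrite sat_rename -hth; suff -> : (fun s v => ejoin (ejoin w (ejoin x b')) w' (r2 s v)) = ejoin w' w by [].
  by apply: funext2 => s [].
have GE (x : env M W1) (b' : env M B) (w : env M W) : sat (FAnd chi (FAl fW (FImp (rename r1 chi) (rename r2 th)))) (ejoin w (ejoin x b')) <->
   sat chi (ejoin w (ejoin x b')) /\ forall w', sat chi (ejoin w' (ejoin x b')) -> w' = w.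
  rewrite sat_and sat_al; split=> -[h1 h2]; split=> // w'.
    move=> hw'; apply/(E2 x b'); have := h2 w' => /=; apply.
    by rewrite (E1 x b' w w').
  rewrite /= (E1 x b' w w') => hw'; apply/(E2 x b'); exact: h2.
split=> [x b' w w' /GE[h1 h2] /GE[h3 h4]|w]; first exact: h4.
rewrite GE; split=> [[/hchi/hth //]|->]; split; first exact/hchi/hth.
by move=> w' /hchi/hth.
Qed.

Lemma increasing_subsequence (P : nat -> Prop) : (forall N, exists2 n, (N <= n)%N & P n) ->
  exists iota : nat -> nat, (forall i j, (i < j)%N -> (iota i < iota j)%N) /\ forall i, P (iota i).
Proof.
move=> h; have {}h N : {n | (N <= n)%N /\ P n}.
  by apply: cid; have [n h1 h2] := h N; exists n.
pose iota := fix iota i := if i is i'.+1 then sval (h (iota i').+1) else sval (h 0%N).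
have lt1 i : (iota i < iota i.+1)%N by rewrite /=; case: (h _) => n [].
exists iota; split; last by case=> [|i] /=; case: (h _) => n [].
move=> i; elim=> // j IH; rewrite ltnS leq_eqVlt => /orP[/eqP->|/IH hh]; first exact: lt1.
exact: ltn_trans hh (lt1 j).
Qed.

Lemma subsequence (P : nat -> Prop) : exists iota : nat -> nat, injective iota /\
  ((forall i, P (iota i)) \/ (forall i, ~ P (iota i))).
Proof.
case: (pselect (forall N, exists2 n, (N <= n)%N & P n)) => h; last first.
  have [N hN] : exists N, forall n, (N <= n)%N -> ~ P n.
    apply: contrapT => h'; apply: h => N; apply: contrapT => h2; apply: h'; exists N => n hn hp.
    by apply: h2; exists n.
  exists (fun i => N + i)%N; split; first by move=> i j /addnI.
  by right=> i; apply: hN; exact: leq_addr.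
have [iota [lt2 hP]] := increasing_subsequence h.
exists iota; split; last by left.
move=> i j e; case: (ltngtP i j) => // /lt2; by rewrite e ltnn.
Qed.

(** Finitely many formulas are made constant by passing to a subsequence, and compactness does the
    rest. It serves to turn dividing over [C] into a family with one type over [acl C], where [q] is
    invariant. *)
Lemma extract (V B : ctx) (c : nat -> env M V) (b : env M B) (k : nat)
    (Om : form (vsum (cprod 'I_k V) B)) : smV V -> smV B ->
  (forall iota : 'I_k -> nat, injective iota ->
     sat Om (ejoin (fun s p => c (iota p.1) s p.2) b)) ->
  exists z : 'I_k -> env M V, [/\ sat Om (ejoin (fun s p => z p.1 s p.2) b),
    forall i i', eqtp (ejoin (z i) b) (ejoin (z i') b) &
    forall sig : form (vsum V B), (forall i, sat sig (ejoin (c i) b)) ->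
      forall i, sat sig (ejoin (z i) b)].
Proof.
move=> sV sB hOm.
have Kn := monster_uncountable Mm.
have sC : smV (cprod 'I_k V) by apply: (smV_cprod Mm) => //; exact: (sml_count Kn).
pose ri (i : 'I_k) s (v : vsum V B s) : vsum (cprod 'I_k V) B s :=
  match v with inl x => inl (i, x) | inr c => inr c end.
have Ei i sig (z : 'I_k -> env M V) : sat (rename (ri i) sig) (ejoin (fun s p => z p.1 s p.2) b) =
    sat sig (ejoin (z i) b).
  by rewrite sat_rename; congr sat; apply: funext2 => s [].
pose Sig : set (form (vsum (cprod 'I_k V) B)) := [set phi | [\/ phi = Om,
   exists i sig, phi = rename (ri i) sig /\ forall i, sat sig (ejoin (c i) b) |
   exists i i' th, phi = FIff (rename (ri i) th) (rename (ri i') th)]].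
have [l hl|z0 hz0] := @realise _ _ _ Mm _ _ b Sig sB sC; last first.
  pose z i : env M V := fun s v => z0 s (i, v).
  have ez : (fun s p => z p.1 s p.2) = z0 by apply: funext2 => s [].
  exists z; rewrite ez; split.
  - by apply: hz0; constructor 1.
  - move=> i i' phi; rewrite -!Ei ez -sat_iff; apply: hz0; constructor 3.
    by exists i, i', phi.
  - by move=> sig hs i; rewrite -Ei ez; apply: hz0; constructor 2; exists i, sig.
have [ths hths] : exists ths : seq (form (vsum V B)), forall iota : 'I_k -> nat, injective iota ->
    (forall th, List.In th ths -> forall i i', sat th (ejoin (c (iota i)) b) <-> sat th (ejoin (c (iota i')) b)) ->
    forall phi, List.In phi l -> sat phi (ejoin (fun s p => c (iota p.1) s p.2) b).
  elim: l hl => [|phi l IH] hl; first by exists [::].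
  have [|ths hths] := IH; first by move=> psi h; apply: hl; right.
  case: (hl phi (or_introl erefl)) => [->|[i [sig [-> hs]]]|[i [i' [th ->]]]].
  - by exists ths => iota ii hi psi [<-|]; [exact: hOm|exact: hths].
  - exists ths => iota ii hi psi [<-|]; last exact: hths.
    by rewrite (Ei i sig (fun i => c (iota i))).
  - exists (th :: ths) => iota ii hi psi [<-|]; last first.
      by apply: hths => // th' h; apply: hi; right.
    rewrite sat_iff !(Ei _ th (fun i => c (iota i))); apply: hi; by left.
have [iota [ii hi]] : exists iota : nat -> nat, injective iota /\
   forall th, List.In th ths -> forall i i', sat th (ejoin (c (iota i)) b) <-> sat th (ejoin (c (iota i')) b).
  elim: (ths) => [|th ths' [iota [ii hi]]]; first by exists id; split=> // th [].
  have [kap [ki hk]] := subsequence (fun i => sat th (ejoin (c (iota i)) b)).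
  exists (iota \o kap); split; first exact: inj_comp.
  move=> th' [<-|h] i i'; last exact: hi.
  by case: hk => hk; split=> h; [exact: hk|exact: hk|case: (hk _ h)|case: (hk _ h)].
pose io (i : 'I_k) := iota (val i).
have hio : injective io by move=> i i' /ii/val_inj.
exists (fun s p => c (io p.1) s p.2).
by apply: (hths io hio) => th h i i'; exact: hi.
Qed.

End Closure.

(** * Formulas of the induced structures read in the ambient one *)

Section Translation.
Variables (L : language) (M : structure L) (D : set (elt M)) (J : Type) (X : J -> dset D).

Inductive vtr (V : J -> Type) : lsort L -> Type := VT (i : J) (v : V i) : vtr V (dsort (X i)).
Arguments VT {V i} v.

Definition vale (V : J -> Type) (e : env (induced X) V) : env M (vtr V) :=
  fun s x => match x in vtr _ s return M s with VT i v => sval (e i v) end.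

Lemma dform_par (Y : dset D) : exists th : form (vsum (vars (single (dsort Y))) (par D)),
  dform Y = rename (@forget_par _ _ _ D) th.
Proof. by have [th _ e] := dform_over Y; exists th; rewrite e. Qed.

Lemma induced_term (V : J -> Type) i (t : term (L := induced_language X) V i) :
  exists v : V i, t = TVar v.
Proof. by case: t => [s v|[]]; exists v. Qed.

Lemma translate (V : J -> Type) (phi : form (L := induced_language X) V) :
  exists psi : form (vsum (vtr V) (par D)), forall e : env (induced X) V,
    sat phi e <-> sat psi (ejoin (vale e) (penv (A := D))).
Proof.
elim: phi => {V} [V|V s t u|V R ts|V phi [psi1 IH1] psi [psi2 IH2]|V s phi [psi IH]].
- by exists (FBot _).
- have [v ->] := induced_term t; have [v' ->] := induced_term u.
  exists (FEq (TVar (inl (VT v))) (TVar (inl (VT v')))) => e /=.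
  split=> [->//|]; case: (e s v) => m h; case: (e s v') => m' h' /= em; subst m'.
  by rewrite (Prop_irrelevance h h').
- have H i := cid (induced_term (ts i)).
  case: R ts H => n [js [chi [chi' _ echi]]] /= ts H.
  pose r s (x : vsum (vars (fun i => dsort (X (js i)))) (par D) s) : vsum (vtr V) (par D) s :=
    match x with inl x => match x in vars _ s return vsum (vtr V) (par D) s with
      Var i => inl (VT (sval (H i))) end | inr c => inr c end.
  exists (rename r chi') => e; rewrite -echi /= /lsat sat_over sat_rename.
  have -> // : (fun s v => ejoin (vale e) (penv (A := D)) (r s v)) =
     ejoin (tenv (fun i => sval (teval e (ts i)))) (penv (A := D)).
  apply: funext2 => s [[i]|//] /=; by case: (H i) => v /= ->.
- by exists (FImp psi1 psi2) => e /=; rewrite IH1 IH2.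
- have [th hth] := dform_par (X s).
  pose r1 t (x : vsum (vars (single (dsort (X s)))) (par D) t) : ext (vsum (vtr V) (par D)) (dsort (X s)) t :=
    match x with inl x => match x in vars _ t return ext (vsum (vtr V) (par D)) (dsort (X s)) t with Var _ => New end
    | inr c => Old (inr c) end.
  pose r2 t (x : vsum (vtr (ext V s)) (par D) t) : ext (vsum (vtr V) (par D)) (dsort (X s)) t :=
    match x with
    | inl x => match x in vtr _ t return ext (vsum (vtr V) (par D)) (dsort (X s)) t with
       VT i v => match v in ext _ _ i return ext (vsum (vtr V) (par D)) (dsort (X s)) (dsort (X i)) with
         Old i v => Old (inl (VT v)) | New => New end end
    | inr c => Old (inr c) end.
  exists (FAll (FImp (rename r1 th) (rename r2 psi))) => e /=.
  have E1 m : sat (rename r1 th) (econs (ejoin (vale e) (penv (A := D))) m) = dmem (X := X s) m.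
    rewrite /dmem /lsat hth sat_over sat_rename; congr sat.
    by apply: funext2 => t [[]|].
  have E2 (m : induced X s) : sat (rename r2 psi) (econs (ejoin (vale e) (penv (A := D))) (sval m)) <-> sat phi (econs e m).
    rewrite IH sat_rename; suff -> : (fun t v => econs (ejoin (vale e) (penv (A := D))) (sval m) (r2 t v)) =
      ejoin (vale (econs e m)) (penv (A := D)) by [].
    by apply: funext2 => t [[i [{}i v|]]|].
  split=> h m; last by apply/E2; apply: h; rewrite E1; exact: (proj2_sig m).
  rewrite E1 => hm; exact: (E2 (exist _ m hm)).2.
Qed.

End Translation.

(** * Generic points are independent in the stable part *)

Section Independence.
Variables (K : Type) (L : language) (M : structure L).
Hypothesis Mm : monster K M.
Notation ctx := (lsort L -> Type).
Notation smV := (smV K).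
Variables (C : set (elt M)) (sC : small K C).
Variables (I : Type) (so : I -> lsort L).
Hypothesis sI : small K [set: I].

Notation pC := (penv (A := C)).
Notation bA := (penv (A := acl C)).
Notation W := (vars so).

Let sW : smV W. Proof. exact/smV_vars/smallT. Qed.
Let sA : smV (par (acl C)). Proof. exact/smV_par/(acl_small Mm). Qed.
Let sPC : smV (par C). Proof. exact: smV_par. Qed.

Lemma bA_pC g : app g bA = bA -> app g pC = pC.
Proof. by move=> /app_penv h; apply/app_penv => s m /(@sub_acl _ _ C)/h. Qed.

Lemma acl_perm g : automorphism g -> app g pC = pC ->
  exists rho : forall s, par (acl C) s -> par (acl C) s, forall s (c : par (acl C) s), bA c = app g bA (rho s c).
Proof.
move=> ga gC; have [h [ha hg gh]] := aut_inv ga.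
have hC : app h pC = pC by rewrite -{1}gC; apply: funext2 => s v; exact: hg.
exists (fun s c => mkpar (acl_aut ha hC (proj2_sig c))) => s [m hm] /=.
by rewrite /app /= gh.
Qed.

(** [g] only permutes [acl C]. *)
Lemma eqtp_acl_app (V : ctx) (z z' : env M V) g : automorphism g -> app g pC = pC ->
  eqtp (ejoin z bA) (ejoin z' bA) -> eqtp (ejoin (app g z) bA) (ejoin (app g z') bA).
Proof.
move=> ga gC h; have [rho hrho] := acl_perm ga gC.
have H (z0 : env M V) : ejoin (app g z0) bA = (fun s v => app g (ejoin z0 bA) (sum_map (fun s v => v) rho v)).
  by apply: funext2 => s [//|c]; exact: hrho.
rewrite !H; apply: eqtp_sub => phi; rewrite !sat_aut //.
Qed.

Section St.
Variable q : set (lform M W).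
Hypotheses (gq : gtp q) (iq : inv bA q).

Lemma fin_vtr n (zo : 'I_n -> St_sort C) : fin (vtr (@proj1_sig _ _) (vars zo)).
Proof.
exists (map (fun i => existT (vtr (@proj1_sig _ _) (vars zo)) _ (VT (@proj1_sig _ _) (Var i : vars zo _)))
   (enum 'I_n)) => s [i [l]].
by apply: (in_map_List (fun i => existT _ _ _)); apply/List_in; rewrite mem_enum.
Qed.

Lemma sm_vtr (V : St_sort C -> Type) : sml K {i & V i} -> smV (vtr (@proj1_sig _ _) V).
Proof.
apply: sml_le; exists (fun u => match projT2 u with VT i v => existT V i v end).
move=> [s [i v]] [s' [i' v']] /= e.
exact: (existT_elim (Q := fun i'' v'' => existT (vtr (@proj1_sig _ _) V) _ (VT (@proj1_sig _ _) v) = existT _ _ (VT (@proj1_sig _ _) v'')) e erefl).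
Qed.

Lemma sm_vtr_fin n (zo : 'I_n -> St_sort C) : smV (vtr (@proj1_sig _ _) (vars zo)).
Proof.
apply: sm_vtr; apply: sml_le (sml_count (monster_uncountable Mm) 'I_n).
exists (fun u => match projT2 u with Var i => i end).
by move=> [s [i]] [s' [i']] /= ->.
Qed.

Lemma sorts_form n (zo : 'I_n -> St_sort C) :
  exists th : form (vsum (vtr (@proj1_sig _ _) (vars zo)) (par C)),
   forall w : env M _, sat th (ejoin w pC) <->
     forall i, dmem (X := sval (zo i)) (w _ (VT (@proj1_sig _ _) (Var i : vars zo _))).
Proof.
have H i := cid (dform_par (sval (zo i))).
pose r i s (x : vsum (vars (single (dsort (sval (zo i))))) (par C) s) :
    vsum (vtr (@proj1_sig _ _) (vars zo)) (par C) s :=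
  match x with inl x => match x in vars _ s return vsum (vtr (@proj1_sig _ _) (vars zo)) (par C) s with
     Var _ => inl (VT (@proj1_sig _ _) (Var i : vars zo _)) end | inr c => inr c end.
exists (FConj (map (fun i => rename (r i) (sval (H i))) (enum 'I_n))) => w.
have E i : sat (rename (r i) (sval (H i))) (ejoin w pC) =
    dmem (X := sval (zo i)) (w _ (VT (@proj1_sig _ _) (Var i : vars zo _))).
  rewrite /dmem /lsat; case: (H i) => th0 /= ->; rewrite sat_over sat_rename; congr sat.
  by apply: funext2 => s [[]|].
rewrite sat_conj; split=> [h i|h phi hp]; last by have [i _ <-] := map_in_List hp; rewrite E.
rewrite -E; apply: h; apply: (in_map_List (fun i => _)); apply/List_in; by rewrite mem_enum.
Qed.

Lemma lift_St n (zo : 'I_n -> St_sort C) (w : env M (vtr (@proj1_sig _ _) (vars zo))) :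
  (forall i, dmem (X := sval (zo i)) (w _ (VT (@proj1_sig _ _) (Var i : vars zo _)))) ->
  exists x : tup (St_structure C) zo, vale (tenv x) = w.
Proof.
move=> h; exists (fun i => exist _ (w _ (VT (@proj1_sig _ _) (Var i : vars zo _))) (h i)).
by apply: funext2 => s [i [l]].
Qed.

Notation vt zo := (vtr (@proj1_sig _ _) (vars zo)).

Lemma translate2 n (so' : 'I_n -> St_sort C) m (zo : 'I_m -> St_sort C)
    (f : form (L := induced_language (@proj1_sig _ _)) (vsum (vars so') (vars zo))) :
  exists psi : form (vsum (vsum (vt so') (vt zo)) (par C)),
   forall (w : tup (St_structure C) so') (z : tup (St_structure C) zo), sat2 f w z <->
     sat psi (ejoin (ejoin (vale (tenv w)) (vale (tenv z))) pC).
Proof.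
have [psi hpsi] := translate f.
pose r s (x : vsum (vtr (@proj1_sig _ _) (vsum (vars so') (vars zo))) (par C) s) : vsum (vsum (vt so') (vt zo)) (par C) s :=
  match x with
  | inl x => match x in vtr _ _ s return vsum (vsum (vt so') (vt zo)) (par C) s with
     VT i v => match v with inl v => inl (inl (VT (@proj1_sig _ _) v)) | inr v => inl (inr (VT (@proj1_sig _ _) v)) end end
  | inr c => inr c end.
exists (rename r psi) => w z; rewrite /sat2 hpsi sat_rename.
suff -> : (fun s v => ejoin (ejoin (vale (tenv w)) (vale (tenv z))) pC (r s v)) =
  ejoin (vale (ejoin (tenv w) (tenv z))) pC by [].
by apply: funext2 => s [[i [v|v]]|v].
Qed.

(** Pulls a condition in the stable part back along [Gam] to the points of [W], where [q] can decide
    it. *)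
Lemma graph_form n (so' : 'I_n -> St_sort C) m (zo : 'I_m -> St_sort C)
    (Gam : form (vsum (vt so') (vsum W (par C))))
    (f : form (L := induced_language (@proj1_sig _ _)) (vsum (vars so') (vars zo))) :
  exists Psi : form (vsum W (vsum (vt zo) (par C))),
   forall (x : env M W) (z : tup (St_structure C) zo), sat Psi (ejoin x (ejoin (vale (tenv z)) pC)) <->
     exists w : tup (St_structure C) so', sat Gam (ejoin (vale (tenv w)) (ejoin x pC)) /\ sat2 f w z.
Proof.
have [psi hpsi] := translate2 f; have [th hth] := sorts_form so'.
pose E : ctx := vsum (vsum W (vsum (vt zo) (par C))) (vt so').
pose r1 s (v : vsum (vt so') (vsum W (par C)) s) : E s :=
  match v with inl w => inr w | inr (inl x) => inl (inl x) | inr (inr c) => inl (inr (inr c)) end.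
pose r2 s (v : vsum (vsum (vt so') (vt zo)) (par C) s) : E s :=
  match v with inl (inl w) => inr w | inl (inr z) => inl (inr (inl z)) | inr c => inl (inr (inr c)) end.
pose r3 s (v : vsum (vt so') (par C) s) : E s :=
  match v with inl w => inr w | inr c => inl (inr (inr c)) end.
exists (FEx (fin_vtr so') (FAnd (rename r1 Gam) (FAnd (rename r2 psi) (rename r3 th)))) => x z.
have E1 (w : env M (vt so')) : sat (FAnd (rename r1 Gam) (FAnd (rename r2 psi) (rename r3 th)))
    (ejoin (ejoin x (ejoin (vale (tenv z)) pC)) w) =
   (sat Gam (ejoin w (ejoin x pC)) /\ sat psi (ejoin (ejoin w (vale (tenv z))) pC) /\ sat th (ejoin w pC)).
  rewrite !sat_and !sat_rename; congr (_ /\ (_ /\ _)); congr sat; apply: funext2 => s [] //.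
  - by move=> [].
  - by move=> [].
rewrite sat_ex; split=> [[w]|[w [h1 h2]]].
  rewrite E1 => -[h1 [h2 /hth/lift_St[x' ex']]]; subst w.
  by exists x'; split=> //; exact/hpsi.
exists (vale (tenv w)); rewrite E1; split=> //; split; first exact/hpsi.
by apply/hth => i; exact: proj2_sig.
Qed.

(** The pullback of a forking formula lies in [q], hence so does that of one of the dividing
    formulas covering it. By invariance [q] then contains the pullbacks of conjugates with the same
    type over [acl C]. At a point generic over all of them, the single value of the graph satisfies
    [k] conjugates at once, against dividing. *)
Lemma real_independent (V : ctx) (e : env M V) (al : tup M so) : smV V ->
  real bA q (tenv al) e -> St_independent C (trange al) (acl C `|` erange e).
Proof.
move=> sV ra n so' w hw phi [phi' _ <-] hphi [r [P [hdiv hcov]]].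
set B := acl C `|` erange e in phi' hphi hcov.
set E := (_ `|` _) in phi' hphi hcov.
have [n2 [so2 [phi0 [r2 er2]]]] := fsupp phi'; subst phi'.
pose be : tup (St_structure C) so2 := fun i => sval (r2 _ (Var i)).
have phiE (x : tup (St_structure C) so') :
    lsat (rename (@forget_par _ _ _ E) (rename (sum_map (fun s v => v) r2) phi0)) x = sat2 phi0 x be.
  rewrite /lsat sat_over sat_rename; congr sat.
  by apply: funext2 => s [[]|[]].
have fixB g : automorphism g -> app g bA = bA -> app g e = e -> app g (vale (tenv be)) = vale (tenv be).
  move=> ga gA ge; have gC := bA_pC gA.
  apply: funext2 => s [i [k]]; rewrite /app /=.
  have gB : app g (penv (A := C `|` B)) = penv (A := C `|` B).
    apply/app_penv => s' m [hm|[hm|[v hv]]].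
    - by move/app_penv: gC; apply.
    - by move/app_penv: gA; apply.
    - by move: hv => /= <-; exact: (congr1 (fun f : env M V => f s' v) ge).
  rewrite /be; case: (r2 _ (Var k)) => m [[_ hm]|hm] /=; first exact: (dcl_fix ga gB hm).
  by move/app_penv: gC; apply; exact: hm.
have [|Gam [fG hG]] := @def_graph _ _ _ Mm _ _ _ (tenv al) pC (vale (tenv w)) (fin_vtr so') (sm_vtr_fin so') sW sPC.
  move=> g ga gal gC; apply: funext2 => s [i [k]]; rewrite /app /=.
  have gB : app g (penv (A := C `|` trange al)) = penv (A := C `|` trange al).
    apply/app_penv => s' m [hm|[i' _ ei]]; first by move/app_penv: gC; apply.
    have es := congr1 (@projT1 _ _) ei; rewrite /= in es; subst s'.
    rewrite -(existT_inj ei).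
    exact: (congr1 (fun f : env M W => f _ (Var i')) gal).
  have [_ hm] := hw _ (ex_intro2 _ _ k Logic.I erefl).
  exact: (dcl_fix ga gB hm).
have [Ph hPh] := graph_form Gam phi0.
have qPh : Q q Ph (ejoin (vale (tenv be)) pC).
  (* [al] is known to be generic over [e] only. But [be] is fixed by all automorphisms over [acl C]
     and [e], so one of these takes [al] to a point generic over [be] as well. *)
  have [a' ra'] := real_ex Mm bA sA sW (ejoin e (vale (tenv be))) gq (smV_vsum Mm sV (sm_vtr_fin so2)).
  have ra2 : real bA q a' e by apply: (real_sub (rho := fun s v => inr (inl v)) gq ra').
  have [g [ga]] := hom Mm (smV_vsum Mm sW (smV_vsum Mm sA sV))
     (real_eqtp Mm sA gq iq sV ra ra2 (eqtp_refl _)).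
  rewrite !app_ejoin => /ejoin_inj[g1 /ejoin_inj[gA ge]].
  apply/(real_at (rho := fun s (v : vsum (vt so2) (par C) s) => match v with inl v => inr (inr v)
      | inr c => inl (mkpar (sub_acl (proj2_sig c))) end) _ gq ra'); first by move=> s [].
  rewrite -g1 -{1}(fixB g ga gA ge) -[in X in ejoin _ (ejoin _ X)](bA_pC gA) -!app_ejoin sat_aut //.
  by apply/hPh; exists w; split; [exact/hG|rewrite -phiE].
have [l [m [zo [f [d [hP [k [ee [het hin]]]]]]]] [Ps [hPs qPs]]] : exists l, exists m (zo : 'I_m -> St_sort C)
    (f : form (L := induced_language (@proj1_sig _ _)) (vsum (vars so') (vars zo))) (d : tup (St_structure C) zo),
   [/\ (forall x, P l x <-> sat2 f x d),
    exists (k : nat) (ee : nat -> tup (St_structure C) zo),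
      (forall i, tp (ee i) (@St_val _ _ C @^-1` C) = tp d (@St_val _ _ C @^-1` C)) /\
      forall t : 'I_k -> nat, injective t -> ~ exists x : tup (St_structure C) so', forall l, sat2 f x (ee (t l)) &
    exists Ps : form (vsum W (vsum (vt zo) (par C))),
     (forall (x : env M W) (z : tup (St_structure C) zo), sat Ps (ejoin x (ejoin (vale (tenv z)) pC)) <->
     exists w : tup (St_structure C) so', sat Gam (ejoin (vale (tenv w)) (ejoin x pC)) /\ sat2 f w z) /\
     Q q Ps (ejoin (vale (tenv d)) pC)].
  apply: contrapT => nl.
  have H l : {F : lform M W | q F /\ forall x, sat F (ejoin x (@pid _ M)) ->
     ~ exists w : tup (St_structure C) so', sat Gam (ejoin (vale (tenv w)) (ejoin x pC)) /\ P l w}.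
    apply: cid; have [m [zo [f [d [h1 h2]]]]] := hdiv l.
    have [Ps hPs] := graph_form Gam f.
    exists (rename (sum_map (fun s v => v) (ejoin (vale (tenv d)) pC)) (FNot Ps)); split.
      apply: contrapT => nq; apply: nl; exists l, m, zo, f, d; split=> //.
      exists Ps; split=> //; apply: contrapT => nQ; apply: nq.
      exact: ((Q_not gq Ps (ejoin (vale (tenv d)) pC)).2 nQ).
    move=> x; rewrite sat_Q sat_not hPs => nx [w0 [k1 /h1 k2]]; apply: nx; by exists w0.
  have [F hF|x hx] := gq.2 (rename (sum_map (fun s v => v) (ejoin (vale (tenv be)) pC)) Ph :: map (fun l => sval (H l)) (enum 'I_r)).
    case: hF => [<- //|hp]; have [l _ <-] := map_in_List hp.
    by case: (proj2_sig (H l)).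
  have := hx _ (or_introl erefl); rewrite sat_Q hPh => -[w0 [k1 k2]].
  have [l hl] : exists l, P l w0 by apply: hcov; rewrite /= phiE.
  apply: (proj2 (proj2_sig (H l)) x _); last by exists w0.
  apply: hx; right; apply: (in_map_List (fun l => sval (H l))); apply/List_in; by rewrite mem_enum.
have [psi hpsi] := translate2 f; have [th hth] := sorts_form so'; have [thz hthz] := sorts_form zo.
have sz := sm_vtr_fin zo.
have het2 (sig : form (vsum (vt zo) (par C))) i : sat sig (ejoin (vale (tenv (ee i))) pC) <->
    sat sig (ejoin (vale (tenv d)) pC).
  pose rs s (x : vsum (vt zo) (par C) s) : vsum (vars (fun l => dsort (sval (zo l)))) (par C) s :=
    match x with inl x => match x in vtr _ _ s return vsum (vars (fun l => dsort (sval (zo l)))) (par C) s with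
      VT i v => match v in vars _ i return vsum (vars (fun l => dsort (sval (zo l)))) (par C) (dsort (sval i)) with Var l => inl (Var l) end end
    | inr c => inr c end.
  have ov : Defs.over C (rename (@forget_par _ _ _ C) (rename rs sig)) by exists (rename rs sig).
  pose R : rsym (induced_language (fun X : St_sort C => proj1_sig X)) :=
    existT _ m (existT _ zo (exist _ _ ov)).
  pose chi0 : form (L := induced_language (fun X : St_sort C => proj1_sig X)) (vsum (vars zo) (par (@St_val _ _ C @^-1` C))) :=
    FRel (r := R) (fun l => TVar (inl (Var l))).
  pose chi := rename (@forget_par _ _ _ _) chi0.
  have chiE (x : tup (St_structure C) zo) : lsat chi x <-> sat sig (ejoin (vale (tenv x)) pC).
    rewrite /chi /lsat sat_over /= /lsat sat_over sat_rename.
    suff -> : (fun s v => ejoin (tenv (fun l => sval (x l))) pC (rs s v)) = ejoin (vale (tenv x)) pC by [].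
    by apply: funext2 => s [[i' [v]]|].
  have : tp (ee i) (@St_val _ _ C @^-1` C) chi <-> tp d (@St_val _ _ C @^-1` C) chi by rewrite het.
  rewrite -!chiE => -[k1 k2]; split=> h.
    by have [] : tp d (@St_val _ _ C @^-1` C) chi by apply: k1; split=> //; exists chi0.
  by have [] : tp (ee i) (@St_val _ _ C @^-1` C) chi by apply: k2; split=> //; exists chi0.
(* the k-inconsistency of the conjugates of d as a first-order condition *)
pose E3 : ctx := vsum (vsum (cprod 'I_k.+1 (vt zo)) (par (acl C))) (vt so').
pose toA s (c : par C s) : par (acl C) s := mkpar (sub_acl (proj2_sig c)).
pose r3 s (v : vsum (vt so') (par C) s) : E3 s :=
  match v with inl w => inr w | inr c => inl (inr (toA s c)) end.
pose r4 (t : 'I_k) s (v : vsum (vsum (vt so') (vt zo)) (par C) s) : E3 s :=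
  match v with inl (inl w) => inr w | inl (inr z) => inl (inl (widen_ord (leqnSn k) t, z)) | inr c => inl (inr (toA s c)) end.
pose Om := FNot (FEx (fin_vtr so') (FAnd (rename r3 th) (FConj (map (fun t => rename (r4 t) psi) (enum 'I_k))))).
have OmE (z : 'I_k.+1 -> tup (St_structure C) zo) :
   sat Om (ejoin (fun s p => vale (tenv (z p.1)) p.2) bA) <->
   ~ exists x : tup (St_structure C) so', forall t : 'I_k, sat2 f x (z (widen_ord (leqnSn k) t)).
  rewrite sat_not sat_ex.
  have e3 (x : env M (vt so')) : sat (rename r3 th) (ejoin (ejoin (fun s p => vale (tenv (z p.1)) p.2) bA) x) =
     sat th (ejoin x pC) by rewrite sat_rename; congr sat; apply: funext2 => s [].
  have e4 (x : env M (vt so')) t : sat (rename (r4 t) psi) (ejoin (ejoin (fun s p => vale (tenv (z p.1)) p.2) bA) x) =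
     sat psi (ejoin (ejoin x (vale (tenv (z (widen_ord (leqnSn k) t))))) pC).
    by rewrite sat_rename; congr sat; apply: funext2 => s [[]|].
  split=> h1 [x hx]; apply: h1.
    exists (vale (tenv x)); rewrite sat_and e3 sat_conj; split.
      by apply/hth => i; exact: proj2_sig.
    by move=> chi hp; have [t _ <-] := map_in_List hp; rewrite e4; apply/hpsi.
  move: hx; rewrite sat_and e3 sat_conj => -[/hth/lift_St[x' <-] hx]; exists x' => t.
  apply/hpsi; rewrite -e4; apply: hx; apply: (in_map_List (fun t => _)); apply/List_in; by rewrite mem_enum.
(* With [k.+1] terms there is an index [ord0] even when [k = 0]; it supplies the conjugate that is
   moved onto [d]. *)
have [|z [zOm zz zC]] := @extract _ _ _ Mm _ _ (fun i => vale (tenv (ee i))) bA k.+1 Om sz sA.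
  move=> iota ii.
  have jt : injective (fun t : 'I_k => iota (widen_ord (leqnSn k) t)).
    by move=> t t' /ii e0; apply: val_inj; exact: (congr1 val e0).
  apply/(OmE (fun i => ee (iota i))); exact: (hin _ jt).
have zd i : eqtp (ejoin (z i) pC) (ejoin (vale (tenv d)) pC).
  apply: eqtp_sym; apply: eqtp_imp => sig hs.
  have := zC (rename (sum_map (fun s v => v) toA) sig).
  have e5 (y : env M (vt zo)) : sat (rename (sum_map (fun s v => v) toA) sig) (ejoin y bA) = sat sig (ejoin y pC).
    by rewrite sat_rename; congr sat; apply: funext2 => s [].
  by rewrite -e5; apply => i'; rewrite e5; apply/het2.
(* [sg] fixes only [C], but by [eqtp_acl_app] the images of the [z i] still share their type over
   [acl C]. *)
have [sg [sga]] := hom Mm (smV_vsum Mm sz sPC) (zd ord0).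
rewrite app_ejoin => /ejoin_inj[sgz sgC].
pose z' i := app sg (z i).
have z'z i : eqtp (ejoin (z' ord0) bA) (ejoin (z' i) bA) by exact: eqtp_acl_app.
have qz i : Q q Ps (ejoin (z' i) pC).
  have [ta [tau]] := hom Mm (smV_vsum Mm sz sA) (z'z i).
  rewrite app_ejoin => /ejoin_inj[tz tA].
  by rewrite -tz -(bA_pC tA) -app_ejoin (Q_aut _ _ iq tau tA) /z' sgz.
have lz i : exists x : tup (St_structure C) zo, vale (tenv x) = z' i.
  apply: lift_St; apply/hthz; rewrite /z' -sgC -app_ejoin sat_aut //.
  by apply/(zd i)/hthz => l'; exact: proj2_sig.
pose zt i := sval (cid (lz i)); have ezt i : vale (tenv (zt i)) = z' i := proj2_sig (cid (lz i)).
have [a1 ra1] := real_ex Mm bA sA sW (fun s p => z' p.1 s p.2 : M s) gq (smV_cprod Mm (sml_count (monster_uncountable Mm) 'I_k.+1) sz).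
have hz i : sat Ps (ejoin a1 (ejoin (vale (tenv (zt i))) pC)).
  apply/(real_at (rho := fun s (v : vsum (vt zo) (par C) s) => match v with inl v => inr (i, v)
      | inr c => inl (toA s c) end) _ gq ra1); last by rewrite ezt.
  by rewrite ezt => s [].
have [w0 [Gw0 _]] := (hPs _ _).1 (hz ord0).
have Om' : sat Om (ejoin (fun s p => vale (tenv (zt p.1)) p.2) bA).
  apply/OmE => // -[x hx].
  have [h [ha hsg _]] := aut_inv sga.
  have hz' i : app h (z' i) = z i by apply: funext2 => s v; exact: hsg.
  have hC : app h pC = pC by rewrite -{1}sgC; apply: funext2 => s v; exact: hsg.
  have lz0 i : exists x : tup (St_structure C) zo, vale (tenv x) = z i.
    by apply: lift_St; apply/hthz; apply/(zd i)/hthz => l'; exact: proj2_sig.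
  pose z0 i := sval (cid (lz0 i)); have ez0 i : vale (tenv (z0 i)) = z i := proj2_sig (cid (lz0 i)).
  have [x' ex'] : exists x' : tup (St_structure C) so', vale (tenv x') = app h (vale (tenv x)).
    apply: lift_St; apply/hth; rewrite -hC -app_ejoin sat_aut //.
    by apply/hth => i; exact: proj2_sig.
  have : sat Om (ejoin (fun s p => vale (tenv (z0 p.1)) p.2) bA).
    by move: zOm; congr sat; apply: funext2 => s [[i v]|] //=; rewrite ez0.
  move/OmE; apply => //; exists x' => t; apply/hpsi.
  rewrite ex' ez0 -hz' -hC -!app_ejoin sat_aut // -ezt; exact/hpsi.
move/OmE: Om'; apply => //; exists w0 => t.
have [w1 [Gw1 fw1]] := (hPs _ _).1 (hz (widen_ord (leqnSn k) t)).
have ew := fG _ _ _ _ Gw0 Gw1; move: fw1.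
suff -> : w1 = w0 by [].
apply: functional_extensionality_dep => i.
have := congr1 (fun g : env M (vt so') => g _ (VT (@proj1_sig _ _) (Var i : vars so' _))) ew.
rewrite /=; case: (w0 i) => m0 h0; case: (w1 i) => m1 h1 /= e01; subst m1.
by rewrite (Prop_irrelevance h0 h1).
Qed.

End St.
End Independence.

(** * Stable domination *)

Section Domination.
Variables (K : Type) (L : language) (M : structure L).
Hypothesis Mm : monster K M.
Notation ctx := (lsort L -> Type).
Notation smV := (smV K).
Variables (C : set (elt M)) (sC : small K C).
Variables (I : Type) (so : I -> lsort L).
Hypothesis sI : small K [set: I].
Variable p0 : set (lform M (vars so)).
Hypothesis p0dom : stably_dominated C K p0.

Notation pC := (penv (A := C)).
Notation bA := (penv (A := acl C)).
Notation W := (vars so).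

Let sW : smV W. Proof. exact/smV_vars/smallT. Qed.
Let sA : smV (par (acl C)). Proof. exact/smV_par/(acl_small Mm). Qed.
Let sPC : smV (par C). Proof. exact: smV_par. Qed.

Definition dext (q : set (lform M W)) := [/\ gtp q, inv bA q & p0 `<=` q].

Lemma small_setU (X Y : set (elt M)) : small K X -> small K Y -> small K (X `|` Y).
Proof.
move=> /smallE sX /smallE sY; apply/smallE.
apply: sml_le (sml_sum (monster_uncountable Mm) (monster_strong_limit Mm) sX sY).
have H (u : {u | (X `|` Y) u}) : {x : {u | X u} + {u | Y u} |
    match x with inl y => sval y = sval u | inr y => sval y = sval u end}.
  case: u => u /= hu; case: (pselect (X u)) => h; first by exists (inl (exist _ u h)).
  have h2 : Y u by case: hu.
  by exists (inr (exist _ u h2)).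
exists (fun u => sval (H u)) => u u' /=; case: (H u) => -[x|x] /= hx; case: (H u') => -[y|y] //= hy [exy].
  by subst y; move: u u' hx hy => [u hu] [u' hu'] /= -> e2; subst u'; rewrite (Prop_irrelevance hu hu').
by subst y; move: u u' hx hy => [u hu] [u' hu'] /= -> e2; subst u'; rewrite (Prop_irrelevance hu hu').
Qed.

Lemma small_sub (X Y : set (elt M)) : X `<=` Y -> small K Y -> small K X.
Proof.
move=> XY /smallE sY; apply/smallE; apply: sml_le sY.
exists (fun u : {u | X u} => exist _ (sval u) (XY _ (proj2_sig u))).
by move=> [u hu] [u' hu'] /= [e]; subst u'; rewrite (Prop_irrelevance hu hu').
Qed.

Lemma small_trange (al : tup M so) : small K (trange al).
Proof.
apply: small_sub (small_erange (tenv al) sW) => u [i _ <-] /=.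
by exists (Var i).
Qed.

Lemma realizes_real q (V : ctx) (e : env M V) (al : tup M so) : dext q -> p0 `<=` Defs.over C ->
  real bA q (tenv al) e -> realizes p0 al.
Proof.
move=> [gq iq pq] ov ra phi hp; have [phi' _ e'] := ov _ hp; rewrite -e' in hp *.
rewrite /lsat sat_over.
pose toA s (c : par C s) : par (acl C) s := mkpar (sub_acl (proj2_sig c)).
apply/(real_at (rho := fun s c => inl (toA s c)) _ gq ra) => //.
have := pq _ hp; rewrite /Q; congr (q (rename _ _)).
Qed.

Lemma St_Good s (m : M s) : St C (existT _ s m) ->
  {th : form (vsum (vars (single s)) (par C)) | Good K th pC /\ sat th (ejoin (tenv (tup1 m)) pC)}.
Proof.
move=> h; apply: cid; have [[[X [Xst Xse]] mm] _ em] := h.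
have [th hth] := dform_par X.
have G := stable_Good Mm sC Xst Xse hth.
have hm : sat th (ejoin (tenv (tup1 (sval mm))) pC).
  by case: (mm) => m0 hm0 /=; move: hm0; rewrite /dmem /= hth lsat_tup1.
have es := congr1 (@projT1 _ _) em; rewrite /= in es.
move: h em; rewrite /St_val /=; subst s => _ em.
by exists th; rewrite -(existT_inj em).
Qed.

Hypothesis p0over : p0 `<=` Defs.over C.

(** By stable domination only the stable formulas over [e] need to be checked. *)
Lemma dominated_real q (V : ctx) (e : env M V) (al : tup M so) (a : env M W) : dext q -> smV V ->
  real bA q (tenv al) e -> eqtp (ejoin (tenv al) bA) (ejoin a bA) ->
  (forall chi : form (vsum W (vsum (par (acl C)) V)), stable_for bA chi ->
     sat chi (ejoin (tenv al) (ejoin bA e)) -> sat chi (ejoin a (ejoin bA e))) ->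
  real bA q a e.
Proof.
move=> dq sV ra aa hst; have [gq iq pq] := dq.
pose B := acl C `|` erange e.
have sB : small K B by apply: small_setU; [exact: (acl_small Mm)|exact: small_erange].
have [_ hent] := p0dom (realizes_real dq p0over ra) sB (real_independent Mm sC sI gq iq sV ra).
have [ta [tau]] := hom Mm (smV_vsum Mm sW sA) aa.
rewrite app_ejoin => /ejoin_inj[tal tA].
pose S := St_of C (trange al); pose pS := penv (A := S).
have sS : small K S.
  apply: small_sub (acl_small Mm (small_setU sC (small_trange al))) => u [_ hu].
  exact: dcl_sub_acl.
have sPS : smV (par S) by exact: smV_par.
(* A formula involves finitely many points of [pS]. They lie in a good set and form the value at
   [al] of a definable function, so the formula, pulled back along it, is stable and passes from
   [al] to [a]; there the value is the image under [ta]. *)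
have key : eqtp (ejoin pS (ejoin bA e)) (ejoin (app ta pS) (ejoin bA e)).
  apply: eqtp_imp => phi0 h0.
  pose sw s (v : vsum (par S) (vsum (par (acl C)) V) s) : vsum (vsum (par (acl C)) V) (par S) s :=
    match v with inl x => inr x | inr c => inl c end.
  have [n [so0 [phi [r er]]]] := fsupp (rename sw phi0).
  have E (z : env M (par S)) : sat phi0 (ejoin z (ejoin bA e)) =
      sat phi (ejoin (ejoin bA e) (fun s v => z s (r s v))).
    transitivity (sat (rename sw phi0) (ejoin (ejoin bA e) z)).
      by rewrite sat_rename; congr sat; apply: funext2 => s [].
    by rewrite er sat_rename; congr sat; apply: funext2 => s [].
  pose u0 : env M (vars so0) := fun s v => pS s (r s v).
  have uS i : S (existT _ _ (u0 _ (Var i))) by exact: (proj2_sig (r _ (Var i))).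
  have H i : {th : form (vsum (vars (single (so0 i))) (par C)) | Good K th pC /\
      sat th (ejoin (tenv (tup1 (u0 _ (Var i)))) pC)}.
    by have [h _] := uS i; exact: St_Good h.
  pose th i := sval (H i).
  have Gth : Good K (thtup th) pC by apply: (Good_tup Mm) => // i; case: (proj2_sig (H i)).
  have hu0 : sat (thtup th) (ejoin u0 pC) by rewrite sat_thtup => i; case: (proj2_sig (H i)).
  have [|Gam [fG hG]] := @def_graph _ _ _ Mm _ _ _ (tenv al) bA u0 (fin_vars so0) (smV_fin Mm so0) sW sA.
    move=> g ga gal gA; have gC := bA_pC gA; apply: funext2 => s [i]; rewrite /app.
    have gB : app g (penv (A := C `|` trange al)) = penv (A := C `|` trange al).
      apply/app_penv => s' m [hm|[i' _ ei]]; first by move/app_penv: gC; apply.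
      have es := congr1 (@projT1 _ _) ei; rewrite /= in es; subst s'.
      rewrite -(existT_inj ei).
      exact: (congr1 (fun f : env M W => f _ (Var i')) gal).
    by have [_ hm] := uS i; exact: (dcl_fix ga gB hm).
  pose toA s (c : par C s) : par (acl C) s := mkpar (sub_acl (proj2_sig c)).
  pose r1 s (v : vsum (vars so0) (par C) s) : vsum (vars so0) (vsum W (par (acl C))) s :=
    match v with inl x => inl x | inr c => inr (inr (toA s c)) end.
  pose Ga := FAnd Gam (rename r1 (thtup th)).
  have GaE w (x : env M W) : sat Ga (ejoin w (ejoin x bA)) <->
      sat Gam (ejoin w (ejoin x bA)) /\ sat (thtup th) (ejoin w pC).
    rewrite sat_and sat_rename.
    by have -> : (fun s v => ejoin w (ejoin x bA) (r1 s v)) = ejoin w pC by apply: funext2 => s [].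
  pose E1 : ctx := vsum (vsum W (vsum (par (acl C)) V)) (vars so0).
  pose r2 s (v : vsum (vars so0) (vsum W (par (acl C))) s) : E1 s :=
    match v with inl x => inr x | inr (inl x) => inl (inl x) | inr (inr c) => inl (inr (inl c)) end.
  pose r3 s (v : vsum (vsum (par (acl C)) V) (vars so0) s) : E1 s :=
    match v with inl c => inl (inr c) | inr x => inr x end.
  pose chi := FEx (fin_vars so0) (FAnd (rename r2 Ga) (rename r3 phi)).
  have chiE (x : env M W) v : sat chi (ejoin x (ejoin bA v)) <->
      exists2 w, sat Ga (ejoin w (ejoin x bA)) & sat phi (ejoin (ejoin bA v) w).
    rewrite sat_ex; have F (w : env M (vars so0)) : sat (FAnd (rename r2 Ga) (rename r3 phi)) (ejoin (ejoin x (ejoin bA v)) w) =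
       (sat Ga (ejoin w (ejoin x bA)) /\ sat phi (ejoin (ejoin bA v) w)).
      by rewrite sat_and !sat_rename; congr (_ /\ _); congr sat; apply: funext2 => s [|[]].
    by split=> -[w]; [rewrite F => -[]; exists w|exists w; rewrite F].
  pose psi : form (vsum (vars so0) (vsum (par (acl C)) V)) :=
    rename (fun s (v : vsum (vsum (par (acl C)) V) (vars so0) s) => match v with inl c => inr c | inr x => inl x end) phi.
  have psiE w v : sat psi (ejoin w (ejoin bA v)) = sat phi (ejoin (ejoin bA v) w).
    by rewrite sat_rename; congr sat; apply: funext2 => s [].
  have st : stable_for bA chi.
    apply: (@stf_graph _ _ _ Mm _ _ _ _ _ bA pC (thtup th) Ga psi) => //.
    - by move=> x w /GaE[].
    - by move=> x w w' /GaE[h1 _] /GaE[h2 _]; exact: fG h1 h2.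
    - move=> x v; rewrite chiE; split=> -[w h1 h2]; exists w => //; by rewrite ?psiE // -psiE.
  have : sat chi (ejoin a (ejoin bA e)).
    apply: hst => //; apply/chiE; exists u0; last by rewrite -E.
    by apply/GaE; split=> //; exact/hG.
  move/chiE => [w hw1 hw2].
  have hw : sat Ga (ejoin (app ta u0) (ejoin a bA)).
    rewrite -tal -[in X in ejoin _ (ejoin _ X)]tA -!app_ejoin sat_aut //.
    by apply/GaE; split=> //; exact/hG.
  have ew : w = app ta u0 by move: hw1 hw => /GaE[h1 _] /GaE[h2 _]; exact: fG h1 h2.
  by rewrite E; move: hw2; rewrite ew.
have sAV : smV (vsum (par (acl C)) V) by exact: (smV_vsum Mm).
have [sg [sga]] := hom Mm (smV_vsum Mm sPS sAV) key.
rewrite !app_ejoin => /ejoin_inj[sgS /ejoin_inj[sgA sge]].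
have [h [ha hta tah]] := aut_inv tau.
(* [rho] fixes [C] and [St(al)], so [rho B] realises the type of [B] over them *)
pose rho s m := h s (sg s m).
have rhoa : automorphism rho by exact: aut_comp.
have rhoS : app rho pS = pS.
  apply: funext2 => s v; have := congr1 (fun f : env M (par S) => f s v) sgS.
  rewrite /app /rho => ->; exact: hta.
have hA : app h bA = bA by rewrite -{1}tA; apply: funext2 => s v; exact: hta.
have rhoA : app rho bA = bA.
  rewrite -[RHS]hA; apply: funext2 => s v; have := congr1 (fun f : env M (par (acl C)) => f s v) sgA.
  by rewrite /app /rho => ->.
pose B' : tup M (fun u : {u : elt M | B u} => projT1 (proj1_sig u)) := fun u => rho _ (enumeration u).
have hB' : realizes (tp (enumeration (B := B)) (C `|` S)) B'.
  move=> phi [[phi' _ <-]]; rewrite /lsat !sat_over => hs.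
  have rhoCS : app rho (penv (A := C `|` S)) = penv (A := C `|` S).
    apply/app_penv => s m [hm|hm]; first by have /app_penv := bA_pC rhoA; apply.
    by have /app_penv := rhoS; apply.
  rewrite -rhoCS; suff -> : tenv B' = app rho (tenv (enumeration (B := B))) by rewrite -app_ejoin sat_aut.
  by apply: funext2 => s [].
have {}hB' := hent _ hB'.
apply: (real_eqtp_r Mm sA sW gq iq sV ra); apply: eqtp_imp => phi hphi.
have alC i : (C `|` trange al) (existT _ _ (al i)) by right; exists i.
have bB s (c : par (acl C) s) : B (existT _ s (sval c)) by left; exact: (proj2_sig c).
have eB s (v : V s) : B (existT _ s (e s v)) by right; exists v.
pose soB := fun u : {u : elt M | B u} => projT1 (proj1_sig u).
pose mk s m (hm : B (existT _ s m)) : vars soB s := Var (exist _ (existT _ s m) hm : {u | B u}).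
pose rr s (v : vsum W (vsum (par (acl C)) V) s) : vsum (vars soB) (par (C `|` trange al)) s :=
  match v with
  | inl x => match x in vars _ s return vsum (vars soB) (par (C `|` trange al)) s with Var i => inr (mkpar (alC i)) end
  | inr (inl c) => inl (mk _ _ (bB s c))
  | inr (inr v) => inl (mk _ _ (eB s v)) end.
have := hB' (rename (@forget_par _ _ _ (C `|` trange al)) (rename rr phi)).
rewrite /lsat sat_over sat_rename.
have F (g : forall s, M s -> M s) :
   (fun s v => ejoin (tenv (fun u : {u | B u} => g _ (enumeration u))) (penv (A := C `|` trange al)) (rr s v)) =
   ejoin (tenv al) (ejoin (app g bA) (app g e)).
  by apply: funext2 => s [[]|[]].
rewrite F => hs; have {}hs : sat phi (ejoin (tenv al) (ejoin (app rho bA) (app rho e))).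
  apply: hs; split; first by exists (rename rr phi).
  by rewrite /lsat sat_over sat_rename (F (fun s m => m)).
(* [ta] carries [al] and [app rho e] to [a] and [e], which turns the entailment at [al] into the
   claim at [a]. *)
have k1 : app ta (app rho bA) = bA.
  by rewrite -[RHS]sgA; apply: funext2 => s v; rewrite /app /rho tah.
have k2 : app ta (app rho e) = e.
  by rewrite -[RHS]sge; apply: funext2 => s v; rewrite /app /rho tah.
by move: hs; rewrite -(sat_aut _ _ tau) !app_ejoin tal k1 k2.
Qed.

End Domination.

(** * Commutation, uniqueness, bound and definability for dominated types *)

Lemma count_sub (P : pred nat) n N : (N <= count P (seq.iota 0 n))%N ->
  exists f : nat -> nat, [/\ forall i, (i < N)%N -> (f i < n)%N && P (f i) &
    forall i j, (i < j)%N -> (j < N)%N -> (f i < f j)%N].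
Proof.
rewrite -size_filter => h; set l := [seq x <- _ | _] in h.
exists (nth 0%N l); split=> [i hi|i j ij hj].
  have : nth 0%N l i \in l by apply: mem_nth; exact: leq_trans hi h.
  by rewrite mem_filter mem_iota andbC.
have sl : sorted ltn l by apply: sorted_filter; [exact: ltn_trans|exact: iota_ltn_sorted].
apply: (sorted_ltn_nth ltn_trans) => //; rewrite inE.
  by apply: leq_trans h; exact: ltn_trans hj.
exact: leq_trans h.
Qed.

Section Dominated.
Variables (K : Type) (L : language) (M : structure L).
Hypothesis Mm : monster K M.
Notation ctx := (lsort L -> Type).
Notation smV := (smV K).
Variables (C : set (elt M)) (sC : small K C).
Variables (I : Type) (so : I -> lsort L).
Hypothesis sI : small K [set: I].
Variable p0 : set (lform M (vars so)).
Hypothesis p0dom : stably_dominated C K p0.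
Hypothesis p0over : p0 `<=` Defs.over C.

Notation pC := (penv (A := C)).
Notation bA := (penv (A := acl C)).
Notation W := (vars so).

Let sW : smV W. Proof. exact/smV_vars/smallT. Qed.
Let sA : smV (par (acl C)). Proof. exact/smV_par/(acl_small Mm). Qed.

Lemma dominated_real' q (V : ctx) (e : env M V) (a' a : env M W) : dext C p0 q -> smV V ->
  real bA q a' e -> eqtp (ejoin a' bA) (ejoin a bA) ->
  (forall chi : form (vsum W (vsum (par (acl C)) V)), stable_for bA chi ->
     sat chi (ejoin a' (ejoin bA e)) -> sat chi (ejoin a (ejoin bA e))) ->
  real bA q a e.
Proof. rewrite -(tenvE a'); exact: (dominated_real Mm sC sI p0dom p0over). Qed.

(** [commute] settles the stable formulas, and by domination these suffice. *)
Lemma dext_comm q q' : dext C p0 q -> dext C p0 q' -> comm K bA q q'.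
Proof.
move=> dq dq' V e a0 a1 sV r0 r1; have [gq iq _] := dq; have [gq' iq' _] := dq'.
have sVW := smV_vsum Mm sV sW.
have [a0' r0'] := real_ex Mm bA sA sW (ejoin e a1) gq sVW.
apply: (dominated_real' dq sVW r0' (real_eqtp0 gq r0' r0)) => chi st.
by rewrite (commute Mm sW sA gq gq' iq iq' sV st r0 r1 r0').
Qed.

(** By [inv_unique] a realisation of [q2] over [v] has the stable formulas of [q1], so by domination
    it is generic for [q1] too. *)
Lemma dext_unique q1 q2 (V : ctx) (phi : form (vsum W V)) (v : env M V) :
  dext C p0 q1 -> dext C p0 q2 ->
  (forall phi : form (vsum W (par (acl C))), Q q1 phi bA <-> Q q2 phi bA) ->
  smV V -> Q q1 phi v <-> Q q2 phi v.
Proof.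
move=> d1 d2 h sV; have [g1 i1 _] := d1; have [g2 _ _] := d2.
have [a1 r1] := real_ex Mm bA sA sW v g1 sV.
have [a2 r2] := real_ex Mm bA sA sW v g2 sV.
rewrite (real_atr phi g2 r2); apply: (real_atr phi g1).
apply: (dominated_real' d1 sV r1) => [chi|chi st].
  rewrite -(real_at (x := bA) (rho := fun s v => inl v) chi g1 r1) //.
  by rewrite -(real_at (x := bA) (rho := fun s v => inl v) chi g2 r2).
rewrite -(real_iff _ g1 r1) => hq; apply/(real_iff _ g2 r2).
exact: (inv_unique Mm sW sA g1 g2 i1 (dext_comm d2 d1) (dext_comm d2 d2) h sV st hq).
Qed.

Section Bound.
Variable q : set (lform M W).
Hypothesis dq : dext C p0 q.

Let gq : gtp q. Proof. by case: dq. Qed.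
Let iq : inv bA q. Proof. by case: dq. Qed.

(** By the stable bound, each stable formula of [q] over [v] holds at all but finitely many terms.
    If [phi] failed at every term, compactness would give a point with all these formulas, the type
    over [acl C] and not [phi]; by domination it would be generic over [v]. *)
Lemma mor_meets (V : ctx) (phi : form (vsum W V)) (c : nat -> env M W) (v : env M V) : smV V ->
  (forall n, morley bA (fun=> q) c n) -> Q q phi v -> exists i, sat phi (ejoin (c i) v).
Proof.
move=> sV mc hq; apply: contrapT => nc.
pose A := par (acl C).
pose rA s (x : vsum W A s) : vsum W (vsum A V) s := match x with inl w => inl w | inr c => inr (inl c) end.
pose rV s (x : vsum W V s) : vsum W (vsum A V) s := match x with inl w => inl w | inr c => inr (inr c) end.
have eA (x : env M W) th : sat (rename rA th) (ejoin x (ejoin bA v)) = sat th (ejoin x bA).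
  by rewrite sat_rename; congr sat; apply: funext2 => s [].
have eV (x : env M W) th : sat (rename rV th) (ejoin x (ejoin bA v)) = sat th (ejoin x v).
  by rewrite sat_rename; congr sat; apply: funext2 => s [].
pose Sig : set (form (vsum W (vsum A V))) := [set chi | [\/ stable_for bA chi /\ Q q chi (ejoin bA v),
   exists2 th, chi = rename rA th & Q q th bA | chi = FNot (rename rV phi)]].
have [l hl|a ha] := @realise _ _ _ Mm _ _ (ejoin bA v) Sig (smV_vsum Mm sA sV) sW.
  suff [i0 hi0] : exists i0, forall i, (i0 <= i)%N -> forall chi, List.In chi l ->
     sat chi (ejoin (c i) (ejoin bA v)) by exists (c i0); exact: hi0.
  elim: l hl => [|chi l IH] hl; first by exists 0%N => i _ chi [].
  have [|i0 hi0] := IH; first by move=> psi h; apply: hl; right.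
  suff [i1 hi1] : exists i1, forall i, (i1 <= i)%N -> sat chi (ejoin (c i) (ejoin bA v)).
    exists (maxn i0 i1) => i; rewrite geq_max => /andP[k0 k1] psi [<-|h]; first exact: hi1.
    exact: hi0.
  case: (hl chi (or_introl erefl)) => [[st qc]|[th -> qt]|->].
  - apply: contrapT => ni.
    have [iota [hi hf]] : exists iota : nat -> nat, (forall i j, (i < j)%N -> (iota i < iota j)%N) /\
        forall i, ~ sat chi (ejoin (c (iota i)) (ejoin bA v)).
      apply: (increasing_subsequence (P := fun i => ~ sat chi (ejoin (c i) (ejoin bA v)))) => N; apply: contrapT => nN; apply: ni; exists N => i hi.
      by apply: contrapT => nc'; apply: nN; exists i.
    have [N hN] := stf_mor_bound Mm sW sA gq iq sV st.
    have hm : morley bA (fun=> q) (fun i => c (iota i)) N.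
      by apply: (mor_sub (n := iota N) gq (mc _)) => [i /hi//|i j ij _]; exact: hi.
    exact: (hN _ hm v (fun i _ => hf i) qc).
  - exists 0%N => i _; rewrite eA.
    by apply/(real_at (x := bA) (rho := fun s v => inl v) th gq (mc i.+1 i (ltnSn i))).
  - by exists 0%N => i _; rewrite sat_not eV => h; apply: nc; exists i.
have [a' ra'] := real_ex Mm bA sA sW v gq sV.
have ra : real bA q a v.
  apply: (dominated_real' dq sV ra') => [chi|chi st].
    split=> h.
      by rewrite -eA; apply: ha; constructor 2; exists chi => //;
        apply/(real_at (x := bA) (rho := fun s v => inl v) chi gq ra').
    apply: contrapT => n; suff : ~ sat chi (ejoin a bA) by [].
    rewrite -eA -sat_not; apply: ha; constructor 2; exists (FNot chi) => //.
    by apply/(real_at (x := bA) (rho := fun s v => inl v) (FNot chi) gq ra').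
  by move=> h; apply: ha; constructor 1; split=> //; apply/(real_iff _ gq ra').
have : sat (FNot (rename rV phi)) (ejoin a (ejoin bA v)) by apply: ha; constructor 3.
by rewrite sat_not eV; apply; apply/(real_atr phi gq ra).
Qed.

Lemma mor_eqtp a a' n : morley bA (fun=> q) a n -> eqtp (ejoin bA (pre a n)) (ejoin bA (pre a' n)) ->
  morley bA (fun=> q) a' n.
Proof.
move=> ma ee; have [g [ga]] := hom Mm (smV_vsum Mm sA (sm_pre Mm sW n)) ee.
rewrite app_ejoin => /ejoin_inj[gA gp] i hi.
have E k : (k < n)%N -> app g (a k) = a' k.
  move=> hk; apply: funext2 => s w.
  exact: (congr1 (fun f : env M (cprod 'I_n W) => f s (Ordinal hk, w)) gp).
rewrite -E // -(_ : app g (pre a i) = pre a' i); first exact: (real_app iq ga gA (ma i hi)).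
apply: funext2 => s [k w]; rewrite /pre /= -E //; exact: ltn_trans (ltn_ord k) hi.
Qed.

Lemma mor_move a c n : morley bA (fun=> q) a n -> morley bA (fun=> q) c n ->
  exists g, [/\ automorphism g, app g bA = bA & forall i, (i < n)%N -> app g (a i) = c i].
Proof.
move=> ma mc; have [g [ga]] := hom Mm (smV_vsum Mm sA (sm_pre Mm sW n))
  (mor_uniq Mm sA sW (fun=> gq) (fun=> iq) ma mc).
rewrite app_ejoin => /ejoin_inj[gA gp]; exists g; split=> // k hk; apply: funext2 => s w.
exact: (congr1 (fun f : env M (cprod 'I_n W) => f s (Ordinal hk, w)) gp).
Qed.

(** Without a bound, compactness gives one [v] with [phi(x, v)] false on a whole Morley sequence [c]
    and true on a whole Morley sequence [a]. Whichever of [phi] and its negation is in [q], one of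
    the sequences contradicts [mor_meets]. *)
Lemma dext_bound (V : ctx) (phi : form (vsum W V)) : smV V ->
  exists N, forall a, morley bA (fun=> q) a N -> forall v : env M V,
    (forall i, (i < N)%N -> ~ sat phi (ejoin (a i) v)) -> ~ Q q phi v.
Proof.
move=> sV; apply: contrapT => nN.
have [c mc] := mor_ex Mm bA sA sW (qs := fun=> q) (fun=> gq).
have bad N : exists v : env M V, (forall i, (i < N)%N -> ~ sat phi (ejoin (c i) v)) /\ Q q phi v.
  apply: contrapT => nv; apply: nN; exists N => a ma v hv hq; apply: nv.
  have [g [ga gA gc]] := mor_move ma (mc N).
  exists (app g v); split; last exact/(Q_aut _ _ iq ga gA).
  by move=> i hi; rewrite -gc // -app_ejoin sat_aut //; exact: hv.
pose A := par (acl C); pose Wn : ctx := cprod nat W.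
pose cc : env M Wn := fun s p => c p.1 s p.2.
have sWn : smV Wn by apply: (smV_cprod Mm) => //; exact/sml_nat/(monster_uncountable Mm).
pose X : ctx := vsum (vsum V Wn) (vsum A Wn).
pose r1 i s (x : vsum W V s) : X s := match x with inl w => inr (inr (i, w)) | inr v => inl (inl v) end.
pose r2 i s (x : vsum W V s) : X s := match x with inl w => inl (inr (i, w)) | inr v => inl (inl v) end.
pose r3 n s (x : vsum A (cprod 'I_n W) s) : X s :=
  match x with inl c => inr (inl c) | inr p => inl (inr (val p.1, p.2)) end.
have e1 (v : env M V) (x : env M Wn) i : sat (rename (r1 i) phi) (ejoin (ejoin v x) (ejoin bA cc)) = sat phi (ejoin (c i) v).
  by rewrite sat_rename; congr sat; apply: funext2 => s [].
have e2 (v : env M V) (a : nat -> env M W) i :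
    sat (rename (r2 i) phi) (ejoin (ejoin v (fun s p => a p.1 s p.2)) (ejoin bA cc)) = sat phi (ejoin (a i) v).
  by rewrite sat_rename; congr sat; apply: funext2 => s [].
have e3 (v : env M V) (a : nat -> env M W) n th :
    sat (rename (r3 n) th) (ejoin (ejoin v (fun s p => a p.1 s p.2)) (ejoin bA cc)) = sat th (ejoin bA (pre a n)).
  by rewrite sat_rename; congr sat; apply: funext2 => s [].
pose Sig : set (form X) := [set psi | [\/ exists i, psi = FNot (rename (r1 i) phi),
   exists i, psi = rename (r2 i) phi |
   exists n th, psi = rename (r3 n) th /\ sat th (ejoin bA (pre c n))]].
have [l hl|vx hvx] := @realise _ _ _ Mm _ _ (ejoin bA cc) Sig (smV_vsum Mm sA sWn) (smV_vsum Mm sV sWn).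
  have [N hN] : exists N, forall psi, List.In psi l -> [\/ exists2 i, (i < N)%N & psi = FNot (rename (r1 i) phi),
     exists i, psi = rename (r2 i) phi | exists n th, psi = rename (r3 n) th /\ sat th (ejoin bA (pre c n))].
    elim: l hl => [|psi l IH] hl; first by exists 0%N.
    have [|N hN] := IH; first by move=> psi' h; apply: hl; right.
    case: (hl psi (or_introl erefl)) => [[i ei]|h|h].
    - exists (maxn N i.+1) => psi' [<-|/hN[[i' h1 h2]|h|h]].
      + by constructor 1; exists i => //; rewrite leq_max leqnn orbT.
      + by constructor 1; exists i' => //; rewrite leq_max h1.
      + by constructor 2.
      + by constructor 3.
    - by exists N => psi' [<-|/hN//]; constructor 2.
    - by exists N => psi' [<-|/hN//]; constructor 3.
  have [v [hv qv]] := bad N.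
  have [a ma] := mor_ex Mm (ejoin bA v) (smV_vsum Mm sA sV) sW (qs := fun=> q) (fun=> gq).
  have mab n : morley bA (fun=> q) a n.
    move=> i hi; have /(real_base _ _ _ _ gq) h := ma n i hi.
    by apply: (real_sub (rho := fun s x => inr (inr x)) gq h).
  exists (ejoin v (fun s p => a p.1 s p.2)) => psi /hN[[i hi ->]|[i ->]|[n [th [-> ht]]]].
  - by rewrite sat_not e1; exact: hv.
  - rewrite e2; apply/(real_at (x := v) (rho := fun s x => inl (inr x)) phi gq (ma i.+1 i (ltnSn i))) => //.
  - by rewrite e3; apply/(mor_uniq Mm sA sW (fun=> gq) (fun=> iq) (mab n) (mc n)).
pose v : env M V := fun s x => vx s (inl x); pose a i : env M W := fun s w => vx s (inr (i, w)).
have evx : vx = ejoin v (fun s p => a p.1 s p.2) by apply: funext2 => s [|[]].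
have ma n : morley bA (fun=> q) a n.
  apply: (mor_eqtp (mc n)); apply: eqtp_imp => th ht; rewrite -(e3 v) -evx; apply: hvx.
  by constructor 3; exists n, th.
case: (pselect (Q q phi v)) => hq.
  have [i hi] := mor_meets sV mc hq.
  have : sat (FNot (rename (r1 i) phi)) (ejoin vx (ejoin bA cc)) by apply: hvx; constructor 1; exists i.
  by rewrite evx sat_not e1.
have [i] := mor_meets sV ma ((Q_not gq phi v).2 hq); rewrite sat_not; apply.
by rewrite -e2 -evx; apply: hvx; constructor 2; exists i.
Qed.

Fixpoint atleast (X : ctx) (F : nat -> form X) (l : seq nat) (k : nat) : form X :=
  match k, l with
  | 0, _ => FTrue X
  | k'.+1, [::] => FBot X
  | k'.+1, i :: l' => FOr (FAnd (F i) (atleast F l' k')) (atleast F l' k)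
  end.

Lemma sat_atleast (X : ctx) (F : nat -> form X) (e : env M X) l k :
  sat (atleast F l k) e <-> (k <= count (fun i => `[< sat (F i) e >]) l)%N.
Proof.
elim: l k => [|i l IH] [|k].
- by rewrite sat_true.
- by [].
- by rewrite sat_true.
rewrite (_ : atleast _ _ _ = FOr (FAnd (F i) (atleast F l k)) (atleast F l k.+1)) //.
rewrite sat_or sat_and !IH /=; case: asboolP => h; rewrite ?add1n ?add0n ?ltnS.
  by split=> [[[_ h1]//|/ltnW//]|h1]; left.
by split=> [[[h1]//|//]|h1]; right.
Qed.

(** Majority vote: among [N + N] terms of a Morley sequence, [phi] or its negation holds at [N] of
    them. These form a Morley sequence again, and [N] is at least the bound for either formula, so
    the vote agrees with [q]. *)
Lemma dext_definable (V : ctx) (phi : form (vsum W V)) : smV V ->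
  exists (V' : ctx) (e' : env M V') (del : form (vsum V V')), smV V' /\
    forall v : env M V, Q q phi v <-> sat del (ejoin v e').
Proof.
move=> sV; have [N1 h1] := dext_bound phi sV; have [N2 h2] := dext_bound (FNot phi) sV.
pose N := maxn N1 N2.
have [c mc] := mor_ex Mm bA sA sW (qs := fun=> q) (fun=> gq).
pose F i : form (vsum V (cprod nat W)) := rename (fun s (x : vsum W V s) =>
  match x with inl w => inr (i, w) | inr v => inl v end) phi.
exists (cprod nat W), (fun s p => c p.1 s p.2), (atleast F (seq.iota 0 (N + N)) N).
split; first by apply: (smV_cprod Mm) => //; exact/sml_nat/(monster_uncountable Mm).
move=> v; rewrite sat_atleast.
have FE i : sat (F i) (ejoin v (fun s p => c p.1 s p.2)) = sat phi (ejoin (c i) v).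
  by rewrite sat_rename; congr sat; apply: funext2 => s [].
set P := fun i => _.
have sub (P' : pred nat) : (N <= count P' (seq.iota 0 (N + N)))%N ->
   exists a, (forall n, (n <= N)%N -> morley bA (fun=> q) a n) /\ forall i, (i < N)%N -> exists2 k, a i = c k & P' k.
  move=> /count_sub[f [hf1 hf2]]; exists (fun i => c (f i)); split.
    move=> n hn; apply: (mor_sub (n := N + N) gq (mc _)) => [i hi|i j ij hj].
      by have /andP[] := hf1 i (leq_trans hi hn).
    by apply: hf2 => //; exact: leq_trans hj hn.
  by move=> i hi; exists (f i) => //; case/andP: (hf1 i hi).
split=> hq.
  rewrite leqNgt; apply/negP => hlt.
  have : (N <= count (predC P) (seq.iota 0 (N + N)))%N.
    by have := count_predC P (seq.iota 0 (N + N)); rewrite size_iota; lia.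
  move=> /sub[a [ma ha]].
  apply: (h1 a (ma _ (leq_maxl _ _)) v) => // i hi.
  have [k -> /asboolPn] := ha i (leq_trans hi (leq_maxl _ _)).
  by rewrite FE.
apply: contrapT => /(Q_not gq) nq; have [a [ma ha]] := sub _ hq.
apply: (h2 a (ma _ (leq_maxr _ _)) v) => // i hi; rewrite sat_not.
have [k -> /asboolP] := ha i (leq_trans hi (leq_maxr _ _)).
by rewrite FE => h; apply.
Qed.

End Bound.
End Dominated.

(** * Finite orbits and traces on the algebraic closure *)

Lemma finite_List (T : Type) (S : set T) : finite_set S -> exists l : seq T, forall x, S x -> List.In x l.
Proof.
move=> [n]; rewrite card_eq_le => /andP[/card_leE[h hi] _].
case: (pselect (exists x, S x)) => [[x0 hx0]|nS]; last by exists [::] => x hx; case: nS; exists x.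
exists (map (fun k => match pselect (exists x (hx : S x), sval (h (exist _ x hx)) = k) with
   left H => sval (cid H) | right _ => x0 end) (seq.iota 0 n)) => x hx.
have hk : (sval (h (exist _ x hx)) < n)%N by exact: (proj2_sig (h (exist _ x hx))).
suff e : match pselect (exists x' (hx' : S x'), sval (h (exist _ x' hx')) = sval (h (exist _ x hx))) with
   left H => sval (cid H) | right _ => x0 end = x.
  rewrite -[X in List.In X _]e.
  apply: (in_map_List (fun k => match pselect (exists x (hx : S x), sval (h (exist _ x hx)) = k) with
   left H => sval (cid H) | right _ => x0 end)).
  by apply/List_in; rewrite mem_iota.
case: pselect => [H|[]]; last by exists x, hx.
case: cid => x' /= [hx' e].
have e' : h (exist _ x' hx') = h (exist _ x hx).
  by case: (h (exist _ x' hx')) e => k hk' /= e; case: (h (exist _ x hx)) e => k2 hk2 /= e; subst k2;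
    rewrite (Prop_irrelevance hk' hk2).
exact: (congr1 sval (hi _ _ e')).
Qed.

Lemma List_finite (T : Type) (S : set T) (l : seq T) : (forall x, S x -> List.In x l) -> finite_set S.
Proof.
elim: l S => [|y l IH] S hS.
  suff -> : S = set0 by exact: finite_set0.
  by apply/seteqP; split=> // x /hS.
apply: (@sub_finite_set _ _ ([set y] `|` (S `\ y))).
  by move=> x hx; case: (pselect (x = y)) => e; [left|right].
rewrite finite_setU; split; first exact: finite_set1.
by apply: IH => x [h1 h2]; case: (hS x h1) => // e; case: h2.
Qed.

Lemma List_tnth (A : Type) (l : seq A) x : List.In x l <-> exists i, tnth (in_tuple l) i = x.
Proof.
split=> [|[i <-]].
  elim: l => // y l IH /= [->|/IH[i hi]]; first by exists ord0.
  by exists (lift ord0 i); rewrite -hi !(tnth_nth x).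
rewrite (tnth_nth (tnth (in_tuple l) i)) /=; move: (tnth _ _) => x0.
move: (val i) (ltn_ord i) => k {i}; elim: l k => // y l IH [_|k hk] /=; first by left.
by right; exact: IH.
Qed.

Section Orbits.
Variables (K : Type) (L : language) (M : structure L).
Hypothesis Mm : monster K M.
Notation ctx := (lsort L -> Type).
Notation smV := (smV K).
Variables (C : set (elt M)) (sC : small K C).
Notation pC := (penv (A := C)).

(** The orbit is definable from its finitely many points and invariant over [C], so [invdef] defines
    it over [C]. *)
Lemma acl_orbit s (m : M s) (l : seq (M s)) :
  (forall g, automorphism g -> app g pC = pC -> List.In (g s m) l) -> acl C (existT _ s m).
Proof.
move=> hl; have sn := monster_uncountable Mm.
pose O := [set m' | exists g, [/\ automorphism g, app g pC = pC & g s m = m']].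
have [l' hl'] : exists l' : seq (M s), forall m', List.In m' l' <-> O m'.
  have H : forall l0 : seq (M s), exists l' : seq (M s), forall m', List.In m' l' <-> List.In m' l0 /\ O m'.
    elim=> [|x l0 [l' h]]; first by exists [::] => m'; split=> // -[].
    case: (pselect (O x)) => hx; [exists (x :: l')|exists l'] => m' /=; rewrite h.
      by split=> [[<-|[]]|[[]]]; tauto.
    by split=> [[]|[[<- //|]]]; tauto.
  have [l' h] := H l; exists l' => m'; rewrite h; split=> [[]//|[g [ga gC <-]]].
  by split; [exact: hl|exists g].
pose D : ctx := vars (fun _ : 'I_(size l') => s).
pose d : env M D := tenv (fun i : 'I_(size l') => tnth (in_tuple l') i).
pose th : form (vsum (vars (single s)) D) :=
  FDisj (map (fun i => FEq (TVar (inl (Var tt))) (TVar (inr (Var i : D s)))) (enum 'I_(size l'))).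
have thE (x : env M (vars (single s))) : sat th (ejoin x d) <-> O (x _ (Var tt)).
  rewrite -hl' sat_disj; split.
    move=> [phi hp]; have [i _ <-] := map_in_List hp => /= ->.
    by apply/List_tnth; exists i.
  move=> /List_tnth[i hi].
  exists (FEq (TVar (inl (Var tt))) (TVar (inr (Var i : D s)))); last by rewrite /= hi.
  apply: (in_map_List (fun i => FEq (TVar (inl (Var tt))) (TVar (inr (Var i : D s))))).
  by apply/List_in; rewrite mem_enum.
have [|chi hchi] := @invdef _ _ _ Mm _ _ _ pC d th (smV_par sC)
   (smV_vars (single s) (sml_count sn _)) (smV_vars _ (sml_count sn _)).
  move=> g ga gC x /thE[h [ha hC e]]; apply/thE; exists (fun s m => g s (h s m)); split.
  - exact: aut_comp.
  - by rewrite -[RHS]gC -[in RHS]hC.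
  - by rewrite e.
exists (rename (@forget_par _ _ _ C) chi); first by exists chi.
have E m' : lsat (rename (@forget_par _ _ _ C) chi) (tup1 m') <-> O m'.
  by rewrite lsat_tup1 hchi thE.
split; first by apply/E; exists (fun s m => m); split=> //; split=> // t; exists id.
by apply: (@List_finite _ _ l') => m' /E/hl'.
Qed.

Variables (I : Type) (so : I -> lsort L).
Hypothesis sI : small K [set: I].
Notation bA := (penv (A := acl C)).
Notation W := (vars so).
Variables (T : set (sentence L)) (TEI : eliminates_imaginaries T) (MT : models M T).

Lemma acl_tuple n (zo : 'I_n -> lsort L) (d : env M (vars zo)) :
  (forall i, acl C (existT _ _ (d _ (Var i)))) ->
  exists (P : form (vsum (vars zo) (par C))) (lz : seq (env M (vars zo))),
    sat P (ejoin d pC) /\ forall z, sat P (ejoin z pC) -> List.In z lz.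
Proof.
move=> hd.
have H i : {th : form (vsum (vars (single (zo i))) (par C)) |
   sat th (ejoin (tenv (tup1 (d _ (Var i)))) pC) /\
   finite_set [set m | sat th (ejoin (tenv (tup1 m)) pC)]}.
  apply: cid; have [phi1 [phi' _ <-] [h1 h2]] := hd i.
  exists phi'; split; first by rewrite lsat_tup1 in h1.
  move: h2; rewrite (_ : [set m | _] = [set m | sat phi' (ejoin (tenv (tup1 m)) pC)]) //.
  by apply/seteqP; split=> m /=; rewrite lsat_tup1.
pose P := thtup (fun i => sval (H i)).
suff [lz hlz] : exists lz : seq (env M (vars zo)), forall z, sat P (ejoin z pC) -> List.In z lz.
  by exists P, lz; split=> //; rewrite sat_thtup => i; case: (proj2_sig (H i)).
  have ll i := cid (finite_List (proj2 (proj2_sig (H i)))).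
  pose N := \max_i size (sval (ll i)).
  pose f (k : {ffun 'I_n -> 'I_N.+1}) : env M (vars zo) :=
    tenv (fun i => nth (d _ (Var i)) (sval (ll i)) (k i)).
  exists (map f (enum {ffun 'I_n -> 'I_N.+1})) => z; rewrite sat_thtup => hz.
  have K0 i : {k : 'I_N.+1 | nth (d _ (Var i)) (sval (ll i)) k = z _ (Var i)}.
    apply: cid; have := proj2_sig (ll i) _ (hz i).
    have hN : (size (sval (ll i)) <= N)%N by exact: (leq_bigmax i).
    move=> hin; suff [k [k1 k2]] : exists k, (k < size (sval (ll i)))%N /\ nth (d _ (Var i)) (sval (ll i)) k = z _ (Var i).
      by exists (inord k); rewrite inordK // ltnS; apply: ltnW; exact: leq_trans k1 hN.
    elim: (sval (ll i)) hin {hN} => //= y l0 IH [->|/IH[k [k1 k2]]]; first by exists 0%N.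
    by exists k.+1.
  have -> : z = f [ffun i => sval (K0 i)].
    by apply: funext2 => s [i]; rewrite /f /= ffunE; case: (K0 i).
  by apply: (in_map_List f); apply/List_in; rewrite mem_enum.
Qed.

(** The trace of [phi(a, _)] on the finite set of conjugates of the parameters has
    its canonical parameter in [acl C]. *)
Lemma acl_trace (a : env M W) (g : forall s, M s -> M s) (phi : form (vsum W (par (acl C)))) :
  automorphism g -> app g pC = pC ->
  (forall s m, acl C (existT _ s m) ->
     (forall h, automorphism h -> app h a = a -> app h pC = pC -> h s m = m) -> g s m = m) ->
  sat phi (ejoin a (app g bA)) <-> sat phi (ejoin a bA).
Proof.
move=> ga gC gfix; have [n [zo [phi0 [r ->]]]] := fsupp phi.
pose d : env M (vars zo) := fun s v => bA (r s v).
have E h : sat (rename (sum_map (fun s v => v) r) phi0) (ejoin a (app h bA)) =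
    sat phi0 (ejoin a (app h d)).
  by rewrite sat_rename; congr sat; apply: funext2 => s [|[]].
have E0 : sat (rename (sum_map (fun s v => v) r) phi0) (ejoin a bA) = sat phi0 (ejoin a d).
  by rewrite sat_rename; congr sat; apply: funext2 => s [|[]].
rewrite E E0.
have [P [lz [dP hlz]]] := acl_tuple (d := d) (fun i => proj2_sig (r _ (Var i))).
have PC h (z : env M (vars zo)) : automorphism h -> app h pC = pC ->
    sat P (ejoin (app h z) pC) <-> sat P (ejoin z pC).
  by move=> ha hC; rewrite -[in X in X <-> _]hC -app_ejoin sat_aut.
pose r1 s (x : vsum W (vars zo) s) : vsum (vars zo) (vsum W (par C)) s :=
  match x with inl w => inr (inl w) | inr z => inl z end.
pose r2 s (x : vsum (vars zo) (par C) s) : vsum (vars zo) (vsum W (par C)) s :=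
  match x with inl z => inl z | inr c => inr (inr c) end.
pose th := FAnd (rename r1 phi0) (rename r2 P).
have thE (z : env M (vars zo)) x : sat th (ejoin z (ejoin x pC)) <-> sat phi0 (ejoin x z) /\ sat P (ejoin z pC).
  rewrite sat_and !sat_rename.
  have -> : (fun s v => ejoin z (ejoin x pC) (r1 s v)) = ejoin x z by apply: funext2 => s [].
  by have -> : (fun s v => ejoin z (ejoin x pC) (r2 s v)) = ejoin z pC by apply: funext2 => s [].
have [k [eo [e he]]] := canonical_parameter TEI MT th (ejoin a pC) (fin_vars zo).
(* The mask records which points of [lz] lie in the conjugate of the trace under [h]. It determines
   the image of [e] under [h], and there are finitely many masks, so each coordinate of [e] has a
   finite orbit over [C]. *)
pose mask h := map (fun z => `[< sat th (ejoin z (app h (ejoin a pC))) >]) lz.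
have same h h' : automorphism h -> app h pC = pC -> automorphism h' -> app h' pC = pC ->
    mask h = mask h' -> forall i, h _ (e i) = h' _ (e i).
  move=> ha hC ha' hC' em.
  have ez z : sat th (ejoin z (app h (ejoin a pC))) <-> sat th (ejoin z (app h' (ejoin a pC))).
    have z0 h0 : app h0 pC = pC -> sat th (ejoin z (app h0 (ejoin a pC))) -> List.In z lz.
      by move=> h0C; rewrite app_ejoin h0C => /thE[_ /hlz].
    have zE : List.In z lz -> `[< sat th (ejoin z (app h (ejoin a pC))) >] = `[< sat th (ejoin z (app h' (ejoin a pC))) >].
      move: em; rewrite /mask; elim: (lz) => //= y l0 IH [e1 /IH h1] [<-//|]; exact: h1.
    split=> hs.
      by have := zE (z0 h hC hs); rewrite (asboolT hs) => /esym/asboolP.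
    by have := zE (z0 h' hC' hs); rewrite (asboolT hs) => /asboolP.
  have [h1 [h1a h1h h1h']] := aut_inv ha'.
  have [_ H2] := he (fun s m => h1 s (h s m)) (aut_comp h1a ha).
  move=> i; rewrite -[LHS](h1h') H2 // => u.
  set X := ejoin a pC in ez *.
  have A1 : sat th (ejoin u (app (fun s m => h1 s (h s m)) X)) = sat th (ejoin (app h' u) (app h X)).
    rewrite -(sat_aut _ _ ha') app_ejoin; congr sat; congr ejoin.
    by apply: funext2 => s v; rewrite /app h1h'.
  have A2 : sat th (ejoin u X) = sat th (ejoin (app h' u) (app h' X)).
    by rewrite -[LHS](sat_aut _ _ ha') app_ejoin.
  by rewrite A1 A2; exact: ez.
have eacl i : acl C (existT _ _ (e i)).
  apply: (@acl_orbit _ _ (map (fun t : (size lz).-tuple bool =>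
     match pselect (exists h, [/\ automorphism h, app h pC = pC & mask h = t]) with
     left hh => sval (cid hh) _ (e i) | right _ => e i end) (enum {: (size lz).-tuple bool}))) => h ha hC.
  have sm : size (mask h) == size lz by rewrite size_map.
  pose t : (size lz).-tuple bool := Tuple sm.
  have -> : h _ (e i) = match pselect (exists h, [/\ automorphism h, app h pC = pC & mask h = t]) with
     left hh => sval (cid hh) _ (e i) | right _ => e i end.
    case: pselect => [hh|[]]; last by exists h.
    case: cid => h' /= [ha' hC' em]; exact: same.
  apply: (in_map_List (fun t : (size lz).-tuple bool =>
     match pselect (exists h, [/\ automorphism h, app h pC = pC & mask h = t]) with
     left hh => sval (cid hh) _ (e i) | right _ => e i end)).
  by apply/List_in; rewrite mem_enum.
have ge i : g _ (e i) = e i.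
  apply: gfix; first exact: eacl.
  by move=> h ha hb hC; move: i; apply/(he h ha) => u; rewrite app_ejoin hb hC.
have gF := (he g ga).1 ge.
have gdP : sat P (ejoin (app g d) pC) by apply/PC.
have h1 := gF (app g d); rewrite -app_ejoin sat_aut // !thE in h1.
tauto.
Qed.

End Orbits.

(** * Invariance over the part of [acl C] definable from a generic *)

Section Invariance.
Variables (K : Type) (L : language) (M : structure L).
Hypothesis Mm : monster K M.
Notation ctx := (lsort L -> Type).
Notation smV := (smV K).
Variables (C : set (elt M)) (sC : small K C).
Variables (I : Type) (so : I -> lsort L).
Hypothesis sI : small K [set: I].
Variable p0 : set (lform M (vars so)).
Hypothesis p0dom : stably_dominated C K p0.
Hypothesis p0over : p0 `<=` Defs.over C.
Variables (T : set (sentence L)) (TEI : eliminates_imaginaries T) (MT : models M T).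
Notation pC := (penv (A := C)).
Notation bA := (penv (A := acl C)).
Notation W := (vars so).
Variable q : set (lform M W).
Hypothesis dq : dext C p0 q.

Lemma act_comp g h (phi : lform M W) : act_form g (act_form h phi) = act_form (fun s m => g s (h s m)) phi.
Proof. by rewrite /act_form rename_comp; congr (rename _ phi); apply: funext2 => s []. Qed.

Lemma sat_act g (phi : lform M W) x : automorphism g ->
  sat (act_form g phi) (ejoin (app g x) (@pid _ M)) = sat phi (ejoin x (@pid _ M)).
Proof.
move=> ga; rewrite /act_form sat_rename -[RHS](sat_aut _ _ ga) app_ejoin.
by congr sat; apply: funext2 => s [].
Qed.

(** The pullback [q'] of [q] under [g] is again an invariant extension of [p0]. By [acl_trace] it
    agrees with [q] over [acl C], so [dext_unique] identifies the two. *)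
Lemma dext_inv (a : env M W) g : 
  (forall phi : form (vsum W (par (acl C))), Q q phi bA -> sat phi (ejoin a bA)) ->
  automorphism g -> app g pC = pC ->
  (forall s m, acl C (existT _ s m) ->
     (forall h, automorphism h -> app h a = a -> app h pC = pC -> h s m = m) -> g s m = m) ->
  forall phi, q phi <-> q (act_form g phi).
Proof.
move=> ra ga gC gfix phi; have [gq iq pq] := dq.
have [h [ha hg gh]] := aut_inv ga.
have hC : app h pC = pC by rewrite -{1}gC; apply: funext2 => s v; exact: hg.
pose q' : set (lform M W) := [set phi | q (act_form g phi)].
have d' : dext C p0 q'.
  split.
  - split=> [psi|l hl]; first exact: (gq.1 (act_form g psi)).
    have [psi hp|x hx] := gq.2 (map (fun chi => act_form g chi) l).
      by have [chi h1 <-] := map_in_List hp; exact: hl.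
    exists (app h x) => psi hp; rewrite -(sat_act _ _ ga).
    have -> : app g (app h x) = x by apply: funext2 => s v; exact: gh.
    by apply: hx; exact: (in_map_List (fun chi => act_form g chi)).
  - move=> k ka kA psi; rewrite /q' /= act_comp.
    (* Since [g] maps [acl C] onto itself, conjugation by it preserves the automorphisms over
       [acl C]. *)
    pose k' s m := g s (k s (h s m)).
    have k'a : automorphism k' by apply: aut_comp => //; exact: aut_comp.
    have k'A : app k' bA = bA.
      apply/app_penv => s m hm; rewrite /k'.
      by have /app_penv -> := kA; [exact: gh|exact: (acl_aut ha hC hm)].
    rewrite (iq _ k'a k'A (act_form g psi)) act_comp /k'.
    suff -> : (fun s m => g s (k s (h s (g s m)))) = (fun s m => g s (k s m)) by [].
    by apply: funext2 => s m; rewrite hg.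
  - move=> psi hp; rewrite /q' /=; have [psi' _ e] := p0over hp; rewrite -e in hp *.
    have := pq _ hp; congr (q _); rewrite /act_form rename_comp; congr (rename _ psi').
    apply: funext2 => s [//|c] /=; congr inr.
    have := congr1 (fun f : env M (par C) => f s c) gC; by rewrite /app /= => ->.
have sA : smV (par (acl C)) by exact/smV_par/(acl_small Mm).
have raE (psi : form (vsum W (par (acl C)))) : Q q psi bA <-> sat psi (ejoin a bA).
  split; first exact: ra.
  by move=> hs; apply: contrapT => nq; exact: (ra _ ((Q_not gq psi bA).2 nq) hs).
have agree0 (psi : form (vsum W (par (acl C)))) : Q q psi bA <-> Q q' psi bA.
  have [rho hrho] := acl_perm ha hC.
  have E : app g bA = (fun s c => bA (rho s c)).
    by apply: funext2 => s c; rewrite /app hrho /app gh.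
  have q'E : Q q' psi bA = Q q psi (app g bA).
    by rewrite /Q /q' /= /act_form rename_comp; congr (q (rename _ psi)); apply: funext2 => s [].
  rewrite q'E E -Q_rename !raE sat_rename.
  rewrite -(acl_trace Mm sC TEI MT psi ga gC gfix) E.
  suff -> : (fun s v => ejoin a bA (sum_map (fun s v => v) rho v)) = ejoin a (fun s c => bA (rho s c)) by [].
  by apply: funext2 => s [].
have [n [vo [phi' [r ->]]]] := fsupp phi.
have := dext_unique Mm sC sI p0dom p0over phi' r dq d' agree0.
by rewrite /Q => -> //; apply: (smV_fin Mm); exact: fin_vars.
Qed.

End Invariance.

(** * Germs *)

Section Equal.
Variables (L : language) (M : structure L).
Notation ctx := (lsort L -> Type).
Variables (W Y Z : ctx) (F : form (vsum W (vsum Y Z))).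

(** [f_u(x)] and [f_v(x)] are defined and equal. *)
Definition agree_at (x : env M W) (u v : env M Z) :=
  exists y, forall y', (sat F (ejoin x (ejoin y' u)) <-> y' = y) /\
                       (sat F (ejoin x (ejoin y' v)) <-> y' = y).

Lemma agree_at_form : fin Y -> exists eta : form (vsum W (vsum Z Z)),
  forall x u v, sat eta (ejoin x (ejoin u v)) <-> agree_at x u v.
Proof.
move=> fY; have [th hth] := @eqform _ M _ fY.
pose X : ctx := vsum (vsum (vsum W (vsum Z Z)) Y) Y.
pose r1 s (v : vsum W (vsum Y Z) s) : X s :=
  match v with inl w => inl (inl (inl w)) | inr (inl y) => inr y | inr (inr z) => inl (inl (inr (inl z))) end.
pose r2 s (v : vsum W (vsum Y Z) s) : X s :=
  match v with inl w => inl (inl (inl w)) | inr (inl y) => inr y | inr (inr z) => inl (inl (inr (inr z))) end.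
pose r3 s (v : vsum Y Y s) : X s := match v with inl y => inr y | inr y => inl (inr y) end.
exists (FEx fY (FAl fY (FAnd (FIff (rename r1 F) (rename r3 th)) (FIff (rename r2 F) (rename r3 th))))) => x u v.
rewrite sat_ex; split=> -[y hy]; exists y.
  move=> y'; move: hy; rewrite sat_al => /(_ y'); rewrite sat_and !sat_iff !sat_rename.
  have -> : (fun s w => ejoin (ejoin (ejoin x (ejoin u v)) y) y' (r1 s w)) = ejoin x (ejoin y' u) by apply: funext2 => s [|[]].
  have -> : (fun s w => ejoin (ejoin (ejoin x (ejoin u v)) y) y' (r2 s w)) = ejoin x (ejoin y' v) by apply: funext2 => s [|[]].
  have -> : (fun s w => ejoin (ejoin (ejoin x (ejoin u v)) y) y' (r3 s w)) = ejoin y' y by apply: funext2 => s [].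
  by rewrite !hth.
rewrite sat_al => y'; rewrite sat_and !sat_iff !sat_rename.
have -> : (fun s w => ejoin (ejoin (ejoin x (ejoin u v)) y) y' (r1 s w)) = ejoin x (ejoin y' u) by apply: funext2 => s [|[]].
have -> : (fun s w => ejoin (ejoin (ejoin x (ejoin u v)) y) y' (r2 s w)) = ejoin x (ejoin y' v) by apply: funext2 => s [|[]].
have -> : (fun s w => ejoin (ejoin (ejoin x (ejoin u v)) y) y' (r3 s w)) = ejoin y' y by apply: funext2 => s [].
by rewrite !hth.
Qed.

Lemma agree_at_sym x u v : agree_at x u v -> agree_at x v u.
Proof. by move=> [y hy]; exists y => y'; have [] := hy y'. Qed.

(** Agreement includes that the common value is the only one, which forces the two values for [v] to
    coincide. *)
Lemma agree_at_trans x u v w : agree_at x u v -> agree_at x v w -> agree_at x u w.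
Proof.
move=> [y hy] [z hz]; have e : y = z by apply/(hz y).1/(hy y).2.
by exists y => y'; have [h1 _] := hy y'; have [_ h2] := hz y'; rewrite e in h1 *.
Qed.

Lemma agree_at_aut g x u v : automorphism g -> agree_at (app g x) (app g u) (app g v) <-> agree_at x u v.
Proof.
move=> ga; have [h [ha hg gh]] := aut_inv ga.
have gK (V : ctx) (z : env M V) : app h (app g z) = z by apply: funext2 => s w; exact: hg.
have hK (V : ctx) (z : env M V) : app g (app h z) = z by apply: funext2 => s w; exact: gh.
split=> -[y hy].
  exists (app h y) => y'; have := hy (app g y').
  rewrite -!app_ejoin !sat_aut // => -[h1 h2]; rewrite h1 h2.
  by split; split=> [<-|->]; rewrite ?gK ?hK.
exists (app g y) => y'; have := hy (app h y').
rewrite -(sat_aut _ (ejoin x _) ga) -(sat_aut _ (ejoin x (ejoin _ v)) ga) !app_ejoin hK => -[h1 h2]; rewrite h1 h2.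
by split; split=> [<-|->]; rewrite ?gK ?hK.
Qed.

End Equal.

Section Q2.
Variables (L : language) (M : structure L).
Notation ctx := (lsort L -> Type).
Variables (W : ctx) (q : set (lform M W)).
Hypothesis gq : gtp q.

Lemma Q_mono2 (V V' V'' : ctx) (phi : form (vsum W V)) e (phi' : form (vsum W V')) e'
   (psi : form (vsum W V'')) e'' :
  (forall x, sat phi (ejoin x e) -> sat phi' (ejoin x e') -> sat psi (ejoin x e'')) ->
  Q q phi e -> Q q phi' e' -> Q q psi e''.
Proof.
move=> h h1 h2.
have E1 : Q q (rename (sum_map (fun s v => v) (fun s v => inl v)) phi) (ejoin e e') by rewrite Q_rename.
have E2 : Q q (rename (sum_map (fun s v => v) (fun s v => inr v)) phi') (ejoin e e') by rewrite Q_rename.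
have := Q_and gq E1 E2; apply: (Q_mono gq) => x; rewrite sat_and !sat_rename => -[k1 k2].
apply: h.
  rewrite (_ : ejoin x e = (fun s v => ejoin x (ejoin e e') (sum_map (fun s v => v) (fun s (v : V s) => inl v) v))) //.
  by apply: funext2 => s [].
rewrite (_ : ejoin x e' = (fun s v => ejoin x (ejoin e e') (sum_map (fun s v => v) (fun s (v : V' s) => inr v) v))) //.
by apply: funext2 => s [].
Qed.

End Q2.

(** * Inserting a generic point into a Morley sequence *)

Section Insert.
Variables (K : Type) (L : language) (M : structure L).
Hypothesis Mm : monster K M.
Notation ctx := (lsort L -> Type).
Notation smV := (smV K).
Variables (B W X : ctx) (b : env M B) (x : env M X) (q : set (lform M W)).
Hypotheses (gq : gtp q) (sB : smV B) (sW : smV W) (sX : smV X).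
Hypothesis cq : comm K b q q.
Variables (a : env M W) (c : nat -> env M W).
Hypothesis ra : real b q a x.
Hypothesis rc : forall n, real b q (c n) (ejoin (ejoin x a) (pre c n)).

Definition insert i k := if (k < i)%N then c k else if k == i then a else c k.-1.

(** The terms of [c] were chosen generic over [a] and [x] too. Only [a] itself needs an argument:
    commutation moves it past the preceding terms of [c] one at a time. *)
Lemma insert_mor i n : morley (ejoin b x) (fun=> q) (insert i) n.
Proof.
move=> k _; apply/(real_base _ _ _ _ gq); rewrite /insert; case: (ltngtP k i) => ki.
- apply: (real_sub (rho := fun s (v : vsum X (cprod 'I_k W) s) => match v with inl y => inr (inl (inl y)) | inr p => inr (inr p) end) gq (@rc k)).
  by move=> s [//|[l w]] /=; rewrite /pre /= (ltn_trans (ltn_ord l) ki).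
- case: k ki => [//|k] ki /=.
  apply: (real_sub (rho := fun s (v : vsum X (cprod 'I_k.+1 W) s) => match v with
     inl y => inr (inl (inl y))
   | inr (l, w) => if l == i :> nat then inr (inl (inr w)) else
       match @idP ((if (l < i)%N then val l else l.-1) < k)%N with
       | ReflectT h => inr (inr (Ordinal h, w)) | ReflectF _ => inr (inl (inr w)) end
     end) gq (@rc k)) => s [//|[l w]] /=.
  rewrite /pre /=; case: (ltngtP l i) => li //.
  - case: {-}_ / idP => //= h; exfalso; apply: h; exact: leq_trans li ki.
  - case: {-}_ / idP => //= h; exfalso; apply: h; have := ltn_ord l; lia.
- subst i; elim: k => [|k IH].
    apply: (real_sub (rho := fun s (v : vsum X (cprod 'I_0 W) s) => match v with inl y => inr y | inr p => match p with (Ordinal _ h, w) => False_rect _ (notF h) end end) gq ra).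
    by move=> s [//|[[]]].
  have sXk : smV (vsum X (cprod 'I_k W)) by apply: (smV_vsum Mm) => //; exact: (sm_pre Mm sW).
  have IH' : real b q a (ejoin x (pre c k)).
    rewrite (_ : pre c k = pre (fun k0 => if (k0 < k)%N then c k0 else if k0 == k then a else c k0.-1) k) //.
    by apply: pre_ext => l ->.
  have rk : real b q (c k) (ejoin (ejoin x (pre c k)) a).
    apply: (real_sub (rho := fun s (v : vsum (vsum X (cprod 'I_k W)) W s) => match v with
      inl (inl y) => inr (inl (inl y)) | inl (inr p) => inr (inr p) | inr w => inr (inl (inr w)) end) gq (@rc k)).
    by move=> s [[]|].
  apply: (real_sub (rho := fun s (v : vsum X (cprod 'I_k.+1 W) s) => match v with
     inl y => inr (inl (inl y))
   | inr (l, w) => match @idP (l < k)%N with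
       | ReflectT h => inr (inl (inr (Ordinal h, w))) | ReflectF _ => inr (inr w) end
     end) gq (cq sXk IH' rk)) => s [//|[l w]] /=.
  rewrite /pre /= ltn_ord; case: {-}_ / idP => //= h.
  by have -> : val l = k by apply/eqP; rewrite eqn_leq -ltnS ltn_ord /= leqNgt; apply/negP.
Qed.

End Insert.

(** * Codes of germs and their strength *)

Section Germs.
Variables (K : Type) (L : language) (M : structure L).
Hypothesis Mm : monster K M.
Notation ctx := (lsort L -> Type).
Notation smV := (smV K).
Variables (C : set (elt M)) (sC : small K C).
Variables (I : Type) (so : I -> lsort L).
Hypothesis sI : small K [set: I].
Variable p0 : set (lform M (vars so)).
Hypothesis p0dom : stably_dominated C K p0.
Hypothesis p0over : p0 `<=` Defs.over C.
Variables (T : set (sentence L)) (TEI : eliminates_imaginaries T) (MT : models M T).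
Notation pC := (penv (A := C)).
Notation bA := (penv (A := acl C)).
Notation W := (vars so).
Variable q : set (lform M W).
Hypothesis dq : dext C p0 q.
Variable C2 : set (elt M).
Hypotheses (CC2 : C `<=` C2) (C2A : C2 `<=` acl C).
Notation b2 := (penv (A := C2)).
Hypothesis iq2 : inv b2 q.
Variables (Y Z : ctx) (fZ : fin Z) (sZ : smV Z).
Variable F : form (vsum W (vsum Y Z)).
Variable eta : form (vsum W (vsum Z Z)).
Hypothesis etaE : forall x u v, sat eta (ejoin x (ejoin u v)) <-> agree_at (M := M) F x u v.

Notation germ u v := (Q q eta (ejoin u v)).

Let gq : gtp q. Proof. by case: dq. Qed.
Let iq : inv bA q. Proof. by case: dq. Qed.
Let sW : smV W. Proof. exact/smV_vars/smallT. Qed.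
Let sA : smV (par (acl C)). Proof. exact/smV_par/(acl_small Mm). Qed.
Let sZZ : smV (vsum Z Z). Proof. exact: (smV_vsum Mm). Qed.

Lemma bA_b2 g : app g bA = bA -> app g b2 = b2.
Proof. by move=> /app_penv h; apply/app_penv => s m /C2A/h. Qed.

Lemma b2_pC g : app g b2 = b2 -> app g pC = pC.
Proof. by move=> /app_penv h; apply/app_penv => s m /CC2/h. Qed.

Lemma germ_sym u v : germ u v -> germ v u.
Proof. by apply: (Q_mono gq) => x /etaE/agree_at_sym/etaE. Qed.

Lemma germ_trans u v w : germ u v -> germ v w -> germ u w.
Proof. by apply: (Q_mono2 gq) => x /etaE h1 /etaE h2; apply/etaE; exact: agree_at_trans h1 h2. Qed.

Lemma germ_aut g u v : automorphism g -> app g b2 = b2 -> germ (app g u) (app g v) <-> germ u v.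
Proof. by move=> ga gb; rewrite -app_ejoin; exact: (Q_aut _ _ iq2 ga gb). Qed.

(** Invariance of [q] over [C2] makes its restrictions to supersets of [acl C]
    move correctly even though [g] only permutes [acl C]. *)
Lemma real_acl_app g a (V : ctx) (e : env M V) : automorphism g -> app g b2 = b2 ->
  real bA q a e -> real bA q (app g a) (app g e).
Proof.
move=> ga gb ra; have [rho hrho] := acl_perm ga (b2_pC gb).
apply: (real_any (b := app g bA) (e := app g e) (rho := fun s v => match v with inl c => inl (rho s c) | inr v => inr v end) gq).
  move=> phi; rewrite -app_ejoin (Q_aut _ _ iq2 ga gb) => /ra.
  by rewrite -app_ejoin sat_aut.
by move=> s [c|//] /=; exact: hrho.
Qed.

Section Fibre.
Variable b : env M Z.
Hypothesis bb : germ b b.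

(** Inserting [a] as [i]-th term of [c] gives a sequence that is Morley over [b] and
    over [app g b]; moving it back to [c] changes only the [i]-th value. *)
Lemma move_one (a : env M W) g (c : nat -> env M W) n i : automorphism g -> app g b2 = b2 ->
  germ (app g b) b -> app g a = a -> real bA q a b ->
  (forall k, real bA q (c k) (ejoin (ejoin (ejoin b (app g b)) a) (pre c k))) ->
  (i < n)%N -> ~ agree_at F a (app g b) b ->
  exists h, [/\ automorphism h, app h b2 = b2 /\ germ (app h b) b,
    forall k, (k < n)%N -> app h (c k) = c k,
    forall k, (k < n)%N -> k != i -> agree_at F (c k) (app h b) b &
    ~ agree_at F (c i) (app h b) b].
Proof.
move=> ga g2 gbb gaa ra rc hi na.
have sbA (z : env M Z) : smV (vsum (par (acl C)) Z) by exact: (smV_vsum Mm).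
have cq := dext_comm Mm sC sI p0dom p0over dq dq.
have ra' : real bA q a (app g b) by rewrite -{1}gaa; exact: real_acl_app.
have rb k : real bA q (c k) (ejoin (ejoin b a) (pre c k)).
  apply: (real_sub (rho := fun s (v : vsum (vsum Z W) (cprod 'I_k W) s) => match v with
    inl (inl z) => inr (inl (inl (inl z))) | inl (inr w) => inr (inl (inr w)) | inr p => inr (inr p) end) gq (@rc k)).
  by move=> s [[]|].
have rb' k : real bA q (c k) (ejoin (ejoin (app g b) a) (pre c k)).
  apply: (real_sub (rho := fun s (v : vsum (vsum Z W) (cprod 'I_k W) s) => match v with
    inl (inl z) => inr (inl (inl (inr z))) | inl (inr w) => inr (inl (inr w)) | inr p => inr (inr p) end) gq (@rc k)).
  by move=> s [[]|].
have m1 := insert_mor Mm gq sW sZ cq ra rb (i := i) (n := n).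
have m2 := insert_mor Mm gq sW sZ cq ra' rb' (i := i) (n := n).
have m3 : morley (ejoin bA b) (fun=> q) c n.
  move=> k _; apply/(real_base _ _ _ _ gq).
  apply: (real_sub (rho := fun s (v : vsum Z (cprod 'I_k W) s) => match v with
    inl z => inr (inl (inl z)) | inr p => inr (inr p) end) gq (@rb k)).
  by move=> s [].
have m4 : morley (ejoin bA (app g b)) (fun=> q) (fun k => app g (c k)) n.
  move=> k hk; apply/(real_base _ _ _ _ gq).
  have /(real_base _ _ _ _ gq)/(real_acl_app ga g2) := m3 k hk.
  by rewrite app_ejoin.
have mv (z : env M Z) d d' : morley (ejoin bA z) (fun=> q) d n -> morley (ejoin bA z) (fun=> q) d' n ->
    exists h, [/\ automorphism h, app h bA = bA, app h z = z & forall k, (k < n)%N -> app h (d k) = d' k].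
  move=> md md'.
  have [h [ha]] := hom Mm (smV_vsum Mm (sbA z) (sm_pre Mm sW n))
    (mor_uniq Mm (sbA z) sW (fun=> gq) (fun=> inv_base iq) md md').
  rewrite app_ejoin => /ejoin_inj[]; rewrite app_ejoin => /ejoin_inj[hA hz] hp.
  exists h; split=> // k hk; apply: funext2 => s w.
  exact: (congr1 (fun f : env M (cprod 'I_n W) => f s (Ordinal hk, w)) hp).
have [h1 [h1a h1A h1b h1c]] := mv _ _ _ m1 m3.
have [h2 [h2a h2A h2b h2c]] := mv _ _ _ m4 m2.
(* [g] takes [b, c] to their images, [h2] takes the image of [c] to the inserted sequence while
   fixing [app g b], and [h1] takes that sequence back to [c] while fixing [b]. So [h] fixes [c],
   and its effect on the values is that of [g] on the inserted sequence. *)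
pose h s m := h1 s (h2 s (g s m)).
have hb : app h b = app h1 (app g b) by rewrite -[in RHS]h2b.
have hc k : (k < n)%N -> app h (c k) = c k.
  by move=> hk; rewrite -[RHS](h1c k hk) -(h2c k hk).
have back k : (k < n)%N -> agree_at F (c k) (app h b) b <-> agree_at F (insert a c i k) (app g b) b.
  move=> hk; rewrite hb -[X in agree_at _ X](h1c k hk) -[X in agree_at _ _ _ X <-> _]h1b agree_at_aut //.
have gen k : agree_at F (c k) (app g b) b.
  apply/etaE; apply: (real_at (rho := fun s (v : vsum Z Z s) => match v with inl z => inr (inl (inl (inr z))) | inr z => inr (inl (inl (inl z))) end) eta gq (@rc k) _).1 => //.
  by move=> s [].
exists h; split=> //.
- by apply: aut_comp => //; exact: aut_comp.
- split; first by rewrite -[RHS](bA_b2 h1A) -[in RHS](bA_b2 h2A) -[in RHS]g2.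
  by rewrite hb -{2}h1b; apply/germ_aut => //; exact: bA_b2.
- move=> k hk ki; apply/back => //; rewrite /insert (negbTE ki).
  by case: ifP => _; exact: gen.
- by move=> /(back _ hi); rewrite /insert ltnn eqxx.
Qed.

(** Otherwise [move_one], applied to every term of a Morley sequence in turn, yields
    an automorphism preserving the germ of [f_b] and changing all values of [f_b] on
    the sequence, against [dext_bound]. *)
Lemma germ_fix (a : env M W) g : automorphism g -> app g b2 = b2 ->
  germ (app g b) b -> app g a = a -> real bA q a b -> agree_at F a (app g b) b.
Proof.
move=> ga g2 gbb gaa ra; apply: contrapT => na.
have [n hn] := dext_bound Mm sC sI p0dom p0over dq eta sZZ.
set x := ejoin (ejoin b (app g b)) a.
have sX : smV (vsum (vsum Z Z) W) by exact: (smV_vsum Mm).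
have [c mc] := mor_ex Mm (ejoin bA x) (smV_vsum Mm sA sX) sW (qs := fun=> q) (fun=> gq).
have rc k : real bA q (c k) (ejoin x (pre c k)).
  by apply/(real_base _ _ _ _ gq); exact: (mc k.+1 k (ltnSn k)).
have mA : morley bA (fun=> q) c n.
  move=> k _; exact: (real_sub (rho := fun s v => inr (inr v)) gq (@rc k)).
have genb k : agree_at F (c k) b b.
  apply/etaE; apply: (real_at (rho := fun s (v : vsum Z Z s) => match v with inl z => inr (inl (inl (inl z))) | inr z => inr (inl (inl (inl z))) end) eta gq (@rc k) _).1 => //.
  by move=> s [].
have step m : (m <= n)%N -> exists h, [/\ automorphism h, app h b2 = b2,
    forall k, (k < n)%N -> app h (c k) = c k, germ (app h b) b &
    forall k, (k < n)%N -> agree_at F (c k) (app h b) b <-> (m <= k)%N].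
  elim: m => [_|m IH hm].
    by exists (fun s v => v); split=> [|//|//|//|k _]; [split=> // t; exists id|split=> // _; exact: genb].
  have [h [ha h2 hc hbb hh]] := IH (ltnW hm).
  have [h' [h'a [h'2 h'b] h'c h'1 h'n]] := move_one ga g2 gbb gaa ra rc hm na.
  have ch k z : (k < n)%N -> agree_at F (c k) (app h z) (app h b) <-> agree_at F (c k) z b.
    by move=> hk; rewrite -{1}(hc k hk) agree_at_aut.
  (* As [h] fixes the sequence, it transports comparisons with [b] into comparisons with [app h b]:
     the change made by [h'] appears at term [m] only, and the changes at earlier terms persist. *)
  exists (fun s v => h s (h' s v)); split.
  - exact: aut_comp.
  - by rewrite -[RHS]h2 -[in RHS]h'2.
  - by move=> k hk; rewrite -[RHS](hc k hk) -[in RHS](h'c k hk).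
  - by apply: germ_trans hbb; apply/(germ_aut (app h' b) b ha h2).
  - move=> k hk; have e1 := ch k (app h' b) hk; have e2 := hh k hk; split=> [h3|lk].
      case: (ltngtP m k) => // km; last first.
        by subst k; case: h'n; apply/e1; apply: agree_at_trans h3 (agree_at_sym _); exact/e2.
      have h4 : agree_at F (c k) (app h' b) b by apply: h'1 => //; rewrite neq_ltn km.
      have : agree_at F (c k) (app h b) b.
        by apply: agree_at_trans (agree_at_sym _) h3; exact/e1.
      by move/e2; rewrite leqNgt km.
    apply: agree_at_trans (_ : agree_at F (c k) (app h b) b); last by apply/e2; exact: ltnW.
    by apply/e1; apply: h'1 => //; rewrite neq_ltn lk orbT.
have [h [ha h2 hc hbb hh]] := step n (leqnn n).
apply: (hn c mA (ejoin (app h b) b) _ hbb) => k hk /etaE/(hh k hk).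
by rewrite leqNgt hk.
Qed.

(** Since [q] is definable, the parameters with the germ of [b] form a definable set; the code is
    its canonical parameter. *)
Lemma germ_code_ex : exists k (eo : 'I_k -> lsort L) (e : tup M eo),
  forall g, automorphism g -> app g b2 = b2 ->
  ((forall i, g _ (e i) = e i) <-> germ (app g b) b).
Proof.
have [V' [e' [del [sV' hdel]]]] := dext_definable Mm sC sI p0dom p0over dq eta sZZ.
pose r s (v : vsum (vsum Z Z) V' s) : vsum Z (vsum Z V') s := match v with
  inl (inl z) => inl z | inl (inr z) => inr (inl z) | inr v => inr (inr v) end.
have rE (u v : env M Z) z : sat (rename r del) (ejoin u (ejoin v z)) = sat del (ejoin (ejoin u v) z).
  by rewrite sat_rename; congr sat; apply: funext2 => s [[]|].
have [k [eo [e he]]] := canonical_parameter TEI MT (rename r del) (ejoin b e') fZ.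
exists k, eo, e => g ga g2; rewrite (he g ga).
have E u : sat (rename r del) (ejoin u (app g (ejoin b e'))) <-> germ u (app g b).
  have [h [ha hg gh]] := aut_inv ga.
  have gK (z : env M Z) : app g (app h z) = z by apply: funext2 => s v; exact: gh.
  by rewrite -{1}(gK u) -app_ejoin sat_aut // rE -hdel -(germ_aut _ _ ga g2) gK.
split=> [hu|hb u].
  by have := hu (app g b); rewrite E rE -hdel => <-; apply/germ_aut.
rewrite E rE -hdel; split=> h; first exact: germ_trans h hb.
by apply: germ_trans h _; exact: germ_sym.
Qed.

Section Code.
Variables (k : nat) (eo : 'I_k -> lsort L) (e : tup M eo).
Hypothesis he : forall g, automorphism g -> app g b2 = b2 ->
  ((forall i, g _ (e i) = e i) <-> germ (app g b) b).

Lemma germ_strong (a : env M W) (y : env M Y) : real bA q a b -> sat F (ejoin a (ejoin y b)) ->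
  forall g, automorphism g -> app g a = a -> app g (ejoin b2 (tenv e)) = ejoin b2 (tenv e) ->
  app g y = y.
Proof.
move=> ra hy g ga gaa; rewrite app_ejoin => /ejoin_inj[g2 ge].
have gbb : germ (app g b) b.
  by apply/he => // i; exact: (congr1 (fun f : env M (vars eo) => f _ (Var i)) ge).
have [z hz] := germ_fix ga g2 gbb gaa ra.
transitivity z; first last; first by apply/esym/(hz y).2.
by apply/(hz _).1; rewrite -{1}gaa -!app_ejoin sat_aut.
Qed.

(** If the germ moved, the negation of [eta] would be in [q] and fail on the whole sequence, against
    the bound. *)
Lemma code_from_values : exists n, forall c : nat -> env M W, morley bA (fun=> q) c n ->
  forall g, automorphism g -> app g b2 = b2 ->
  (forall i, (i < n)%N -> agree_at F (c i) (app g b) b) -> forall i, g _ (e i) = e i.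
Proof.
have [n hn] := dext_bound Mm sC sI p0dom p0over dq (FNot eta) sZZ.
exists n => c mc g ga g2 hc; apply/he => //; apply: contrapT => /(Q_not gq).
by apply: (hn c mc) => i hi; rewrite sat_not; apply; apply/etaE; exact: hc.
Qed.

End Code.
End Fibre.
End Germs.

(** * The stable part *)

Section GoodSets.
Variables (K : Type) (L : language) (M : structure L).
Hypothesis Mm : monster K M.
Notation ctx := (lsort L -> Type).
Notation smV := (smV K).

(** [Good] for a bare set, so that unions and images can be treated before a defining formula is at
    hand. *)
Definition GoodS (W : ctx) (X : set (env M W)) :=
  forall (V : ctx) (phi : form (vsum W V)), smV V -> exists k, ~ ord phi X k.

Lemma GoodS_map (W1 W2 : ctx) (X1 : set (env M W1)) (X2 : set (env M W2)) :
  (forall (V : ctx) (phi : form (vsum W1 V)), smV V ->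
     exists (V' : ctx) (psi : form (vsum W2 V')) (t : env M V -> env M V'), smV V' /\
       forall w1, X1 w1 -> exists2 w2, X2 w2 & forall v, sat phi (ejoin w1 v) <-> sat psi (ejoin w2 (t v))) ->
  GoodS X2 -> GoodS X1.
Proof.
move=> h G V phi sV; have [V' [psi [t [sV' ht]]]] := h V phi sV.
(* The additional term guarantees that [x 0] lies in [X1], which gives a default point even for
   [k = 0]. *)
have [k nk] := G V' psi sV'; exists k.+1 => -[x [y [hx hxy]]]; apply: nk.
have [w0 _ _] := ht _ (hx 0%N isT).
have H i : {w | (i < k)%N -> X2 w /\ forall v, sat phi (ejoin (x i) v) <-> sat psi (ejoin w (t v))}.
  apply: cid; case: (ltnP i k) => hi; last by exists w0.
  by have [w h1 h2] := ht _ (hx i (ltnW hi)); exists w.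
exists (fun i => sval (H i)), (fun j => t (y j)); split=> [i hi|i j hi hj].
  by have [] := proj2_sig (H i) hi.
have [_ h1] := proj2_sig (H i) hi.
by rewrite -h1; exact: hxy (ltnW hi) (ltnW hj).
Qed.

(** Of [k1 + k2] ordered points, [k1] lie in [X1] or [k2] lie in [X2], and a subsequence of an order
    is an order. *)
Lemma GoodS_union (W : ctx) (X1 X2 : set (env M W)) : GoodS X1 -> GoodS X2 -> GoodS (X1 `|` X2).
Proof.
move=> G1 G2 V phi sV; have [k1 n1] := G1 V phi sV; have [k2 n2] := G2 V phi sV.
exists (k1 + k2) => -[x [y [hx hxy]]].
have sub (k : nat) (P : pred nat) (X : set (env M W)) :
    (forall i, (i < k1 + k2)%N -> P i -> X (x i)) ->
    (k <= count P (seq.iota 0 (k1 + k2)))%N -> ord phi X k.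
  move=> hP /count_sub[f [hf1 hf2]]; exists (fun i => x (f i)), (fun i => y (f i)).
  split=> [i hi|i j hi hj]; first by have /andP[h1 h2] := hf1 i hi; exact: hP.
  have /andP[h1 _] := hf1 i hi; have /andP[h2 _] := hf1 j hj; rewrite hxy //.
  case: (ltngtP i j) => ij; first by rewrite (hf2 _ _ ij hj).
    by have := hf2 _ _ ij hi; split=> //; lia.
  by rewrite ij ltnn.
pose P i := `[< X1 (x i) >].
have := count_predC P (seq.iota 0 (k1 + k2)); rewrite size_iota.
case: (leqP k1 (count P (seq.iota 0 (k1 + k2)))) => h hc.
  by apply: n1; apply: (sub k1 P) => // i _ /asboolP.
apply: n2; apply: (sub k2 (predC P)); last by lia.
by move=> i hi /asboolPn; case: (hx i hi).
Qed.

Lemma Good_aut (W D : ctx) (th : form (vsum W D)) (d : env M D) g : automorphism g ->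
  Good K th d -> Good K th (app g d).
Proof.
move=> ga G V phi sV; have [k nk] := G V phi sV; exists k => -[x [y [hx hxy]]]; apply: nk.
have [h [ha hg gh]] := aut_inv ga.
have hK (U : ctx) (z : env M U) : app h (app g z) = z by apply: funext2 => s v; exact: hg.
exists (fun i => app h (x i)), (fun i => app h (y i)); split=> [i hi|i j hi hj].
  by have := hx i hi => /=; rewrite -(sat_aut _ _ ha) app_ejoin hK.
by rewrite -app_ejoin sat_aut //; exact: hxy.
Qed.

Lemma Good_image (W1 W2 D : ctx) (th : form (vsum W2 D)) (Gam : form (vsum W1 (vsum W2 D))) (d : env M D) :
  fin W1 -> fin W2 -> smV D ->
  (forall w z z', sat Gam (ejoin z (ejoin w d)) -> sat Gam (ejoin z' (ejoin w d)) -> z = z') ->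
  Good K th d ->
  exists th' : form (vsum W1 D), Good K th' d /\
    forall z, sat th' (ejoin z d) <-> exists2 w, sat th (ejoin w d) & sat Gam (ejoin z (ejoin w d)).
Proof.
move=> f1 f2 sD fG G.
pose X1 : ctx := vsum (vsum W1 D) W2.
pose r1 s (v : vsum W2 D s) : X1 s := match v with inl w => inr w | inr c => inl (inr c) end.
pose r2 s (v : vsum W1 (vsum W2 D) s) : X1 s :=
  match v with inl z => inl (inl z) | inr (inl w) => inr w | inr (inr c) => inl (inr c) end.
pose th' := FEx f2 (FAnd (rename r1 th) (rename r2 Gam)).
have E z : sat th' (ejoin z d) <-> exists2 w, sat th (ejoin w d) & sat Gam (ejoin z (ejoin w d)).
  rewrite sat_ex; split=> [[w]|[w h1 h2]].
    rewrite sat_and !sat_rename => -[h1 h2]; exists w.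
      by move: h1; congr sat; apply: funext2 => s [].
    by move: h2; congr sat; apply: funext2 => s [|[]].
  exists w; rewrite sat_and !sat_rename; split.
    by move: h1; congr sat; apply: funext2 => s [].
  by move: h2; congr sat; apply: funext2 => s [|[]].
exists th'; split=> //; apply: (GoodS_map _ (X2 := [set w | sat th (ejoin w d)])) G => V phi sV.
pose X2 : ctx := vsum (vsum W2 (vsum V D)) W1.
pose l1 s (v : vsum W1 (vsum W2 D) s) : X2 s :=
  match v with inl z => inr z | inr (inl w) => inl (inl w) | inr (inr c) => inl (inr (inr c)) end.
pose l2 s (v : vsum W1 V s) : X2 s := match v with inl z => inr z | inr c => inl (inr (inl c)) end.
exists (vsum V D), (FEx f1 (FAnd (rename l1 Gam) (rename l2 phi))), (fun v => ejoin v d).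
split; first exact: (smV_vsum Mm).
move=> z /E[w h1 h2]; exists w => // v; rewrite sat_ex.
have e1 z' : sat (rename l1 Gam) (ejoin (ejoin w (ejoin v d)) z') = sat Gam (ejoin z' (ejoin w d)).
  by rewrite sat_rename; congr sat; apply: funext2 => s [|[]].
have e2 z' : sat (rename l2 phi) (ejoin (ejoin w (ejoin v d)) z') = sat phi (ejoin z' v).
  by rewrite sat_rename; congr sat; apply: funext2 => s [].
split=> [h|[z']]; first by exists z; rewrite sat_and e1 e2.
by rewrite sat_and e1 e2 => -[h3 h4]; rewrite (fG _ _ _ h2 h3).
Qed.

End GoodSets.

(** * Good sets over [acl C] and their conjugates *)

Section Conjugates.
Variables (K : Type) (L : language) (M : structure L).
Hypothesis Mm : monster K M.
Notation ctx := (lsort L -> Type).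
Notation smV := (smV K).
Variables (C : set (elt M)) (sC : small K C).
Notation pC := (penv (A := C)).
Notation bA := (penv (A := acl C)).

(** The union of the finitely many conjugates over [C] of a good set over
    [acl C]. *)
Lemma Good_acl (W : ctx) (th : form (vsum W (par (acl C)))) (e : env M W) : smV W ->
  Good K th bA -> sat th (ejoin e bA) ->
  exists th' : form (vsum W (par C)), Good K th' pC /\ sat th' (ejoin e pC).
Proof.
move=> sW; have [n [zo [th0 [r ->]]]] := fsupp th; set d : env M (vars zo) := fun s v => bA (r s v).
have E z : sat (rename (sum_map (fun s v => v) r) th0) (ejoin z bA) = sat th0 (ejoin z d).
  by rewrite sat_rename; congr sat; apply: funext2 => s [].
rewrite E => G0 he.
have G : Good K th0 d.
  move=> V phi sV; have [k nk] := G0 V phi sV; exists k => -[x [y [h1 h2]]]; apply: nk.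
  by exists x, y; split=> // i hi; rewrite /= E; exact: h1.
have [P [lz [dP hlz]]] := acl_tuple (d := d) (fun i => proj2_sig (r _ (Var i))).
pose conj z := exists g, [/\ automorphism g, app g pC = pC & z = app g d].
have [D [d' [th1 [sD h1 h2]]]] : exists (D : ctx) (d' : env M D) (th1 : form (vsum W D)),
    [/\ smV D, Good K th1 d' & forall w, sat th1 (ejoin w d') <-> exists2 z, List.In z lz & conj z /\ sat th0 (ejoin w z)].
  elim: (lz) => [|z l [D [d' [th1 [sD h1 h2]]]]].
    exists (vars zo), d, (FBot _); split; first exact: (smV_fin Mm).
      by move=> V phi sV; exists 1%N => -[x [y [h _]]]; exact: (h 0%N isT).
    by move=> w; split=> // -[].
  case: (pselect (conj z)) => hz; last first.
    exists D, d', th1; split=> // w; rewrite h2; split=> -[z' h3 h4]; exists z' => //; first by right.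
    by case: h3 h4 => // <- [].
  exists (vsum (vars zo) D), (ejoin z d'), (FOr (rename (sum_map (fun s v => v) (fun s v => inl v)) th0)
     (rename (sum_map (fun s v => v) (fun s v => inr v)) th1)).
  have E1 w : sat (FOr (rename (sum_map (fun s v => v) (fun s v => inl v)) th0)
     (rename (sum_map (fun s v => v) (fun s v => inr v)) th1)) (ejoin w (ejoin z d')) =
     (sat th0 (ejoin w z) \/ sat th1 (ejoin w d')).
    by rewrite sat_or !sat_rename; congr (_ \/ _); congr sat; apply: funext2 => s [].
  split; first by apply: (smV_vsum Mm) => //; exact: (smV_fin Mm).
    have Gz : Good K th0 z by have [g [ga _ ->]] := hz; exact: Good_aut.
    move=> V phi sV; have [k nk] := GoodS_union Gz h1 phi sV; exists k => -[x [y [h3 h4]]]; apply: nk.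
    by exists x, y; split=> // i hi; rewrite /setU /mkset -E1; exact: h3.
  move=> w; rewrite E1 h2; split=> [[h|[z' h3 h4]]|[z' [<-|h3] h4]].
  - by exists z => //; left.
  - by exists z' => //; right.
  - by left; case: h4.
  - by right; exists z'.
have [|th' hth'] := @invdef _ _ _ Mm _ _ _ pC d' th1 (smV_par sC) sW sD.
  move=> g ga gC x /h2[z hz [[h [ha hC ez]] hx]]; apply/h2; exists (app g z); last first.
    split; last by rewrite -app_ejoin sat_aut.
    exists (fun s v => g s (h s v)); split; [exact: aut_comp|by rewrite -[RHS]gC -[in RHS]hC|].
    by rewrite ez.
  apply: hlz; rewrite -gC -app_ejoin sat_aut //.
  by rewrite ez -hC -app_ejoin sat_aut.
exists th'; split.
  move=> V phi sV; have [k nk] := h1 V phi sV; exists k => -[x [y [h3 h4]]]; apply: nk.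
  by exists x, y; split=> // i hi; apply/hth'; exact: h3.
apply/hth'/h2; exists d; first exact: hlz.
split=> //; exists (fun s v => v); split=> //; split=> // t; exact: (Bijective (g := id)).
Qed.

End Conjugates.

(** * Removing generic parameters *)

Section Descent.
Variables (K : Type) (L : language) (M : structure L).
Hypothesis Mm : monster K M.
Notation ctx := (lsort L -> Type).
Notation smV := (smV K).
Variables (C : set (elt M)) (sC : small K C).
Variables (I : Type) (so : I -> lsort L).
Hypothesis sI : small K [set: I].
Variable p0 : set (lform M (vars so)).
Hypothesis p0dom : stably_dominated C K p0.
Hypothesis p0over : p0 `<=` Defs.over C.
Notation pC := (penv (A := C)).
Notation bA := (penv (A := acl C)).
Notation W := (vars so).
Notation A := (par (acl C)).
Variable q : set (lform M W).
Hypothesis dq : dext C p0 q.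

Let gq : gtp q. Proof. by case: dq. Qed.
Let iq : inv bA q. Proof. by case: dq. Qed.
Let sW : smV W. Proof. exact/smV_vars/smallT. Qed.
Let sA : smV A. Proof. exact/smV_par/(acl_small Mm). Qed.

(** [q] being definable, so is the set of all [z] such that [chi(z; a, x)] for
    generic [a]; finitely many of its points lie in a common fibre. *)
Lemma descent (V0 E : ctx) (x : env M V0) (e0 : env M E) (a : env M W)
    (chi : form (vsum E (vsum (vsum A V0) W))) :
  smV V0 -> smV E -> real bA q a (ejoin x e0) -> Good K chi (ejoin (ejoin bA x) a) ->
  sat chi (ejoin e0 (ejoin (ejoin bA x) a)) ->
  exists th : form (vsum E (vsum A V0)), Good K th (ejoin bA x) /\ sat th (ejoin e0 (ejoin bA x)).
Proof.
move=> sV0 sE ra G he.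
pose B : ctx := vsum A V0; have sB : smV B by exact: (smV_vsum Mm).
pose r s (v : vsum E (vsum B W) s) : vsum W (vsum E B) s :=
  match v with inl z => inr (inl z) | inr (inl c) => inr (inr c) | inr (inr w) => inl w end.
pose bx : env M B := ejoin bA x.
have rE (w : env M W) (z : env M E) : sat (rename r chi) (ejoin w (ejoin z bx)) = sat chi (ejoin z (ejoin bx w)).
  by rewrite sat_rename; congr sat; apply: funext2 => s [|[]].
have [V' [e' [del [sV' hdel]]]] := dext_definable Mm sC sI p0dom p0over dq (rename r chi) (smV_vsum Mm sE sB).
pose r' s (v : vsum (vsum E B) V' s) : vsum E (vsum B V') s :=
  match v with inl (inl z) => inl z | inl (inr c) => inr (inl c) | inr v => inr (inr v) end.
have r'E z : sat (rename r' del) (ejoin z (ejoin bx e')) <-> Q q (rename r chi) (ejoin z bx).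
  rewrite hdel sat_rename; suff -> : (fun s v => ejoin z (ejoin bx e') (r' s v)) = ejoin (ejoin z bx) e' by [].
  by apply: funext2 => s [[]|].
have [|th hth] := @invdef _ _ _ Mm _ _ _ bx (ejoin bx e') (rename r' del) sB sE (smV_vsum Mm sB sV').
  move=> g ga gb z /r'E h; apply/r'E; rewrite -gb -app_ejoin.
  apply/(Q_aut _ _ iq ga) => //.
  by move: gb; rewrite /bx app_ejoin => /ejoin_inj[].
exists th; split; last first.
  apply/hth/r'E; apply/(real_at (rho := fun s (v : vsum E B s) => match v with inl z => inr (inr z) | inr (inl c) => inl c | inr (inr v) => inr (inl v) end) _ gq ra).
    by move=> s [|[]].
  by rewrite rE.
move=> V phi sV; have [k nk] := G V phi sV; exists k => -[w [y [hw hwy]]]; apply: nk.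
have [a' ra'] := real_ex Mm bA sA sW (ejoin x (pre w k)) gq (smV_vsum Mm sV0 (sm_pre Mm sE k)).
have r1 : real bA q a x by apply: (real_sub (rho := fun s v => inr (inl v)) gq ra).
have r2 : real bA q a' x by apply: (real_sub (rho := fun s v => inr (inl v)) gq ra').
have [g [ga]] := hom Mm (smV_vsum Mm sW sB) (real_eqtp Mm sA gq iq sV0 r2 r1 (eqtp_refl _)).
rewrite app_ejoin => /ejoin_inj[gaa gb].
exists (fun i => app g (w i)), (fun i => app g (y i)); split=> [i hi|i j hi hj]; last first.
  by rewrite -app_ejoin sat_aut //; exact: hwy.
have /hth/r'E := hw i hi.
rewrite (real_at (rho := fun s (v : vsum E B s) => match v with inl z => inr (inr (Ordinal hi, z)) | inr (inl c) => inl c | inr (inr v) => inr (inl v) end) _ gq ra'); last by move=> s [|[]].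
by rewrite rE -(sat_aut _ _ ga) !app_ejoin gaa -[app g x]/(app g x) -(app_ejoin g bA x) gb.
Qed.

Section Values.
Variables (n : nat) (to : 'I_n -> lsort L).
Notation Y := (vars to).
Variable chi : form (vsum Y (vsum W (par C))).

(** All [N] terms stay among the parameters, so that the induction on the number [m] of factors
    takes place over a fixed base. *)
Lemma Good_pow (c : nat -> env M W) (N m : nat) : (m <= N)%N ->
  (forall i, (i < N)%N -> Good K chi (ejoin (c i) pC)) ->
  exists th : form (vsum (cprod 'I_m Y) (vsum A (cprod 'I_N W))),
    Good K th (ejoin bA (pre c N)) /\ forall w, sat th (ejoin w (ejoin bA (pre c N))) <->
      forall i : 'I_m, sat chi (ejoin (fun s v => w s (i, v)) (ejoin (c i) pC)).
Proof.
move=> mN hG; set D := vsum A (cprod 'I_N W); set d := ejoin bA (pre c N).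
have sD : smV D by apply: (smV_vsum Mm) => //; exact: (sm_pre Mm sW).
have sY : smV Y by exact: (smV_fin Mm).
elim: m mN => [|m IH] mN.
  exists (FTrue _); split=> [V phi sV|w]; last by rewrite sat_true; split=> // _ [].
  exists 2 => -[x [y [_ h]]].
  have e : x 0%N = x 1%N by apply: funext2 => s [[]].
  by have := (h 0%N 1%N isT isT).2 isT; rewrite e => /(h 1%N 1%N isT isT).
have [th [h1 h2]] := IH (ltnW mN).
pose r s (v : vsum Y (vsum W (par C)) s) : vsum Y D s := match v with inl y => inl y
  | inr (inl w) => inr (inr (Ordinal mN, w)) | inr (inr c) => inr (inl (mkpar (sub_acl (proj2_sig c)))) end.
have rE y : sat (rename r chi) (ejoin y d) = sat chi (ejoin y (ejoin (c m) pC)).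
  by rewrite sat_rename; congr sat; apply: funext2 => s [|[]].
have G1 : Good K (rename r chi) d.
  move=> V phi sV; have [k nk] := hG m mN V phi sV; exists k => -[x [y [h3 h4]]]; apply: nk.
  by exists x, y; split=> // i hi; rewrite /mkset -rE; exact: h3.
have fY : fin Y by exact: fin_vars.
have G2 := Good_prod Mm sY (sm_pre Mm sY m) (fin_cprod m fY) sD G1 h1.
pose l s (v : vsum Y (cprod 'I_m Y) s) : cprod 'I_m.+1 Y s := match v with inl y => (ord_max, y)
   | inr (i, y) => (widen_ord (leqnSn m) i, y) end.
pose l' s (v : cprod 'I_m.+1 Y s) : vsum Y (cprod 'I_m Y) s := let: (i, y) := v in
   match ltnP i m with LtnNotGeq h => inr (Ordinal h, y) | GeqNotLtn _ => inl y end.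
have ll' s v : l s (l' s v) = v.
  case: v => i y; rewrite /l' /l; case: ltnP => h; congr pair; apply: val_inj => //=.
  by apply/eqP; rewrite eqn_leq h -ltnS ltn_ord.
pose L1 s (v : vsum (vsum Y (cprod 'I_m Y)) D s) : vsum (cprod 'I_m.+1 Y) D s :=
  match v with inl v => inl (l s v) | inr c => inr c end.
exists (rename L1 (thprod (rename r chi) th)).
have E w : sat (rename L1 (thprod (rename r chi) th)) (ejoin w d) =
   sat (thprod (rename r chi) th) (ejoin (ejoin (fun s v => w s (ord_max, v)) (fun s v => w s (widen_ord (leqnSn m) v.1, v.2))) d).
  by rewrite sat_rename; congr sat; apply: funext2 => s [[|[]]|].
split.
  apply: (GoodS_map _ (X2 := [set w | sat (thprod (rename r chi) th) (ejoin w d)])) G2 => V phi sV.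
  exists V, (rename (sum_map l' (fun s v => v)) phi), (fun v => v); split=> // w hw.
  exists (ejoin (fun s v => w s (ord_max, v)) (fun s v => w s (widen_ord (leqnSn m) v.1, v.2))).
    by rewrite /mkset -E.
  move=> v; rewrite sat_rename; suff -> : (fun s v0 => ejoin (ejoin (fun s v => w s (ord_max, v)) (fun s v => w s (widen_ord (leqnSn m) v.1, v.2))) v (sum_map l' (fun s v => v) v0)) = ejoin w v by [].
  apply: funext2 => s [z|//] /=; rewrite -[in RHS](ll' s z).
  by case: (l' s z) => [|[]].
move=> w; rewrite E sat_thprod h2 rE; split=> [[k1 k2] i|h].
  case: (ltnP i m) => hi.
    have e : widen_ord (leqnSn m) (Ordinal hi) = i by exact: val_inj.
    by have := k2 (Ordinal hi); rewrite /= e.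
  have ei : i = ord_max by apply: val_inj => /=; apply/eqP; rewrite eqn_leq hi -ltnS ltn_ord.
  by rewrite ei.
split; first exact: (h ord_max).
by move=> i; exact: (h (widen_ord (leqnSn m) i)).
Qed.

End Values.
End Descent.

(** * The code lies in a good set over [C] *)

Section GoodCode.
Variables (K : Type) (L : language) (M : structure L).
Hypothesis Mm : monster K M.
Notation ctx := (lsort L -> Type).
Notation smV := (smV K).
Variables (C : set (elt M)) (sC : small K C).
Variables (I : Type) (so : I -> lsort L).
Hypothesis sI : small K [set: I].
Variable p0 : set (lform M (vars so)).
Hypothesis p0dom : stably_dominated C K p0.
Hypothesis p0over : p0 `<=` Defs.over C.
Notation pC := (penv (A := C)).
Notation bA := (penv (A := acl C)).
Notation W := (vars so).
Notation A := (par (acl C)).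
Variable q : set (lform M W).
Hypothesis dq : dext C p0 q.
Variable C2 : set (elt M).
Hypothesis C2A : C2 `<=` acl C.
Notation b2 := (penv (A := C2)).
Variables (n0 : nat) (to : 'I_n0 -> lsort L).
Notation Y := (vars to).
Variables (Z : ctx) (sZ : smV Z).
Variable F : form (vsum W (vsum Y Z)).
Variable eta : form (vsum W (vsum Z Z)).
Hypothesis etaE : forall x u v, sat eta (ejoin x (ejoin u v)) <-> agree_at (M := M) F x u v.
Variable b : env M Z.
Hypothesis bb : Q q eta (ejoin b b).
Variables (k : nat) (eo : 'I_k -> lsort L) (e : tup M eo).
Hypothesis he : forall g, automorphism g -> app g b2 = b2 ->
  ((forall i, g _ (e i) = e i) <-> Q q eta (ejoin (app g b) b)).
Variable chi : form (vsum Y (vsum W (par C))).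
Hypothesis hG : forall a, real bA q a b -> Good K chi (ejoin a pC).
Hypothesis hF : forall a y, real bA q a b -> sat F (ejoin a (ejoin y b)) -> sat chi (ejoin y (ejoin a pC)).

Let gq : gtp q. Proof. by case: dq. Qed.
Let iq : inv bA q. Proof. by case: dq. Qed.
Let sW : smV W. Proof. exact/smV_vars/smallT. Qed.
Let sA : smV A. Proof. exact/smV_par/(acl_small Mm). Qed.

(** The code is a function of the values of [f_b] on a Morley sequence, so it lies
    in a good set over that sequence; the sequence is then eliminated one term at
    a time. *)
Lemma code_good : exists th : form (vsum (vars eo) (par C)), Good K th pC /\ sat th (ejoin (tenv e) pC).
Proof.
have [n hn] := code_from_values Mm sC sI p0dom p0over dq sZ etaE he.
pose te := tenv e.
have se : smV (vars eo) by exact: (smV_fin Mm).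
have sY : smV Y by exact: (smV_fin Mm).
(* The sequence is generic over the code as well as over [b]: [descent] removes a term only if it is
   generic over the point that is to stay in the set. *)
have [c mc] := mor_ex Mm (ejoin bA (ejoin b te)) (smV_vsum Mm sA (smV_vsum Mm sZ se)) sW (qs := fun=> q) (fun=> gq).
have rc i : real bA q (c i) (ejoin (ejoin b te) (pre c i)).
  by apply/(real_base _ _ _ _ gq); exact: (mc i.+1 i (ltnSn i)).
have rb i : real bA q (c i) b by apply: (real_sub (rho := fun s v => inr (inl (inl v))) gq (@rc i)).
have mA : morley bA (fun=> q) c n.
  by move=> i _; exact: (real_sub (rho := fun s v => inr (inr v)) gq (@rc i)).
have H i : {y : env M Y | forall y', sat F (ejoin (c i) (ejoin y' b)) <-> y' = y}.
  apply: cid; have /etaE[y hy] : sat eta (ejoin (c i) (ejoin b b)).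
    apply: (real_at (rho := fun s (v : vsum Z Z s) => match v with inl z => inr z | inr z => inr z end) eta gq (@rb i) _).1 => //.
    by move=> s [].
  by exists y => y'; have [] := hy y'.
pose y i : env M Y := sval (H i); have hy i := proj2_sig (H i).
pose yb : env M (cprod 'I_n Y) := fun s p => y p.1 s p.2.
pose d : env M (vsum A (cprod 'I_n W)) := ejoin bA (pre c n).
have sd : smV (vsum A (cprod 'I_n W)) by apply: (smV_vsum Mm) => //; exact: (sm_pre Mm sW).
have hfix g : automorphism g -> app g yb = yb -> app g d = d -> app g te = te.
  move=> ga gy gd.
  have [gA gp] : app g bA = bA /\ app g (pre c n) = pre c n.
    by move: gd; rewrite app_ejoin => /ejoin_inj.
  have g2 : app g b2 = b2 by exact: (bA_b2 C2A gA).
  suff h i : g _ (e i) = e i by apply: funext2 => s [i]; exact: h.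
  apply: (hn c mA g ga g2) => {}i hi.
  have gc : app g (c i) = c i.
    by apply: funext2 => s w; exact: (congr1 (fun f : env M (cprod 'I_n W) => f s (Ordinal hi, w)) gp).
  have gyi : app g (y i) = y i.
    by apply: funext2 => s w; exact: (congr1 (fun f : env M (cprod 'I_n Y) => f s (Ordinal hi, w)) gy).
  have [h [ha hg gh]] := aut_inv ga.
  have hK (V : ctx) (z : env M V) : app g (app h z) = z by apply: funext2 => s w; exact: gh.
  have gK (V : ctx) (z : env M V) : app h (app g z) = z by apply: funext2 => s w; exact: hg.
  exists (y i) => y'; split; last exact: hy.
  rewrite -{1}(hK _ y') -{1}gc -!app_ejoin sat_aut // hy; split=> [e1|->].
    by rewrite -(hK _ y') e1.
  by rewrite -{1}gyi gK.
have [Gam [fG hGam]] := def_graph Mm (fin_vars eo) se (sm_pre Mm sY n) sd hfix.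
have [th1 [G1 h1]] := Good_pow Mm sC sI (leqnn n) (fun i _ => hG (@rb i)).
have [th2 [G2 h2]] := Good_image Mm (fin_vars eo) (fin_cprod n (fin_vars to)) sd (fun w => @fG w d) G1.
pose P m := exists th : form (vsum (vars eo) (vsum A (cprod 'I_m W))),
  Good K th (ejoin bA (pre c m)) /\ sat th (ejoin te (ejoin bA (pre c m))).
have Pn : P n.
  exists th2; split=> //; apply/h2; exists yb; last exact/hGam.
  by apply/h1 => i; apply: (hF (rb i)); exact/hy.
have down m : P m -> P 0.
  elim: m => [//|m IH] [th [G ht]]; apply: IH.
  pose r s (v : vsum (vars eo) (vsum A (cprod 'I_m.+1 W)) s) : vsum (vars eo) (vsum (vsum A (cprod 'I_m W)) W) s :=
    match v with inl z => inl z | inr (inl c) => inr (inl (inl c))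
    | inr (inr (i, w)) => match ltnP i m with
       LtnNotGeq h => inr (inl (inr (Ordinal h, w))) | GeqNotLtn _ => inr (inr w) end end.
  have rE z : sat (rename r th) (ejoin z (ejoin (ejoin bA (pre c m)) (c m))) = sat th (ejoin z (ejoin bA (pre c m.+1))).
    rewrite sat_rename; congr sat; apply: funext2 => s [//|[//|[i w]]] /=; case: ltnP => // h.
    have en : val i = m by apply/eqP; rewrite eqn_leq h -ltnS ltn_ord.
    by rewrite /pre /= en.
  have [|||||th' [G' h']] := descent Mm sC sI p0dom p0over dq (V0 := cprod 'I_m W) (E := vars eo) (x := pre c m) (e0 := te) (a := c m) (chi := rename r th).
  - exact: (sm_pre Mm sW).
  - by [].
  - apply: (real_sub (rho := fun s (v : vsum (cprod 'I_m W) (vars eo) s) => match v with inl p => inr (inr p) | inr z => inr (inl (inr z)) end) gq (@rc m)).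
    by move=> s [].
  - move=> V phi sV; have [l nl] := G V phi sV; exists l => -[x [z [h3 h4]]]; apply: nl.
    by exists x, z; split=> // i hi; rewrite /mkset -rE; exact: h3.
  - by rewrite rE.
  - by exists th'.
have [th [G ht]] := down n Pn.
pose r s (v : vsum (vars eo) (vsum A (cprod 'I_0 W)) s) : vsum (vars eo) A s :=
  match v with inl z => inl z | inr (inl c) => inr c
  | inr (inr (i, _)) => match i with Ordinal _ h => False_rect _ (Bool.diff_false_true h) end end.
have rE z : sat (rename r th) (ejoin z bA) = sat th (ejoin z (ejoin bA (pre c 0))).
  by rewrite sat_rename; congr sat; apply: funext2 => s [//|[//|[[]]]].
apply: (Good_acl Mm sC se (th := rename r th)); last by rewrite rE.
move=> V phi sV; have [l nl] := G V phi sV; exists l => -[x [z [h3 h4]]]; apply: nl.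
by exists x, z; split=> // i hi; rewrite /mkset -rE; exact: h3.
Qed.

End GoodCode.

(** * Finite orders as a first-order condition *)

Section OrderFormula.
Variable L : language.
Notation ctx := (lsort L -> Type).

(** This lets goodness pass between [U] and [N] and between points of the same type. *)
Lemma ord_form (W V D : ctx) (phi : form (vsum W V)) (th : form (vsum W D)) (k : nat) :
  fin W -> fin V -> exists om : form D, forall (M : structure L) (d : env M D),
    sat om d <-> ord phi [set x | sat th (ejoin x d)] k.
Proof.
move=> fW fV.
pose X : ctx := vsum (vsum D (cprod 'I_k.+1 W)) (cprod 'I_k.+1 V).
(* The extra index makes [inord] available for [k = 0]. *)
pose o i : 'I_k.+1 := inord i.
pose r1 i s (v : vsum W D s) : X s := match v with inl w => inl (inr (o i, w)) | inr c => inl (inl c) end.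
pose r2 i j s (v : vsum W V s) : X s := match v with inl w => inl (inr (o i, w)) | inr v => inr (o j, v) end.
pose f1 := FConj (map (fun i => rename (r1 i) th) (seq.iota 0 k)).
pose f2 := FConj (map (fun p => FIff (rename (r2 p.1 p.2) phi) (if (p.1 < p.2)%N then FTrue _ else FBot _))
   (flatten (map (fun i => map (fun j => (i, j)) (seq.iota 0 k)) (seq.iota 0 k)))).
exists (FEx (fin_cprod _ fW) (FEx (fin_cprod _ fV) (FAnd f1 f2))) => M d.
have E1 (x : env M (cprod 'I_k.+1 W)) (y : env M (cprod 'I_k.+1 V)) :
    sat f1 (ejoin (ejoin d x) y) <-> forall i, (i < k)%N -> sat th (ejoin (fun s w => x s (o i, w)) d).
  rewrite sat_conj.
  have e i : sat (rename (r1 i) th) (ejoin (ejoin d x) y) = sat th (ejoin (fun s w => x s (o i, w)) d).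
    by rewrite sat_rename; congr sat; apply: funext2 => s [].
  split=> [h i hi|h psi hp].
    by rewrite -e; apply: h; apply: (in_map_List (fun i => rename (r1 i) th)); apply/List_in; rewrite mem_iota.
  by have [i /List_in] := map_in_List hp; rewrite mem_iota => /andP[_ hi] <-; rewrite e; exact: h.
have E2 (x : env M (cprod 'I_k.+1 W)) (y : env M (cprod 'I_k.+1 V)) :
    sat f2 (ejoin (ejoin d x) y) <-> forall i j, (i < k)%N -> (j < k)%N ->
      (sat phi (ejoin (fun s w => x s (o i, w)) (fun s w => y s (o j, w))) <-> (i < j)%N).
  rewrite sat_conj.
  have e i j : sat (FIff (rename (r2 i j) phi) (if (i < j)%N then FTrue _ else FBot _)) (ejoin (ejoin d x) y) <->
     (sat phi (ejoin (fun s w => x s (o i, w)) (fun s w => y s (o j, w))) <-> (i < j)%N).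
    rewrite sat_iff sat_rename.
    have -> : (fun s v => ejoin (ejoin d x) y (r2 i j s v)) = ejoin (fun s w => x s (o i, w)) (fun s w => y s (o j, w)).
      by apply: funext2 => s [].
    suff -> : sat (if (i < j)%N then FTrue X else FBot X) (ejoin (ejoin d x) y) = (i < j)%N :> Prop by [].
    by apply/propext; case: ifP => _; rewrite ?sat_true.
  split=> [h i j hi hj|h psi hp].
    apply/e; apply: h; apply: (in_map_List (fun p => FIff (rename (r2 p.1 p.2) phi) (if (p.1 < p.2)%N then FTrue _ else FBot _)) (x := (i, j))).
    by apply/List_in/flatten_mapP; exists i; [rewrite mem_iota|apply: map_f; rewrite mem_iota].
  have [p /List_in/flatten_mapP[i hi /mapP[j hj ->]] <-] := map_in_List hp.
  by apply/e; apply: h; [move: hi|move: hj]; rewrite mem_iota.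
rewrite sat_ex; split=> [[x]|[x [y [hx hxy]]]].
  rewrite sat_ex => -[y]; rewrite sat_and E1 E2 => -[h1 h2].
  by exists (fun i s w => x s (o i, w)), (fun j s w => y s (o j, w)).
have vo i : (i < k)%N -> o i = i :> nat by move=> hi; rewrite /o inordK // ltnS ltnW.
exists (fun s (p : cprod 'I_k.+1 W s) => x p.1 s p.2); rewrite sat_ex.
exists (fun s (p : cprod 'I_k.+1 V s) => y p.1 s p.2).
rewrite sat_and E1 E2; split=> [i hi|i j hi hj] /=; first by rewrite vo //; exact: hx.
by rewrite !vo //; exact: hxy.
Qed.

End OrderFormula.

Lemma GoodS_fin (K : Type) (L : language) (M : structure L) (W : lsort L -> Type) (X : set (env M W)) :
  (forall n (zo : 'I_n -> lsort L) (phi : form (vsum W (vars zo))), exists k, ~ ord phi X k) ->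
  GoodS K X.
Proof.
move=> h V phi sV; have [n [zo [phi' [r ->]]]] := fsupp phi.
have [k nk] := h n zo phi'; exists k => -[x [y [hx hxy]]]; apply: nk.
exists x, (fun j s v => y j s (r s v)); split=> // i j hi hj; rewrite -hxy // sat_rename.
suff -> : (fun s v => ejoin (x i) (y j) (sum_map (fun s v => v) r v)) = ejoin (x i) (fun s v => y j s (r s v)) by [].
by apply: funext2 => s [].
Qed.

Lemma Good_transfer (K K' : Type) (L : language) (M N : structure L) (j : forall s, M s -> N s)
    (W D : lsort L -> Type) (th : form (vsum W D)) (d : env M D) :
  monster K M -> elementary j -> fin W -> Good K th d -> Good K' th (fun s v => j s (d s v)).
Proof.
move=> Mm je fW G; apply: GoodS_fin => n zo phi.
have [k nk] := G _ phi (smV_fin Mm zo); exists k.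
have [om hom] := ord_form phi th k fW (fin_vars zo).
by move=> /hom/je/hom.
Qed.

(** * Good sets are stable and stably embedded *)

Section Pair.
Variables (K K' : Type) (L : language) (M N : structure L).
Hypotheses (Mm : monster K M) (Nm : monster K' N).
Variable j : forall s, M s -> N s.
Hypothesis jelem : elementary j.
Hypothesis Msmall : small K' [set: elt M].
Notation ctx := (lsort L -> Type).
Variables (C : set (elt M)) (sC : small K C).
Notation pC := (penv (A := C)).
Variables (s0 : lsort L) (th : form (vsum (vars (single s0)) (par C))).
Hypothesis Gth : Good K th pC.

Lemma over_th : Defs.over C (rename (@forget_par _ _ _ C) th).
Proof. by exists th. Qed.

Let X : dset C := DSet over_th.

Lemma dmemX m : dmem (X := X) m = sat th (ejoin (tenv (tup1 m)) pC).
Proof. by rewrite /dmem lsat_tup1. Qed.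

Lemma Good_stable : stable_dset X.
Proof.
move=> n m so to phi; have [psi hpsi] := translate phi.
pose Xs := fun _ : unit => X.
pose W : ctx := vars (fun _ : 'I_n => s0).
pose V : ctx := vsum (vars (fun _ : 'I_m => s0)) (par C).
pose r s (x : vsum (vtr Xs (vsum (vars so) (vars to))) (par C) s) : vsum W V s := match x with
  | inl x => match x in vtr _ _ s return vsum W V s with VT i v => match v with
     inl v => match v in vars _ i return vsum W V s0 with Var l => inl (Var l) end
   | inr v => match v in vars _ i return vsum W V s0 with Var l => inr (inl (Var l)) end end end
  | inr c => inr (inr c) end.
have sV : smV K V by apply: (smV_vsum Mm); [exact: (smV_fin Mm)|exact: smV_par].
have GW := Good_tup Mm (smV_par sC) (fun _ : 'I_n => Gth).
have [k nk] := GW V (rename r psi) sV.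
move=> /(_ k.+1)[x [y hxy]]; apply: nk.
exists (fun i => tenv (fun l => sval (x (inord i) l))), (fun i => ejoin (tenv (fun l => sval (y (inord i) l))) pC).
split=> [i hi|i i' hi hi'].
  rewrite /mkset sat_thtup => l /=; rewrite -dmemX; exact: (proj2_sig (x (inord i) l)).
have := hxy (inord i) (inord i'); rewrite !inordK ?ltnS ?(ltnW hi) ?(ltnW hi') // /sat2 hpsi => <-.
rewrite sat_rename; suff -> : (fun s v => ejoin (tenv (fun l => sval (x (inord i) l))) (ejoin (tenv (fun l => sval (y (inord i') l))) pC) (r s v)) =
  ejoin (vale (ejoin (tenv (x (inord i))) (tenv (y (inord i'))))) pC by [].
by apply: funext2 => s [[i0 [[l]|[l]]]|c].
Qed.

Section Power.
Variable n : nat.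
Notation W := (vars (fun _ : 'I_n => s0)).
Notation thn := (thtup (fun _ : 'I_n => th)).
(** [E] contains every point of the set in [M] and need not be small for [K]. Its image is small for
    [K'], so the saturation of [N] is the one that applies. *)
Let E : set (elt M) := C `|` dset_elts X.
Let b0 : env N (par E) := fun s c => j (sval c).
Let jC : env N (par C) := fun s c => j (sval c).
Let toE s (c : par C s) : par E s := mkpar (or_introl (proj2_sig c) : E (existT M s (sval c))).
Let sE : smV K' (par E).
Proof. by apply: smV_par; apply: small_sub Msmall. Qed.
Let sW : smV K' W. Proof. exact: (smV_fin Nm). Qed.

Let GN : Good K' thn jC.
Proof.
have G := Good_tup Mm (smV_par sC) (fun _ : 'I_n => Gth).
exact: (Good_transfer (K' := K') Mm jelem (fin_vars _) G).
Qed.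

(** Conjunction with the good set makes every formula stable, so commutation and uniqueness on that
    set follow from the results for stable formulas alone. *)
Definition conc (V : ctx) (phi : form (vsum W (vsum (par E) V))) : form (vsum W (vsum (par E) V)) :=
  FAnd (rename (sum_map (fun s v => v) (fun s c => inl (toE c))) thn) phi.

Lemma conc_sat (V : ctx) (phi : form (vsum W (vsum (par E) V))) x v :
  sat (conc phi) (ejoin x (ejoin b0 v)) <-> sat thn (ejoin x jC) /\ sat phi (ejoin x (ejoin b0 v)).
Proof.
rewrite sat_and sat_rename.
suff -> : (fun s w => ejoin x (ejoin b0 v) (sum_map (fun s v => v) (fun s c => inl (toE c)) w)) = ejoin x jC by [].
by apply: funext2 => s [].
Qed.

Lemma conc_stf (V : ctx) (phi : form (vsum W (vsum (par E) V))) : smV K' V -> stable_for b0 (conc phi).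
Proof.
move=> sV; have [k nk] := GN phi (smV_vsum Nm sE sV); exists k.+1 => -[x [y [_ hxy]]]; apply: nk.
have hx i : (i < k)%N -> sat thn (ejoin (x i) jC).
  move=> hi; have /conc_sat[//] : sat (conc phi) (ejoin (x i) (ejoin b0 (y k))).
  by apply/hxy => //; exact: ltnW.
exists x, (fun i => ejoin b0 (y i)); split=> // i i' hi hi'.
rewrite -(hxy i i' (ltnW hi) (ltnW hi')) conc_sat.
by split=> [h|[]//]; split=> //; exact: hx.
Qed.

Lemma conc_comm t1 t2 : gtp t1 -> gtp t2 -> inv b0 t1 -> inv b0 t2 ->
  Q t1 thn jC -> comm K' b0 t1 t2.
Proof.
move=> g1 g2 i1 i2 c1 V e a a' sV ra ra' phi hq.
have sVW := smV_vsum Nm sV sW.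
have [a0 r0] := real_ex Nm b0 sE sW (ejoin e a') g1 sVW.
have ha0 : sat thn (ejoin a0 jC).
  by apply/(real_at (rho := fun s c => inl (toE c)) _ g1 r0).
have st := conc_stf phi sVW.
have := commute Nm sW sE g1 g2 i1 i2 sV st ra ra' r0; rewrite !conc_sat => h.
by have [_] := h.2 (conj ha0 (r0 _ hq)).
Qed.

(** A coheir of the type of [y], obtained from an ultrafilter on the small model. *)
Lemma fs_type (y : env N W) (h : env N M) : sat thn (ejoin y jC) ->
  (forall s (c : par E s), h s (sval c) = b0 c) ->
  (forall psi : lform M W, sat psi (ejoin y h) ->
     exists2 u : env M W, sat thn (ejoin u pC) & sat psi (ejoin (fun s v => j (u s v)) h)) ->
  exists t, [/\ gtp t, inv b0 t, Q t thn jC & forall psi : lform M W, Q t psi h <-> sat psi (ejoin y h)].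
Proof.
move=> hy hb fs.
pose T := {u : env M W | sat thn (ejoin u pC)}.
pose c (u : T) : env N W := fun s v => j (sval u s v).
pose F : set_system T := [set S | exists2 psi : lform M W, sat psi (ejoin y h) &
   forall u, sat psi (ejoin (c u) h) -> S u].
have PF : ProperFilter F.
  split.
    move=> [psi h1 h2]; have [u hu hs] := fs psi h1; exact: (h2 (exist _ u hu) hs).
  split.
  - by exists (FTrue _) => //; rewrite sat_true.
  - move=> P P' [psi h1 h2] [psi' h1' h2']; exists (FAnd psi psi'); first by rewrite sat_and.
    by move=> u; rewrite sat_and => -[/h2 ? /h2'].
  - by move=> P P' PP [psi h1 h2]; exists psi => // u /h2/PP.
have [D [UD hD]] := ultraFilterLemma PF.
exists (tlim c D); split.
- exact: tlim_gtp.
- apply: tlim_inv => g gb [u hu]; apply: funext2 => s [l] /=; rewrite /app /c /=.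
  have hE : E (existT M s0 (u _ (Var l))).
    right; exists (u _ (Var l)) => //; rewrite dmemX.
    by move: hu; rewrite sat_thtup => /(_ l).
  exact: (congr1 (fun f : env N (par E) => f s0 (mkpar hE)) gb).
- apply/Q_tlim; apply: filterS filterT => -[u hu] _ /=.
  have /jelem := hu; congr sat; by apply: funext2 => s [].
- have H psi : sat psi (ejoin y h) -> Q (tlim c D) psi h.
    by move=> hs; apply/Q_tlim; apply: hD; exists psi.
  move=> psi; split; last exact: H.
  move=> hq; apply: contrapT => /(H (FNot psi)).
  by move/(Q_not (tlim_gtp c UD)).
Qed.

(** All parameters come from the small model, so by elementarity the existence of [y] is witnessed
    there. *)
Lemma fs_self (y : env N W) (psi : lform M W) : sat thn (ejoin y jC) -> sat psi (ejoin y j) ->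
  exists2 u : env M W, sat thn (ejoin u pC) & sat psi (ejoin (fun s v => j (u s v)) j).
Proof.
move=> hy hp.
pose r1 s (v : vsum W (par C) s) : vsum M W s := match v with inl w => inr w | inr c => inl (sval c) end.
pose r2 s (v : vsum W M s) : vsum M W s := match v with inl w => inr w | inr c => inl c end.
pose om := FEx (fin_vars (fun _ : 'I_n => s0)) (FAnd (rename r1 thn) (rename r2 psi)).
have E1 (N' : structure L) (h : env N' M) x : sat (FAnd (rename r1 thn) (rename r2 psi)) (ejoin h x) <->
    sat thn (ejoin x (fun s (c : par C s) => h s (sval c))) /\ sat psi (ejoin x h).
  rewrite sat_and !sat_rename.
  have -> : (fun s v => ejoin h x (r1 s v)) = ejoin x (fun s (c : par C s) => h s (sval c)) by apply: funext2 => s [].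
  by have -> : (fun s v => ejoin h x (r2 s v)) = ejoin x h by apply: funext2 => s [].
have : sat om (fun s v => j (@pid _ M s v)) by rewrite sat_ex; exists y; apply/E1.
move=> /jelem; rewrite sat_ex => -[u /E1[h1 h2]]; exists u; first exact: h1.
move: h2 => /jelem; congr sat; by apply: funext2 => s [].
Qed.

(** The coheirs of the types of [y] over the small model and over its image under
    [g] agree on the base; formulas being stable on the good set, they are equal
    there. *)
Lemma trace_inv m (zo : 'I_m -> lsort L) (phi : form (vsum W (vars zo))) (d : env M (vars zo)) g (y : env N W) :
  automorphism g -> app g b0 = b0 -> sat thn (ejoin y jC) ->
  sat phi (ejoin y (fun s v => j (d s v))) <-> sat phi (ejoin y (fun s v => g s (j (d s v)))).
Proof.
move=> ga gb hy; have [h [ha hg gh]] := aut_inv ga.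
have gbE s (c : par E s) : g s (j (sval c)) = j (sval c).
  exact: (congr1 (fun f : env N (par E) => f s c) gb).
have hK (V : ctx) (z : env N V) : app g (app h z) = z by apply: funext2 => s v; exact: gh.
have gC : app g jC = jC by apply: funext2 => s c; exact: (gbE s (toE c)).
pose gj : env N M := fun s m => g s (j m).
have [t [gt it ct ht]] := fs_type hy (fun s c => erefl) (fun psi => fs_self hy (psi := psi)).
have [|t' [gt' it' ct' ht']] := @fs_type y gj hy gbE.
  move=> psi hp.
  have hy' : sat thn (ejoin (app h y) jC) by rewrite -(sat_aut _ _ ga) app_ejoin hK gC.
  have hp' : sat psi (ejoin (app h y) j) by rewrite -(sat_aut _ _ ga) app_ejoin hK.
  have [u hu hs] := fs_self hy' hp'; exists u => //.
  move: hs; rewrite -(sat_aut _ _ ga) app_ejoin; congr (sat psi (ejoin _ _)).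
  apply: funext2 => s [l]; apply: (gbE _ (mkpar (_ : E (existT M s0 (u _ (Var l)))))).
  right; exists (u _ (Var l)) => //; rewrite dmemX.
  by move: hu; rewrite sat_thtup => /(_ l).
have sZ : smV K' (vars zo) by exact: (smV_fin Nm).
have ab0 (psi : form (vsum W (par E))) : Q t psi b0 <-> Q t' psi b0.
  pose psi' : lform M W := rename (sum_map (fun s v => v) (fun s (c : par E s) => sval c)) psi.
  have := ht psi'; have := ht' psi'; rewrite !Q_rename !sat_rename.
  have -> : (fun s (c : par E s) => gj s (sval c)) = b0 by apply: funext2 => s c; exact: gbE.
  have -> : (fun s v => ejoin y j (sum_map (fun s v => v) (fun s (c : par E s) => sval c) v)) = ejoin y b0.
    by apply: funext2 => s [].
  have -> : (fun s v => ejoin y gj (sum_map (fun s v => v) (fun s (c : par E s) => sval c) v)) = ejoin y b0.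
    by apply: funext2 => s [//|c]; exact: gbE.
  by move=> -> ->.
pose jd : env N (vars zo) := fun s v => j (d s v).
pose phi1 : form (vsum W (vsum (par E) (vars zo))) := rename (sum_map (fun s v => v) (fun s v => inr v)) phi.
have tE t0 v : gtp t0 -> Q t0 thn jC -> Q t0 (conc phi1) (ejoin b0 v) <-> Q t0 phi v.
  move=> g0 c0.
  have E1 x : sat phi1 (ejoin x (ejoin b0 v)) = sat phi (ejoin x v).
    by rewrite sat_rename; congr sat; apply: funext2 => s [].
  split; first by apply: (Q_mono g0) => x; rewrite conc_sat E1 => -[].
  by move=> h0; apply: (Q_mono2 g0 _ c0 h0) => x h1 h2; rewrite conc_sat E1.
have st := conc_stf phi1 sZ.
have tt' : Q t phi jd <-> Q t' phi jd.
  rewrite -(tE t) // -(tE t') //; split.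
    by apply: (inv_unique Nm sW sE gt gt' it) => //; apply: conc_comm.
  by apply: (inv_unique Nm sW sE gt' gt it') => // [||psi]; [apply: conc_comm|apply: conc_comm|rewrite ab0].
pose phi' : lform M W := rename (sum_map (fun s v => v) d) phi.
have := ht phi'; have := ht' phi'; rewrite !Q_rename !sat_rename.
have -> : (fun s v => ejoin y j (sum_map (fun s v => v) d v)) = ejoin y jd by apply: funext2 => s [].
have -> : (fun s v => ejoin y gj (sum_map (fun s v => v) d v)) = ejoin y (fun s v => g s (jd s v)) by apply: funext2 => s [].
move=> <- <-; rewrite -[X in Q t phi X]/jd tt'.
exact: iff_sym (Q_aut _ jd it' ga gb).
Qed.

(** By [trace_inv] the trace in [N] is invariant over [E]. [invdef] applied in [N] defines it over
    [E], and elementarity brings the formula back to [M]. *)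
Lemma trace_def m (zo : 'I_m -> lsort L) (phi : form (vsum W (vars zo))) (d : env M (vars zo)) :
  exists psi : form (vsum W (par E)), forall x : env M W, sat thn (ejoin x pC) ->
    sat psi (ejoin x (penv (A := E))) <-> sat phi (ejoin x d).
Proof.
pose jd : env N (vars zo) := fun s v => j (d s v).
pose r1 s (v : vsum W (par C) s) : vsum W (vsum (par C) (vars zo)) s := match v with inl w => inl w | inr c => inr (inl c) end.
pose r2 s (v : vsum W (vars zo) s) : vsum W (vsum (par C) (vars zo)) s := match v with inl w => inl w | inr c => inr (inr c) end.
pose Th := FAnd (rename r1 thn) (rename r2 phi).
have ThE (N' : structure L) x (c : env N' (par C)) (d' : env N' (vars zo)) :
    sat Th (ejoin x (ejoin c d')) <-> sat thn (ejoin x c) /\ sat phi (ejoin x d').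
  rewrite sat_and !sat_rename.
  have -> : (fun s v => ejoin x (ejoin c d') (r1 s v)) = ejoin x c by apply: funext2 => s [].
  by have -> : (fun s v => ejoin x (ejoin c d') (r2 s v)) = ejoin x d' by apply: funext2 => s [].
have [||psi hpsi] := @invdef _ _ _ Nm _ _ _ b0 (ejoin jC jd) Th sE sW.
- apply: (smV_vsum Nm); last exact: (smV_fin Nm).
  by apply: smV_par; exact: small_sub Msmall.
- move=> g ga gb y /ThE[h1 h2].
  have gC : app g jC = jC.
    by apply: funext2 => s c; exact: (congr1 (fun f : env N (par E) => f s (toE c)) gb).
  have h3 : sat thn (ejoin (app g y) jC) by rewrite -gC -app_ejoin sat_aut.
  apply/ThE; split=> //; apply/(trace_inv phi d ga gb h3).
  by rewrite (_ : ejoin _ _ = app g (ejoin y jd)) ?sat_aut // app_ejoin.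
exists psi => x hx; rewrite jelem.
have -> : (fun s v => j (ejoin x (penv (A := E)) v)) = ejoin (fun s v => j (x s v)) b0 by apply: funext2 => s [].
rewrite hpsi ThE.
have e1 : sat thn (ejoin (fun s v => j (x s v)) jC).
  by have /jelem := hx; congr sat; apply: funext2 => s [].
have e2 : sat phi (ejoin (fun s v => j (x s v)) jd) <-> sat phi (ejoin x d).
  rewrite [X in _ <-> X]jelem; suff -> : (fun s v => j (ejoin x d v)) = ejoin (fun s v => j (x s v)) jd by [].
  by apply: funext2 => s [].
by rewrite e2; split=> [[]|].
Qed.

End Power.

Lemma Good_embedded : stably_embedded X.
Proof.
move=> n phi; have [m [zo [phi' [d ->]]]] := fsupp phi.
have [psi hpsi] := @trace_def n m zo phi' d.
exists (rename (@forget_par _ _ _ _) psi); first by exists psi.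
move=> x hx; rewrite /lsat sat_over hpsi; last first.
  by rewrite sat_thtup => i; rewrite -dmemX; exact: hx.
rewrite sat_rename; suff -> : (fun s v => ejoin (tenv x) (fun s m => m) (sum_map (fun s v => v) d v)) = ejoin (tenv x) d by [].
by apply: funext2 => s [].
Qed.

Lemma Good_St m : sat th (ejoin (tenv (tup1 m)) pC) -> St C (existT M s0 m).
Proof.
rewrite -dmemX => hm.
by exists (existT (St_structure C) (exist _ X (conj Good_stable Good_embedded)) (exist _ m hm)).
Qed.

End Pair.

(** Coordinate projections of a good set are good by [Good_image], which reduces the tuple to single
    elements. *)
Lemma Good_tuple_St (K K' : Type) (L : language) (M N : structure L) (j : forall s, M s -> N s)
   (C : set (elt M)) n (so : 'I_n -> lsort L) (th : form (vsum (vars so) (par C))) (e : tup M so) :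
  monster K M -> monster K' N -> elementary j -> small K' [set: elt M] -> small K C ->
  Good K th (penv (A := C)) -> sat th (ejoin (tenv e) (penv (A := C))) -> trange e `<=` St C.
Proof.
move=> Mm Nm je sM sC G he _ [i _ <-].
pose Gam : form (vsum (vars (single (so i))) (vsum (vars so) (par C))) :=
  FEq (TVar (inl (Var tt))) (TVar (inr (inl (Var i)))).
have f1 : fin (vars (single (so i))) by exists [:: existT _ _ (Var tt)] => s [[]]; left.
have fG (w : env M (vars so)) (z z' : env M (vars (single (so i)))) :
    sat Gam (ejoin z (ejoin w (penv (A := C)))) -> sat Gam (ejoin z' (ejoin w (penv (A := C)))) -> z = z'.
  by rewrite /= => e1 e2; apply: funext2 => s [[]] /=; rewrite e1 e2.
have [th' [G' h']] := Good_image Mm f1 (fin_vars so) (smV_par sC) fG G.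
apply: (Good_St Mm Nm je sM sC G'); apply/h'.
by exists (tenv e).
Qed.

(** * Global types realised in the larger model *)

Lemma over_setT (L : language) (M : structure L) (V : lsort L -> Type) (phi : lform M V) :
  Defs.over setT phi.
Proof.
exists (rename (sum_map (fun s v => v) (fun s m => mkpar (I : setT (existT M s m)))) phi) => //.
by rewrite rename_comp -[RHS]rename_id; congr (rename _ phi); apply: funext2 => s [].
Qed.

Lemma complete_gtp (L : language) (M : structure L) (I : Type) (so : I -> lsort L)
    (q : set (lform M (vars so))) : complete_type setT q -> gtp q.
Proof.
move=> [_ fs tot]; split=> [phi|l hl]; first exact/tot/over_setT.
have [|a ha] := fs (size l) (tnth (in_tuple l)).
  by move=> i; apply: hl; apply/List_tnth; exists i.
by exists (tenv a) => phi /List_tnth[i <-]; exact: ha.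
Qed.

Lemma automorphism_overE (L : language) (M : structure L) (A : set (elt M)) g :
  automorphism_over A g <-> automorphism g /\ app g (penv (A := A)) = penv (A := A).
Proof. by split=> -[ga /app_penv]. Qed.

Section SmallRange.
Variables (K K' : Type) (L : language) (M N : structure L).
Hypothesis Mm : monster K M.
Variable j : forall s, M s -> N s.
Hypothesis jelem : elementary j.
Hypothesis Msmall : small K' [set: elt M].

(** If the monster model [M] has fewer than [K] elements, saturation makes it
    finite in every sort. *)
Lemma small_monster_onto s (x : N s) : small K [set: elt M] -> exists m, j m = x.
Proof.
move=> sM; pose p : set (lform M (vars (single s))) :=
  [set phi | exists m : M s, phi = FNot (FEq (TVar (inl (Var tt))) (TVar (inr m)))].
have np : ~ finitely_satisfiable p.
  move=> fs; have [|a ha] := monster_saturated Mm sM (p := p) _ fs.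
    by move=> phi _; exact: over_setT.
  by have := ha _ (ex_intro _ (a tt) erefl); exact.
have [n [ms hms]] : exists n (ms : 'I_n -> M s), forall m, exists i, m = ms i.
  apply: contrapT => nf; apply: np => n phi hphi.
  have ms i := cid (hphi i).
  apply: contrapT => na; apply: nf; exists n, (fun i => sval (ms i)) => m.
  apply: contrapT => nm; apply: na; exists (tup1 m) => i.
  rewrite (proj2_sig (ms i)) => /= e; apply: nm; by exists i.
pose om : form (ext M s) := FDisj (map (fun i : 'I_n => FEq (TVar New) (TVar (Old (ms i)))) (enum 'I_n)).
have /jelem h : sat (FAll om) (@pid _ M).
  move=> m; have [i hi] := hms m; rewrite sat_disj.
  exists (FEq (TVar New) (TVar (Old (ms i)))) => //.
  by apply: (in_map_List (fun i => FEq (TVar New) (TVar (Old (ms i))))); apply/List_in; rewrite mem_enum.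
have : sat om (econs (fun s v => j v) x) := h x.
rewrite sat_disj => -[psi hp].
by have [i _ <-] := map_in_List hp => /= e; exists (ms i).
Qed.

Lemma small_jelt (C : set (elt M)) : small K' (jelt j @` C).
Proof.
apply/smallE; apply: sml_le ((smallT _ _).1 Msmall).
exists (fun u : {u | (jelt j @` C) u} => s2val (cid2 (proj2_sig u))).
move=> [u hu] [v hv] /=; case: cid2 => x /= _ ex; case: cid2 => y /= _ ey exy; subst y.
by subst u v; rewrite (Prop_irrelevance hu hv).
Qed.

(** [K] and [K'] are compared only through [elt M]. If [elt M] is not small for [K], then [I]
    injects into it by comparability; otherwise every element of [N] comes from [M]. *)
Lemma small_trange_ext (I : Type) (so : I -> lsort L) (a : tup N so) :
  small K [set: I] -> small K' (trange a).
Proof.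
move=> sI; case: (pselect (small K [set: elt M])) => [sM|nM].
  apply: small_sub (small_jelt setT) => _ [i _ <-].
  have [m hm] := small_monster_onto (a i) sM.
  by exists (existT M _ m) => //; rewrite /jelt /= hm.
have sI' : sml K' I.
  apply: sml_le ((smallT _ _).1 Msmall).
  have /smallT[IK nKI] := sI.
  case: (lec_total I (elt M)) => // h; exfalso; apply: nM.
  by apply/smallT; exact: sml_le h ((smallT _ _).1 sI).
apply: small_sub (small_erange (K := K') (tenv a) (smV_vars so sI')) => u [i _ <-] /=.
by exists (Var i).
Qed.

End SmallRange.

Section Realised.
Variables (L : language) (M N : structure L) (j : forall s, M s -> N s).
Variables (I : Type) (so : I -> lsort L) (q : set (lform M (vars so))) (a : tup N so).
Hypotheses (gq : gtp q) (aq : realizes_in j q a).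

Lemma realized_Q (V : lsort L -> Type) (phi : form (vsum (vars so) V)) (v : env M V) :
  Q q phi v <-> sat phi (ejoin (tenv a) (fun s x => j (v s x))).
Proof.
have H (psi : form (vsum (vars so) V)) : Q q psi v -> sat psi (ejoin (tenv a) (fun s x => j (v s x))).
  move=> /aq; rewrite sat_rename; congr sat; by apply: funext2 => s [].
split; first exact: H.
by move=> h; apply: contrapT => /(Q_not gq)/H; rewrite sat_not.
Qed.

End Realised.

Theorem theorem6p3
  (L : language) (T : set (sentence L))
  (Tcomplete : complete_theory T) (TEI : eliminates_imaginaries T)
  (* the monster model U, and a larger monster model N in which the
     realisations of global types live *)
  (K : Type) (U : structure L) (UT : models U T) (Umonster : monster K U)
  (K' : Type) (N : structure L) (Nmonster : monster K' N)
  (j : forall s, U s -> N s) (jelem : elementary j)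
  (Usmall : small K' [set: elt U])
  (C : set (elt U)) (Csmall : small K C)
  (I : Type) (so : I -> lsort L) (Ismall : small K [set: I])
  (p0 p q : set (lform U (vars so)))
  (p0type : complete_type C p0) (p0dom : stably_dominated C K p0)
  (ptype : complete_type (acl C) p) (p0p : p0 `<=` p)
  (* q is p|U *)
  (qtype : complete_type setT q) (pq : p `<=` q)
  (qinv : invariant_over (acl C) q)
  (* the definable function f = f_b *)
  (n m : nat) (to : 'I_n -> lsort L) (zo : 'I_m -> lsort L)
  (F : form (vsum (vars so) (vsum (vars to) (vars zo)))) (b : tup U zo)
  (Ffun : functional F b)
  (Fdom : forall x : tup N so, realizes_in j q x ->
            exists y : tup N to, sat3 F x y (jtup j b))
  (a : tup N so) (aq : realizes_in j q a) :
  let Ca := (jelt j @` C) `|` trange a in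
  let C'' := acl C `&` (jelt j @^-1` dcl Ca) in
  ((exists (k : nat) (eo : 'I_k -> lsort L) (e : tup U eo),
      germ_code F C'' q b e) /\
   (forall (k : nat) (eo : 'I_k -> lsort L) (e : tup U eo),
      germ_code F C'' q b e -> strong_over F C'' q b e)) /\
  ((forall y : tup N to, sat3 F a y (jtup j b) -> trange y `<=` St Ca) ->
   forall (k : nat) (eo : 'I_k -> lsort L) (e : tup U eo),
     germ_code F C'' q b e -> trange e `<=` St C).
Proof.
move=> Ca C2.
have sI := Ismall; have sC := Csmall.
pose Z := vars zo; pose Y := vars to; pose W := vars so.
pose tb : env U Z := tenv b.
have gq : gtp q := complete_gtp qtype.
have iq : inv (penv (A := acl C)) q.
  by move=> g ga gA phi; apply: qinv; apply/automorphism_overE.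
have p0over : p0 `<=` Defs.over C by case: p0type.
have dq : dext C p0 q by split=> //; exact: subset_trans pq.
have sA : smV K (par (acl C)) by exact/smV_par/(acl_small Umonster).
have sW : smV K W by exact/smV_vars/smallT.
have sZ : smV K Z by exact: (smV_fin Umonster).
have sY : smV K Y by exact: (smV_fin Umonster).
have CC2 : C `<=` C2.
  move=> u hu; split; first exact: sub_acl.
  have hCa : Ca (jelt j u) by left; exists u.
  pose phi : form (vsum (vars (single (projT1 (jelt j u)))) (par Ca)) :=
    FEq (TVar (inl (Var tt))) (TVar (inr (exist _ (projT2 (jelt j u)) hCa))).
  by exists (rename (@forget_par _ _ _ _) phi); first by exists phi.
have C2A : C2 `<=` acl C by move=> u [].
have inq (V : lsort L -> Type) (phi : form (vsum W V)) (v : env U V) :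
    Q q phi v <-> sat phi (ejoin (tenv a) (fun s x => j _ (v s x))) := realized_Q gq aq phi v.
have toCa (s : lsort L) (v : vsum W (par C) s) : Ca (existT N s (ejoin (tenv a) (fun s c => j _ (sval c)) v)).
  case: v => [[i]|[c hc]]; first by right; exists i.
  by left; exists (existT U s c).
(* [C''] is defined from [a] in [N], whereas [dext_inv] speaks of a generic point [a'] of [U]. It
   remains to see that an element of [acl C] definable from [C] and [a'] is definable from [C] and
   [a]. *)
have iq2 : inv (penv (A := C2)) q.
  have [a' ra'] := real_ex Umonster (penv (A := acl C)) sA sW tb gq sZ.
  move=> g ga g2; apply: (dext_inv Umonster sC sI p0dom p0over TEI UT dq (a := a')) => //.
  - by move=> phi; apply: (real_at (rho := fun s c => inl c) phi gq ra' _).1.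
  - by apply/app_penv => s c /CC2; move: s c; apply/app_penv.
  - move=> s m0 hm hfix; apply: ((app_penv C2 g).2 g2); split=> //=.
    pose w0 : env U (vars (single s)) := tenv (tup1 m0).
    have f1 : fin (vars (single s)) by exists [:: existT _ _ (Var tt)] => s' [[]]; left.
    have s1 : smV K (vars (single s)) by apply: smV_vars; exact: (sml_count (monster_uncountable Umonster)).
    have hf h : automorphism h -> app h a' = a' -> app h (penv (A := C)) = penv (A := C) -> app h w0 = w0.
      by move=> ha h1 h2; rewrite /w0 app_tup1 hfix.
    have [Gam [_ hGam]] := def_graph Umonster f1 s1 sW (smV_par sC) hf.
    pose D := vsum (par C) (vars (single s)).
    pose r1 t (v : vsum (vars (single s)) (vsum W (par C)) t) : ext (vsum W D) s t :=
      match v with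
      | inl w => match w in vars _ t return ext (vsum W D) s t with Var _ => New end
      | inr (inl w) => Old (inl w) | inr (inr c) => Old (inr (inl c)) end.
    (* [om] says that [Gam] defines exactly the given element from [x] and [C]. It holds at [a'],
       its parameters lie in [acl C], hence it is in [q] and holds at [a]. *)
    pose om : form (vsum W D) := FAll (FIff (rename r1 Gam) (FEq (TVar New) (TVar (Old (inr (inr (Var tt))))))).
    have omE (S : structure L) (x : env S W) (c : env S (par C)) (z : S s) :
        sat om (ejoin x (ejoin c (tenv (tup1 z)))) <->
        forall z', sat Gam (ejoin (tenv (tup1 z')) (ejoin x c)) <-> z' = z.
      have E z' : sat (FIff (rename r1 Gam) (FEq (TVar New) (TVar (Old (inr (inr (Var tt)))))))
         (econs (ejoin x (ejoin c (tenv (tup1 z)))) z') <->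
         (sat Gam (ejoin (tenv (tup1 z')) (ejoin x c)) <-> z' = z).
        rewrite sat_iff sat_rename.
        suff -> : (fun t v => econs (ejoin x (ejoin c (tenv (tup1 z)))) z' (r1 t v)) = ejoin (tenv (tup1 z')) (ejoin x c) by [].
        by apply: funext2 => t [[]|[]].
      by split=> h z'; apply/E; exact: h.
    have : Q q om (ejoin (penv (A := C)) w0).
      apply/(real_at (rho := fun t (v : D t) => match v with
        | inl c => inl (mkpar (sub_acl (proj2_sig c)))
        | inr v => match v in vars _ t return vsum (par (acl C)) Z t with Var _ => inl (mkpar hm) end end) om gq ra').
        by move=> t [|[[]]].
      apply/omE => z; rewrite hGam; split=> [e|->//].
      exact: (congr1 (fun f : env U (vars (single s)) => f s (Var tt)) e).
    move=> /inq.
    have -> : (fun t x => j _ (ejoin (penv (A := C)) w0 x)) = ejoin (fun t c => j _ (sval c)) (tenv (tup1 (j _ m0))) by apply: funext2 => t [|[[]]].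
    move=> /omE hz.
    pose rC t (v : vsum (vars (single s)) (vsum W (par C)) t) : vsum (vars (single s)) (par Ca) t :=
      match v with inl w => inl w | inr v => inr (mkpar (toCa _ v)) end.
    exists (rename (@forget_par _ _ _ Ca) (rename rC Gam)); first by exists (rename rC Gam).
    move=> z; rewrite lsat_tup1 sat_rename -hz.
    suff -> : (fun t v => ejoin (tenv (tup1 z)) (penv (A := Ca)) (rC t v)) =
       ejoin (tenv (tup1 z)) (ejoin (tenv a) (fun t c => j _ (sval c))) by [].
    by apply: funext2 => t [].
have fY : fin Y := fin_vars to.
have [eta etaE] := @agree_at_form _ U _ _ _ F fY.
have fF u : functional F u -> forall (x : env U W) (y y' : env U Y),
    sat F (ejoin x (ejoin y (tenv u))) -> sat F (ejoin x (ejoin y' (tenv u))) -> y = y'.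
  move=> hu x y y'; rewrite -(tenvE x) -(tenvE y) -(tenvE y') => h1 h2.
  by rewrite (hu _ _ _ h1 h2).
have agE u x : functional F u -> agree_at F x (tenv u) tb <->
    exists2 y : tup U to, sat F (ejoin x (ejoin (tenv y) (tenv u))) & sat F (ejoin x (ejoin (tenv y) tb)).
  move=> hu; split=> [[y hy]|[y h1 h2]].
    by exists (fun i => y _ (Var i)); rewrite (tenvE y); [apply/(hy y).1|apply/(hy y).2].
  exists (tenv y) => y'; split; split=> [h|->] //; exact: fF h _.
have [y0 hy0] := Fdom a aq.
pose rF s (v : vsum W (vsum Y Z) s) : vsum (vsum W Z) Y s :=
  match v with inl w => inl (inl w) | inr (inl y) => inr y | inr (inr z) => inl (inr z) end.
(* Otherwise [q] would say that [f_b] is undefined at [x], which [Fdom] refutes at [a]. *)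
have bb : Q q eta (ejoin tb tb).
  apply: contrapT => /(Q_not gq) hn.
  have : Q q (FNot (FEx fY (rename rF F))) tb.
    apply: (Q_mono gq _ hn) => x; rewrite !sat_not etaE sat_ex => h1 [y hy]; apply: h1.
    apply/(agE b) => //; exists (fun i => y _ (Var i)); rewrite (tenvE y).
      by move: hy; rewrite sat_rename; congr sat; apply: funext2 => s [|[]].
    by move: hy; rewrite sat_rename; congr sat; apply: funext2 => s [|[]].
  move/inq; rewrite sat_not sat_ex; apply; exists (tenv y0).
  move: hy0; rewrite /sat3 sat_rename; congr sat; apply: funext2 => s [//|[//|[l]]] //.
have sg u : functional F u -> same_germ F q u b <-> Q q eta (ejoin (tenv u) tb).
  move=> hu; split.
    move=> [phi hphi hE].
    have : Q q phi (@pid _ U) by rewrite /Q (_ : rename _ phi = phi) // -[RHS]rename_id; congr rename; apply: funext2 => s [].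
    apply: (Q_mono gq) => x hx; apply/etaE/agE => //.
    have /hE[y h1 h2] : lsat phi (fun i => x _ (Var i)) by rewrite /lsat tenvE.
    by rewrite -(tenvE x); exists y.
  move=> hq; exists (rename (sum_map (fun s v => v) (ejoin (tenv u) tb)) eta) => // x.
  rewrite /lsat sat_Q etaE agE //; exact: iff_refl.
(* Conjugates of [b] again define functions, so that [same_germ] and [eta] agree on them. *)
have fb g : automorphism g -> functional F (fun i => g _ (b i)).
  move=> ga x y y'; have [h [ha hg gh]] := aut_inv ga.
  have E (z : tup U to) : sat3 F x z (fun i => g _ (b i)) <-> sat3 F (fun i => h _ (x i)) (fun i => h _ (z i)) b.
    rewrite /sat3 -(sat_aut _ _ ha); suff -> : app h (ejoin (tenv x) (ejoin (tenv z) (tenv (fun i => g _ (b i))))) =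
      ejoin (tenv (fun i => h _ (x i))) (ejoin (tenv (fun i => h _ (z i))) (tenv b)) by [].
    by apply: funext2 => s [[l]|[[l]|[l]]] //=; rewrite /app /= hg.
  move=> /E h1 /E h2; have e := Ffun _ _ _ h1 h2.
  apply: functional_extensionality_dep => i.
  by rewrite -[LHS]gh (congr1 (fun z : tup U to => z i) e) gh.
have appb (g : forall s, U s -> U s) : tenv (fun i => g _ (b i)) = app g tb by apply: funext2 => s [l].
have gc k (eo : 'I_k -> lsort L) (e : tup U eo) : germ_code F C2 q b e <->
    forall g, automorphism g -> app g (penv (A := C2)) = penv (A := C2) ->
      ((forall i, g _ (e i) = e i) <-> Q q eta (ejoin (app g tb) tb)).
  split=> h g.
    by move=> ga g2; rewrite -appb -sg; [apply: h; apply/automorphism_overE|exact: fb].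
  by move=> /automorphism_overE[ga g2]; rewrite sg ?appb; [exact: h|exact: fb].
split; [split|].
- have [k [eo [e he]]] := germ_code_ex Umonster sC sI p0dom p0over TEI UT dq iq2 (fin_vars zo) sZ etaE bb.
  by exists k, eo, e; apply/gc.
- move=> k eo e /gc he.
  pose B := C2 `|` trange e; pose pB := penv (A := B).
  have sB : smV K (par B).
    apply/smV_par/(small_setU Umonster); first exact: small_sub C2A (acl_small Umonster sC).
    apply: small_sub (small_erange (tenv e) (smV_fin Umonster eo)) => u [i _ <-] /=; by exists (Var i).
  (* [a'] is generic over [e] and [C''] besides [b], so that agreement of [f_b] with the graph found
     at [a'] belongs to [q]. *)
  have [a' ra'] := real_ex Umonster (penv (A := acl C)) sA sW (ejoin tb pB) gq (smV_vsum Umonster sZ sB).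
  have rb : real (penv (A := acl C)) q a' tb by apply: (real_sub (rho := fun s v => inr (inl v)) gq ra').
  have /etaE[y hy] : sat eta (ejoin a' (ejoin tb tb)).
    apply: (real_at (rho := fun s (v : vsum Z Z s) => match v with inl z => inr z | inr z => inr z end) eta gq rb _).1 => //.
    by move=> s [].
  have hya : sat F (ejoin a' (ejoin y tb)) by apply/(hy y).1.
  have hfix g : automorphism g -> app g a' = a' -> app g pB = pB -> app g y = y.
    move=> ga gaa gB; apply: (germ_strong Umonster sC sI p0dom p0over dq CC2 C2A iq2 sZ etaE bb he rb hya ga gaa).
    have gBE s (c : U s) : B (existT U s c) -> g s c = c by move: s c; apply/app_penv.
    rewrite app_ejoin; congr ejoin; apply: funext2 => s; first by case=> c hc; apply: gBE; left.
    by case=> i; apply: gBE; right; exists i.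
  have [Gam [fG hGam]] := def_graph Umonster fY sY sW sB hfix.
  pose rG s (v : vsum Y (vsum W (par B)) s) : vsum (vsum W Y) (par B) s :=
    match v with inl y => inl (inr y) | inr (inl w) => inl (inl w) | inr (inr c) => inr c end.
  pose G : lform U (vsum W Y) := rename (@forget_par _ _ _ B) (rename rG Gam).
  have GE (x : env U W) (z : env U Y) : sat G (ejoin (ejoin x z) (fun s c => c)) = sat Gam (ejoin z (ejoin x pB)).
    by rewrite sat_over sat_rename; congr sat; apply: funext2 => s [|[]].
  exists G => graph; split; first by exists (rename rG Gam).
    move=> x z z'; rewrite /graph !GE => /fG h /h e0; apply: functional_extensionality_dep => i.
    exact: (congr1 (fun f : env U Y => f _ (Var i)) e0).
  pose X := vsum (vsum W (vsum Z (par B))) Y.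
  pose r1 s (v : vsum W (vsum Y Z) s) : X s := match v with inl w => inl (inl w) | inr (inl y) => inr y
    | inr (inr z) => inl (inr (inl z)) end.
  pose r2 s (v : vsum Y (vsum W (par B)) s) : X s := match v with inl y => inr y | inr (inl w) => inl (inl w)
    | inr (inr c) => inl (inr (inr c)) end.
  pose psi := FEx fY (FAnd (rename r1 F) (rename r2 Gam)).
  have psiE (x : env U W) : sat psi (ejoin x (ejoin tb pB)) <->
     exists2 z : env U Y, sat F (ejoin x (ejoin z tb)) & sat Gam (ejoin z (ejoin x pB)).
    have e1 z : sat (rename r1 F) (ejoin (ejoin x (ejoin tb pB)) z) = sat F (ejoin x (ejoin z tb)).
      by rewrite sat_rename; congr sat; apply: funext2 => s [|[]].
    have e2 z : sat (rename r2 Gam) (ejoin (ejoin x (ejoin tb pB)) z) = sat Gam (ejoin z (ejoin x pB)).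
      by rewrite sat_rename; congr sat; apply: funext2 => s [|[]].
    by rewrite sat_ex; split=> -[z]; [rewrite sat_and e1 e2 => -[]; exists z|exists z; rewrite sat_and e1 e2].
  exists (rename (sum_map (fun s v => v) (ejoin tb pB)) psi).
    apply/(real_atr psi gq ra')/psiE; exists y => //; exact/hGam.
  move=> x; rewrite /lsat sat_Q psiE; split=> [[z h1 h2]|[z h1 h2]].
    by exists (fun i => z _ (Var i)); rewrite /graph ?GE /sat3 tenvE.
  by exists (tenv z) => //; rewrite -GE.
move=> hSt k eo e /gc he.
have sCa : small K' Ca.
  apply: (small_setU Nmonster); first exact: small_jelt.
  exact: (small_trange_ext Umonster jelem Usmall a sI).
(* The hypothesis of (ii) puts the coordinates of [f(a)] in good sets of [N] over [Ca]; these have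
   to be carried to generic points of [U]. *)
have stl l := St_Good Nmonster sCa (hSt y0 hy0 (existT N _ (y0 l)) (ex_intro2 _ _ l Logic.I erefl)).
pose chiN := thtup (fun l => sval (stl l)).
have GN : Good K' chiN (penv (A := Ca)).
  by apply: (Good_tup Nmonster (smV_par sCa)) => l; case: (proj2_sig (stl l)).
pose jC : env N (par C) := fun s c => j _ (sval c).
(* Each parameter in [Ca] is a coordinate of [a] or comes from [C]. This turns [chiN] into a formula
   [chi] in a variable point and [C]. *)
have rev s (c : par Ca s) : {v : vsum W (par C) s | ejoin (tenv a) jC v = sval c}.
  apply: cid; case: c => c hc /=; case: hc => [[[s' c'] hc' ec]|[i _ ec]].
    apply: (existT_elim (Q := fun t z => exists v : vsum W (par C) t, ejoin (tenv a) jC v = z) ec).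
    by exists (inr (mkpar hc')).
  apply: (existT_elim (Q := fun t z => exists v : vsum W (par C) t, ejoin (tenv a) jC v = z) ec).
  by exists (inl (Var i)).
pose chi : form (vsum Y (vsum W (par C))) := rename (sum_map (fun s v => v) (fun s c => sval (rev s c))) chiN.
have chiE (y : env N Y) : sat chi (ejoin y (ejoin (tenv a) jC)) = sat chiN (ejoin y (penv (A := Ca))).
  rewrite sat_rename; congr sat; apply: funext2 => s [//|c] /=; exact: (proj2_sig (rev s c)).
have realC (D : lsort L -> Type) (r : forall s, D s -> vsum (par (acl C)) Z s) (psi : form (vsum W D)) a' :
    real (penv (A := acl C)) q a' tb ->
    (sat psi (ejoin (tenv a) (fun s v => j _ (ejoin (penv (A := acl C)) tb (r s v)))) <->
     sat psi (ejoin a' (fun s v => ejoin (penv (A := acl C)) tb (r s v)))).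
  by move=> ra'; rewrite -(inq D psi) (real_at (rho := r) psi gq ra').
pose toA s (c : par C s) : par (acl C) s := mkpar (sub_acl (proj2_sig c)).
(* That the fibre of [chi] carries an order of a given length is first-order in the point over [C],
   so it has the same answer at [a'] as at [a]. *)
have hG a' : real (penv (A := acl C)) q a' tb -> Good K chi (ejoin a' (penv (A := C))).
  move=> ra'; apply: GoodS_fin => l wo phi.
  have [i ni] := GN _ (rename (fun s v => v) phi) (smV_fin Nmonster wo); exists i.
  have [om hom] := ord_form phi chi i fY (fin_vars wo).
  move=> /hom/(realC (par C) (fun s c => inl (toA s c)) om a' ra')/hom hO.
  apply: ni; rewrite rename_id; case: hO => x [y [h1 h2]]; exists x, y; split=> // i' hi'.
  by rewrite /mkset -chiE; exact: h1.
pose D := vsum (par C) Z.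
pose rD s (v : D s) : vsum (par (acl C)) Z s := match v with inl c => inl (toA s c) | inr z => inr z end.
pose r1 s (v : vsum W (vsum Y Z) s) : vsum (vsum W D) Y s := match v with inl w => inl (inl w)
  | inr (inl y) => inr y | inr (inr z) => inl (inr (inr z)) end.
pose r2 s (v : vsum Y (vsum W (par C)) s) : vsum (vsum W D) Y s := match v with inl y => inr y
  | inr (inl w) => inl (inl w) | inr (inr c) => inl (inr (inl c)) end.
pose psi := FEx fY (FAnd (rename r1 F) (rename r2 chi)).
have psiE (S : structure L) (x : env S W) (c : env S (par C)) (z : env S Z) : sat psi (ejoin x (ejoin c z)) <->
    exists2 y : env S Y, sat F (ejoin x (ejoin y z)) & sat chi (ejoin y (ejoin x c)).
  have e1 y : sat (rename r1 F) (ejoin (ejoin x (ejoin c z)) y) = sat F (ejoin x (ejoin y z)).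
    by rewrite sat_rename; congr sat; apply: funext2 => s [|[]].
  have e2 y : sat (rename r2 chi) (ejoin (ejoin x (ejoin c z)) y) = sat chi (ejoin y (ejoin x c)).
    by rewrite sat_rename; congr sat; apply: funext2 => s [|[]].
  by rewrite sat_ex; split=> -[y]; [rewrite sat_and e1 e2 => -[]; exists y|exists y; rewrite sat_and e1 e2].
have hF a' y : real (penv (A := acl C)) q a' tb -> sat F (ejoin a' (ejoin y tb)) ->
    sat chi (ejoin y (ejoin a' (penv (A := C)))).
  move=> ra' hy.
  have : sat psi (ejoin (tenv a) (fun s v => j _ (ejoin (penv (A := acl C)) tb (rD s v)))).
    have -> : (fun s v => j _ (ejoin (penv (A := acl C)) tb (rD s v))) = ejoin jC (fun s v => j _ (tb s v)).
      by apply: funext2 => s [].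
    apply/psiE; exists (tenv y0).
      move: hy0; rewrite /sat3; congr sat; apply: funext2 => s [//|[//|[l]]] //.
    by rewrite chiE sat_thtup => l; case: (proj2_sig (stl l)).
  move=> /(realC D rD psi a' ra').
  have -> : (fun s v => ejoin (penv (A := acl C)) tb (rD s v)) = ejoin (penv (A := C)) tb by apply: funext2 => s [].
  by move=> /psiE[y' h1 h2]; rewrite (fF b Ffun a' y y').
have [th [G hth]] := code_good Umonster sC sI p0dom p0over dq C2A sZ etaE bb he hG hF.
exact: (Good_tuple_St Umonster Nmonster jelem Usmall sC G hth).
Qed.
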